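(* Let $\gamma>1$ and let $\phi,\psi\in C^1_b(\mathbb{R})$. Suppose that either $0\le\mu<1$ and $\lambda>0$, or $\mu=1$ and $\lambda>2$. Then there exist a number $\varepsilon_0>0$ and a constant $C>0$ such that, for every $\varepsilon$ with $0<\varepsilon\le\varepsilon_0$, the Cauchy problem $$ \begin{cases} u_t-v_x=0,\\ v_t+p(u)_x=-\dfrac{\lambda}{(1+t)^{\mu}}\,v,\\ (u(0,x),v(0,x))=(1+\varepsilon\phi(x),\,\varepsilon\psi(x)), \end{cases} \qquad t\ge 0,\ x\in\mathbb{R},\qquad p(u)=\frac{u^{-\gamma}}{\gamma}, $$ has a unique global solution $(u,v)$, and its Riemann invariants $$ r=v-\eta(u)+\frac{2}{\gamma-1},\qquad s=v+\eta(u)-\frac{2}{\gamma-1},\qquad \eta(u)=\frac{2}{\gamma-1}u^{-(\gamma-1)/2}, $$ satisfy, for all $t\ge 0$, $$ \|(r_t(t),s_t(t))\|_{L^\infty}+\|(r_x(t),s_x(t))\|_{L^\infty}\le C\varepsilon(1+t)^{-\mu}. $$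
   Context: For $\Omega\subset\mathbb{R}^n$, $C^1_b(\Omega)$ denotes the set of bounded continuous real-valued functions on $\Omega$ whose first partial derivatives exist, are continuous and are bounded on $\Omega$, with norm $\|f\|_{C^1_b(\Omega)}=\|f\|_{L^\infty(\Omega)}+\|(\partial_{x_1}f,\ldots,\partial_{x_n}f)\|_{L^\infty(\Omega)}$. The notation $\|\cdot\|_{L^\infty}$ means $\|\cdot\|_{L^\infty(\mathbb{R})}$ in the spatial variable $x$. Here $u=u(t,x)$ and $v=v(t,x)$ are real-valued. A solution on $[0,T]$ means a pair $(u,v)\in C^1_b([0,T]\times\mathbb{R})\times C^1_b([0,T]\times\mathbb{R})$ with $u$ bounded below by a positive constant on $[0,T]\times\mathbb{R}$, satisfying the equations and the initial condition pointwise. A global solution is a pair $(u,v)$ defined on $[0,\infty)\times\mathbb{R}$ whose restriction to $[0,T]\times\mathbb{R}$ is a solution on $[0,T]$ for every $T>0$; uniqueness is understood in this class. The numbers $\varepsilon_0$ and $C$ may depend on $\gamma,\mu,\lambda,\phi,\psi$, and $C$ does not depend on $t$ or $\varepsilon$. *)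

(* Defs.v *)
From Stdlib Require Import Reals.
From Coquelicot Require Import Coquelicot.
Open Scope R_scope.

Definition C1b_line (f : R -> R) : Prop :=
  (forall x, continuous f x) /\
  (exists M, forall x, Rabs (f x) <= M) /\
  exists f' : R -> R,
    (forall x, is_derive f x (f' x)) /\
    (forall x, continuous f' x) /\
    (exists M, forall x, Rabs (f' x) <= M).

(* Partial derivatives relative to a region Om of the (t,x) plane: the
   increment only ranges over points of Om, so the derivative in t is
   one-sided at t = 0 and at t = T when Om is [0,T] x R. *)
Definition is_dt (Om : R -> R -> Prop) (f : R -> R -> R) (t x l : R) : Prop :=
  D_in (fun s => f s x) (fun _ => l) (fun s => Om s x) t.

Definition is_dx (Om : R -> R -> Prop) (f : R -> R -> R) (t x l : R) : Prop :=
  D_in (fun y => f t y) (fun _ => l) (fun y => Om t y) x.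

Definition jointly_continuous_on (Om : R -> R -> Prop) (f : R -> R -> R) : Prop :=
  continuous_on (fun q : R * R => Om (fst q) (snd q))
                (fun q : R * R => f (fst q) (snd q)).

Definition bounded_on (Om : R -> R -> Prop) (f : R -> R -> R) : Prop :=
  exists M, forall t x, Om t x -> Rabs (f t x) <= M.

Definition C1b (Om : R -> R -> Prop) (f : R -> R -> R) : Prop :=
  jointly_continuous_on Om f /\ bounded_on Om f /\
  exists ft fx : R -> R -> R,
    (forall t x, Om t x -> is_dt Om f t x (ft t x) /\ is_dx Om f t x (fx t x)) /\
    jointly_continuous_on Om ft /\ bounded_on Om ft /\
    jointly_continuous_on Om fx /\ bounded_on Om fx.

Definition strip (T : R) : R -> R -> Prop := fun t _ => 0 <= t <= T.
Definition half_plane : R -> R -> Prop := fun t _ => 0 <= t.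

Definition pressure (gamma u : R) : R := Rpower u (- gamma) / gamma.

Definition eta (gamma u : R) : R :=
  2 / (gamma - 1) * Rpower u (- ((gamma - 1) / 2)).

Definition riemann_r (gamma : R) (u v : R -> R -> R) : R -> R -> R :=
  fun t x => v t x - eta gamma (u t x) + 2 / (gamma - 1).

Definition riemann_s (gamma : R) (u v : R -> R -> R) : R -> R -> R :=
  fun t x => v t x + eta gamma (u t x) - 2 / (gamma - 1).

Definition is_solution (gamma mu lambda : R) (u0 v0 : R -> R) (T : R)
    (u v : R -> R -> R) : Prop :=
  C1b (strip T) u /\ C1b (strip T) v /\
  (exists c, 0 < c /\ forall t x, strip T t x -> c <= u t x) /\
  (forall t x, strip T t x ->
     exists ut vt vx px : R,
       is_dt (strip T) u t x ut /\
       is_dt (strip T) v t x vt /\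
       is_dx (strip T) v t x vx /\
       is_dx (strip T) (fun s y => pressure gamma (u s y)) t x px /\
       ut - vx = 0 /\
       vt + px = - (lambda / Rpower (1 + t) mu) * v t x) /\
  (forall x, u 0 x = u0 x /\ v 0 x = v0 x).

Definition is_global_solution (gamma mu lambda : R) (u0 v0 : R -> R)
    (u v : R -> R -> R) : Prop :=
  forall T, 0 < T -> is_solution gamma mu lambda u0 v0 T u v.

(* The essential supremum is written as a supremum: it is only applied to
   continuous functions of x, for which the two agree.  On pairs, [norm] is
   the Euclidean norm. *)
Definition Linfty_norm {V : NormedModule R_AbsRing} (f : R -> V) : Rbar :=
  Lub_Rbar (fun y => exists x, y = norm (f x)).

(* Main.v *)
Require Import Defs.
From Stdlib Require Import Reals Lra Lia IndefiniteDescription.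
From Coquelicot Require Import Coquelicot.
Open Scope R_scope.

(* In characteristic coordinates ([al] and [be], the feet on [t = 0] of the two
   characteristics through a point) the equations for the Riemann invariants become
   semilinear.  With [theta = s - r], wave speed [c(theta)], [kappa = c' / c],
   [P = t_al], [Q = - t_be], [Y = c r_x P], [V = c s_x Q] and [J = Q Y + P V] they read

     P_be = - kappa J,   Q_al = kappa J,   Y_be = (a / 2) J,   V_al = - (a / 2) J,
     theta_al = - 2 Y,   t_al = P,

   where [a] is the damping coefficient; [x] and [v] are then primitives of closed
   forms.  Truncating the products in [J] makes the right-hand side globally Lipschitz,
   so Picard iteration solves the system on the whole plane, and a priori estimates show
   that the truncation is never active on [0 <= al - be <= W]: [|r|, |s|] do not exceed
   their initial maximum, and the Riccati variable [sqrt c r_x], after subtraction of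
   [a G(theta)] with [G' = 1 / (4 sqrt c)], stays below the barrier
   [K eps (B + t)^(-mu)], which is a supersolution precisely under the assumption on
   [mu] and [lambda].  The map from [(al, be)] to [(t, x)] is bi-Lipschitz on such a
   strip, which gives a solution on every time interval; the solutions fit together by
   uniqueness, proved by comparing two solutions along the characteristics of one. *)

(** * Continuous and continuously differentiable functions on the plane *)

(** With data only in [C^1] the gradients are merely continuous, and an iteration that
    differentiates the solution along its own characteristics would lose a derivative. Taking [Y]
    and [V] as unknowns next to [P] and [Q] avoids this: every equation is an ordinary differential
    equation along a coordinate line and contains no derivative of another unknown. The factor
    [sqrt c] in the Riccati variable is there because it cancels the part of [P_be] that contains
    [V]. The danger of circularity lies in the truncation level. It is chosen from the width [W]
    alone, which is possible because [t <= a - b] follows from the bounds [1/2 <= c <= 2], not from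
    the bound on [P] that is being proved. The decay estimate itself never depends on [W]. Sizes:
    data of size [eps] give invariants of size [m eps] and a barrier of size [K eps]. All error
    terms decay like [(1 + t)^(-2 mu)], as does damping times barrier. Errors linear in [eps] are
    beaten by a large [K], fixed first; the Riccati square, of size [eps^2], is beaten by a small
    [eps]. *)

Definition jcont (f : R -> R -> R) : Prop := forall a b, continuity_2d_pt f a b.

Definition flip (f : R -> R -> R) : R -> R -> R := fun a b => f b a.

Lemma jcont_flip (f : R -> R -> R) : jcont f -> jcont (flip f).
Proof.
  intros H a b eps. destruct (H b a eps) as [d Hd].
  exists d. intros u v Hu Hv. apply Hd; assumption.
Qed.

Lemma jcont_comp2 (f g h : R -> R -> R) :
  jcont f -> jcont g -> jcont h -> jcont (fun a b => f (g a b) (h a b)).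
Proof.
  intros Hf Hg Hh a b eps.
  destruct (Hf (g a b) (h a b) eps) as [d Hd].
  destruct (Hg a b d) as [d1 Hd1].
  destruct (Hh a b d) as [d2 Hd2].
  assert (Hm : 0 < Rmin d1 d2) by (apply Rmin_pos; apply cond_pos).
  exists (mkposreal _ Hm). simpl. intros u v Hu Hv.
  assert (A1 := Rmin_l d1 d2). assert (A2 := Rmin_r d1 d2).
  apply Hd; [apply Hd1 | apply Hd2]; lra.
Qed.

Lemma jcont_comp1 (f : R -> R) (g : R -> R -> R) :
  (forall x, continuous f x) -> jcont g -> jcont (fun a b => f (g a b)).
Proof.
  intros Hf Hg a b. apply continuity_1d_2d_pt_comp; [|apply Hg].
  apply continuity_pt_filterlim. apply Hf.
Qed.

Lemma jcont_fst : jcont (fun a _ => a).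
Proof. intros a b. apply continuity_2d_pt_id1. Qed.

Lemma jcont_snd : jcont (fun _ b => b).
Proof. intros a b. apply continuity_2d_pt_id2. Qed.

Lemma jcont_const (c : R) : jcont (fun _ _ => c).
Proof. intros a b. apply continuity_2d_pt_const. Qed.

Lemma jcont_plus (f g : R -> R -> R) :
  jcont f -> jcont g -> jcont (fun a b => f a b + g a b).
Proof. intros H H' a b. apply continuity_2d_pt_plus; auto. Qed.

Lemma jcont_minus (f g : R -> R -> R) :
  jcont f -> jcont g -> jcont (fun a b => f a b - g a b).
Proof. intros H H' a b. apply continuity_2d_pt_minus; auto. Qed.

Lemma jcont_mult (f g : R -> R -> R) :
  jcont f -> jcont g -> jcont (fun a b => f a b * g a b).
Proof. intros H H' a b. apply continuity_2d_pt_mult; auto. Qed.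

Lemma jcont_opp (f : R -> R -> R) :
  jcont f -> jcont (fun a b => - f a b).
Proof. intros H a b. apply continuity_2d_pt_opp; auto. Qed.

Lemma jcont_ext (f g : R -> R -> R) :
  (forall a b, f a b = g a b) -> jcont f -> jcont g.
Proof. intros H Hf a b. now apply continuity_2d_pt_ext with f. Qed.

Lemma jcont_slice1 (f : R -> R -> R) (b a : R) :
  jcont f -> continuous (fun x => f x b) a.
Proof.
  intros H. apply continuity_pt_filterlim.
  intros eps Heps. destruct (H a b (mkposreal eps Heps)) as [d Hd].
  exists d. split; [apply cond_pos|].
  intros x [_ Hx]. apply Hd; [exact Hx|].
  rewrite Rminus_diag, Rabs_R0. apply cond_pos.
Qed.

Lemma ex_RInt_cont (f : R -> R) (a b : R) :
  (forall x, continuous f x) -> ex_RInt f a b.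
Proof. intros H. apply (ex_RInt_continuous (V := R_CompleteNormedModule)). auto. Qed.

Lemma Rabs_RInt_le (f : R -> R) (a b M : R) :
  (forall x, continuous f x) ->
  (forall x, Rmin a b <= x <= Rmax a b -> Rabs (f x) <= M) ->
  Rabs (RInt f a b) <= M * Rabs (b - a).
Proof.
  intros Hc HM. destruct (Rle_dec a b) as [h|h].
  - rewrite (Rabs_pos_eq (b - a)) by lra. rewrite Rmult_comm.
    apply abs_RInt_le_const; [exact h | now apply ex_RInt_cont |].
    intros t Ht. apply HM. now rewrite Rmin_left, Rmax_right by lra.
  - rewrite <- (opp_RInt_swap f) by now apply ex_RInt_cont.
    unfold opp; simpl. rewrite Rabs_Ropp, (Rabs_left (b - a)) by lra.
    replace (M * - (b - a)) with ((a - b) * M) by ring.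
    apply abs_RInt_le_const; [lra | now apply ex_RInt_cont |].
    intros t Ht. apply HM. now rewrite Rmin_right, Rmax_left by lra.
Qed.

Lemma RInt_Chasles_R (f : R -> R) (a b c : R) :
  (forall x, continuous f x) -> RInt f a b + RInt f b c = RInt f a c.
Proof. intros H. apply (RInt_Chasles f); now apply ex_RInt_cont. Qed.

Lemma is_derive_RInt_cont (f : R -> R) (a b : R) :
  (forall x, continuous f x) -> is_derive (fun x => RInt f a x) b (f b).
Proof.
  intros H. apply (is_derive_RInt f _ a b); [|apply H].
  apply filter_forall. intros x. apply (RInt_correct (V := R_CompleteNormedModule)), ex_RInt_cont, H.
Qed.

(** The increment splits into the change of the integrand over the fixed interval from [0] to [a0],
    small by uniform continuity, and the integral over the short piece from [a0] to [a], small
    because [f] is bounded nearby. *)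
Lemma jcont_RInt0 (f : R -> R -> R) :
  jcont f -> jcont (fun a b => RInt (fun x => f x b) 0 a).
Proof.
  intros Hf a0 b0 eps.
  set (lo := Rmin 0 a0 - 1). set (hi := Rmax 0 a0 + 1).
  assert (Hlo : lo <= -1 /\ lo <= a0 - 1).
  { unfold lo. generalize (Rmin_l 0 a0) (Rmin_r 0 a0). lra. }
  assert (Hhi : 1 <= hi /\ a0 + 1 <= hi).
  { unfold hi. generalize (Rmax_l 0 a0) (Rmax_r 0 a0). lra. }
  assert (HS : forall b x, continuous (fun y => f y b) x).
  { intros b x. now apply jcont_slice1. }
  destruct (bounded_continuity (V := R_NormedModule) (fun x => f x b0) lo hi) as [M HM].
  { intros x _. apply HS. }
  assert (HM0 : 0 < M).
  { specialize (HM lo ltac:(lra)). simpl in HM.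
    eapply Rle_lt_trans; [|exact HM]. apply (norm_ge_0 (V := R_NormedModule)). }
  assert (Ha : 0 < 1 + Rabs a0) by (generalize (Rabs_pos a0); lra).
  (* The cap at [1] turns the bound [M] on the slice at [b0] into the bound [M + 1] on nearby
     slices. *)
  set (e1 := Rmin 1 (eps / (2 * (1 + Rabs a0)))).
  assert (He1 : 0 < e1).
  { apply Rmin_pos; [lra|]. apply Rdiv_lt_0_compat; [apply cond_pos | lra]. }
  destruct (uniform_continuity_2d_1d f lo hi b0 (fun x _ => Hf x b0) (mkposreal e1 He1))
    as [d Hd]. simpl in Hd.
  assert (Hc : forall x b, lo <= x <= hi -> Rabs (b - b0) < d -> Rabs (f x b - f x b0) < e1).
  { intros x b Hx Hb. assert (Hb' := Rabs_def2 _ _ Hb). destruct Hb' as [B1 B2].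
    assert (dp := cond_pos d).
    apply Hd; try lra. rewrite Rminus_diag, Rabs_R0. exact dp. }
  set (d2 := Rmin 1 (eps / (2 * (M + 1)))).
  assert (Hd2 : 0 < d2).
  { apply Rmin_pos; [lra|]. apply Rdiv_lt_0_compat; [apply cond_pos | lra]. }
  assert (Hm : 0 < Rmin d d2) by (apply Rmin_pos; [apply cond_pos | exact Hd2]).
  exists (mkposreal _ Hm). simpl. intros a b Hua Hvb.
  assert (A1 := Rmin_l d d2). assert (A2 := Rmin_r d d2).
  assert (A3 : d2 <= 1) by apply Rmin_l.
  assert (A4 : e1 <= 1) by apply Rmin_l.
  assert (Habs : Rabs (a - a0) < d2) by lra.
  assert (Habs' := Rabs_def2 _ _ Habs).
  rewrite <- (RInt_Chasles_R (fun x => f x b) 0 a0 a) by auto.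
  assert (E : RInt (fun x => f x b) 0 a0 - RInt (fun x => f x b0) 0 a0
              = RInt (fun x => f x b - f x b0) 0 a0).
  { symmetry. apply (RInt_minus (V := R_CompleteNormedModule)); apply ex_RInt_cont; auto. }
  replace (RInt (fun x => f x b) 0 a0 + RInt (fun x => f x b) a0 a - RInt (fun x => f x b0) 0 a0)
    with ((RInt (fun x => f x b) 0 a0 - RInt (fun x => f x b0) 0 a0) + RInt (fun x => f x b) a0 a)
    by ring.
  rewrite E.
  apply Rle_lt_trans with (e1 * Rabs (a0 - 0) + (M + 1) * Rabs (a - a0)).
  { eapply Rle_trans; [apply Rabs_triang|]. apply Rplus_le_compat.
    - apply Rabs_RInt_le.
      + intros x. apply (continuous_minus (V := R_NormedModule)); apply HS.
      + intros x Hx. apply Rlt_le, Hc; [|lra].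
        unfold lo, hi. lra.
    - apply Rabs_RInt_le; [auto|].
      intros x Hx.
      assert (lo <= x <= hi).
      { destruct (Rle_dec a0 a); [rewrite Rmin_left, Rmax_right in Hx by lra
                                 | rewrite Rmin_right, Rmax_left in Hx by lra]; lra. }
      specialize (HM x H). specialize (Hc x b H ltac:(lra)).
      unfold norm in HM; simpl in HM. unfold abs in HM; simpl in HM.
      replace (f x b) with ((f x b - f x b0) + f x b0) by ring.
      eapply Rle_trans; [apply Rabs_triang|]. lra. }
  rewrite Rminus_0_r.
  assert (B1 : e1 * Rabs a0 <= eps / 2).
  { apply Rle_trans with (eps / (2 * (1 + Rabs a0)) * (1 + Rabs a0)).
    - apply Rmult_le_compat; try lra; [apply Rabs_pos | apply Rmin_r].
    - right. field. lra. }
  assert (B2 : (M + 1) * Rabs (a - a0) < eps / 2).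
  { apply Rlt_le_trans with ((M + 1) * (eps / (2 * (M + 1)))).
    - apply Rmult_lt_compat_l; [lra|]. eapply Rlt_le_trans; [exact Habs | apply Rmin_r].
    - right. field. lra. }
  lra.
Qed.

(** The integral starts on the diagonal because the diagonal is the initial line [t = 0] in
    characteristic coordinates. Integration in the second coordinate is the same operation after
    [flip]. *)
Definition int1 (f : R -> R -> R) : R -> R -> R := fun a b => RInt (fun x => f x b) b a.

Lemma jcont_int1 (f : R -> R -> R) : jcont f -> jcont (int1 f).
Proof.
  intros Hf.
  apply jcont_ext with (fun a b => RInt (fun x => f x b) 0 a - RInt (fun x => f x b) 0 b).
  { intros a b. unfold int1.
    rewrite <- (RInt_Chasles_R (fun x => f x b) 0 b a) by (intros; now apply jcont_slice1).
    ring. }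
  assert (H := jcont_RInt0 f Hf).
  apply jcont_minus; [exact H|].
  apply (jcont_comp2 (fun a b => RInt (fun x => f x b) 0 a) (fun _ b => b) (fun _ b => b));
    auto using jcont_snd.
Qed.

Lemma int1_diag (f : R -> R -> R) (a : R) : int1 f a a = 0.
Proof. unfold int1. apply (RInt_point (V := R_CompleteNormedModule)). Qed.

Lemma is_derive_int1_fst (f : R -> R -> R) (a b : R) :
  jcont f -> is_derive (fun x => int1 f x b) a (f a b).
Proof.
  intros Hf. apply (is_derive_RInt_cont (fun x => f x b)).
  intros x. now apply jcont_slice1.
Qed.

Lemma is_derive_int1_snd (f fb : R -> R -> R) (a b : R) :
  jcont f -> jcont fb -> (forall a b, is_derive (fun y => f a y) b (fb a b)) ->
  is_derive (fun y => int1 f a y) b (int1 fb a b - f b b).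
Proof.
  intros Hf Hfb Hd. unfold int1.
  assert (HS : forall b x, continuous (fun y => f y b) x).
  { intros b' x. now apply jcont_slice1. }
  assert (HD : forall x y, Derive (fun z => f y z) x = fb y x).
  { intros x y. apply is_derive_unique, Hd. }
  assert (HC : forall x y, continuity_2d_pt (fun u v => Derive (fun z => f v z) u) x y).
  { intros x y. apply continuity_2d_pt_ext with (flip fb).
    - intros u v. symmetry. apply HD.
    - now apply jcont_flip. }
  assert (K := is_derive_RInt_param_bound_comp_aux2 (flip f) (fun y => y) a b 1).
  unfold flip in K.
  replace (RInt (fun x => fb x b) b a - f b b)
    with (RInt (fun t => Derive (fun u => f t u) b) b a + - f b b * 1).
  2: { rewrite (RInt_ext _ (fun x => fb x b)); [ring | intros; apply HD]. }
  apply K.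
  - apply filter_forall. intros y. now apply ex_RInt_cont.
  - exists (mkposreal 1 Rlt_0_1). apply filter_forall. intros y. now apply ex_RInt_cont.
  - apply (is_derive_id (K := R_AbsRing)).
  - exists (mkposreal 1 Rlt_0_1). apply filter_forall. intros y t _. eexists. apply Hd.
  - intros t _. apply HC.
  - exists (mkposreal 1 Rlt_0_1). intros u v _ _. apply HC.
  - apply continuity_pt_filterlim, HS.
Qed.

Definition C1_plane (f fa fb : R -> R -> R) : Prop :=
  (forall a b, is_derive (fun x => f x b) a (fa a b)) /\
  (forall a b, is_derive (fun y => f a y) b (fb a b)) /\
  jcont fa /\ jcont fb.

(** Only the first partial derivative has to exist nearby and be continuous; the second is needed at
    the point alone. In the uniqueness proof this makes continuity of the time derivatives
    sufficient. *)
Lemma differentiable_of_partials (f fa : R -> R -> R) (a b db : R) :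
  locally_2d (fun x y => is_derive (fun z => f z y) x (fa x y)) a b ->
  is_derive (fun y => f a y) b db ->
  continuity_2d_pt fa a b ->
  differentiable_pt_lim f a b (fa a b) db.
Proof.
  intros [d Hd] H2 H3. apply filterdiff_differentiable_pt_lim.
  apply filterdiff_ext_lin with (fun u : R * R => plus (scal (fst u) (fa a b)) (scal (snd u) db)).
  2: { intros u. reflexivity. }
  apply is_derive_filterdiff; auto.
  - exists d. intros [u v] [Hu Hv]. apply Hd; assumption.
  - apply continuity_2d_pt_filterlim in H3. exact H3.
Qed.

Lemma C1_plane_differentiable (f fa fb : R -> R -> R) (a b : R) :
  C1_plane f fa fb -> differentiable_pt_lim f a b (fa a b) (fb a b).
Proof.
  intros (H1 & H2 & H3 & H4).
  apply differentiable_of_partials; auto.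
  exists (mkposreal 1 Rlt_0_1). intros; apply H1.
Qed.

Lemma C1_plane_jcont (f fa fb : R -> R -> R) : C1_plane f fa fb -> jcont f.
Proof.
  intros H a b. apply differentiable_continuity_pt.
  exists (fa a b), (fb a b). now apply C1_plane_differentiable.
Qed.

Lemma C1_plane_int1 (f fb : R -> R -> R) :
  jcont f -> jcont fb -> (forall a b, is_derive (fun y => f a y) b (fb a b)) ->
  C1_plane (int1 f) f (fun a b => int1 fb a b - f b b).
Proof.
  intros Hf Hfb Hd. split; [|split; [|split]].
  - intros a b. now apply is_derive_int1_fst.
  - intros a b. now apply is_derive_int1_snd.
  - exact Hf.
  - apply jcont_minus; [now apply jcont_int1|].
    apply (jcont_comp2 f (fun _ b => b) (fun _ b => b)); auto using jcont_snd.
Qed.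

(** The one-variable theorem on the segment: the intermediate point stays in every convex set
    containing both ends, in particular in the strip on which the partial derivatives are
    controlled. *)
Lemma C1_plane_MVT (f fa fb : R -> R -> R) (a1 b1 a2 b2 : R) :
  C1_plane f fa fb ->
  exists s, 0 <= s <= 1 /\
    f a2 b2 - f a1 b1 =
      fa (a1 + s * (a2 - a1)) (b1 + s * (b2 - b1)) * (a2 - a1) +
      fb (a1 + s * (a2 - a1)) (b1 + s * (b2 - b1)) * (b2 - b1).
Proof.
  intros Hf.
  set (A := fun s => a1 + s * (a2 - a1)). set (B := fun s => b1 + s * (b2 - b1)).
  assert (HD : forall s, is_derive (fun s => f (A s) (B s)) s
             (fa (A s) (B s) * (a2 - a1) + fb (A s) (B s) * (b2 - b1))).
  { intros s. apply is_derive_Reals.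
    apply (derivable_pt_lim_comp_2d f A B).
    - now apply C1_plane_differentiable.
    - apply is_derive_Reals. unfold A. auto_derive; [trivial | ring].
    - apply is_derive_Reals. unfold B. auto_derive; [trivial | ring]. }
  destruct (MVT_gen _ 0 1 _ (fun x _ => HD x)) as [s [Hs He]].
  { intros x _. apply continuity_pt_filterlim.
    apply (ex_derive_continuous (fun s => f (A s) (B s))). eexists. apply HD. }
  exists s. rewrite Rmin_left, Rmax_right in Hs by lra. split; [exact Hs|].
  unfold A, B in He |- *.
  replace (a1 + 1 * (a2 - a1)) with a2 in He by ring.
  replace (b1 + 1 * (b2 - b1)) with b2 in He by ring.
  replace (a1 + 0 * (a2 - a1)) with a1 in He by ring.
  replace (b1 + 0 * (b2 - b1)) with b1 in He by ring.
  rewrite He. ring.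
Qed.

(** * Picard iteration along coordinate lines *)

Lemma geometric_limit (x : nat -> R) (e : R) :
  (forall n, Rabs (x (S n) - x n) <= e * (/2) ^ n) ->
  exists l, forall n, Rabs (x n - l) <= 2 * e * (/2) ^ n.
Proof.
  intros H.
  (* The factor [1 - (/2) ^ m] makes the induction on [m] close; it is dropped right after. *)
  assert (Hd : forall n m, Rabs (x (n + m)%nat - x n) <= 2 * e * (/2) ^ n * (1 - (/2) ^ m)).
  { intros n m. induction m as [|m IH].
    - rewrite Nat.add_0_r, Rminus_diag, Rabs_R0. simpl. lra.
    - rewrite Nat.add_succ_r. specialize (H (n + m)%nat).
      replace (x (S (n + m)) - x n) with ((x (S (n + m)) - x (n + m)%nat) + (x (n + m)%nat - x n)) by ring.
      eapply Rle_trans; [apply Rabs_triang|].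
      rewrite pow_add in H. simpl. 
      replace (2 * e * (/ 2) ^ n * (1 - / 2 * (/ 2) ^ m))
        with (e * ((/ 2) ^ n * (/ 2) ^ m) + 2 * e * (/ 2) ^ n * (1 - (/ 2) ^ m)) by field.
      lra. }
  assert (He : 0 <= e).
  { specialize (H 0%nat). simpl in H. rewrite Rmult_1_r in H.
    eapply Rle_trans; [apply Rabs_pos | exact H]. }
  assert (Hp : forall n, 0 < (/2) ^ n) by (intros; apply pow_lt; lra).
  assert (Hd' : forall n m, Rabs (x (n + m)%nat - x n) <= 2 * e * (/2) ^ n).
  { intros n m. eapply Rle_trans; [apply Hd|].
    rewrite <- (Rmult_1_r (2 * e * (/2) ^ n)) at 2.
    apply Rmult_le_compat_l; [|generalize (Hp m); lra].
    apply Rmult_le_pos; [lra | apply Rlt_le, Hp]. }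
  assert (Hlim : is_lim_seq (fun n => 2 * e * (/2) ^ n) 0).
  { replace (Finite 0) with (Rbar_mult (2 * e) 0) by (simpl; f_equal; ring).
    apply is_lim_seq_scal_l, is_lim_seq_geom. rewrite Rabs_pos_eq; lra. }
  assert (Hex : ex_finite_lim_seq x).
  { apply ex_lim_seq_cauchy_corr. intros eps.
    apply is_lim_seq_spec in Hlim. destruct (Hlim (pos_div_2 eps)) as [N HN].
    exists N. intros n m Hn Hm.
    specialize (HN N (le_n _)). rewrite Rminus_0_r in HN. simpl in HN.
    rewrite Rabs_pos_eq in HN.
    2:{ apply Rmult_le_pos; [lra | apply Rlt_le, Hp]. }
    replace (x n - x m) with ((x n - x N) - (x m - x N)) by ring.
    eapply Rle_lt_trans; [apply Rabs_triang|]. rewrite Rabs_Ropp.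
    replace n with (N + (n - N))%nat by lia. replace m with (N + (m - N))%nat by lia.
    generalize (Hd' N (n - N)%nat) (Hd' N (m - N)%nat). lra. }
  destruct Hex as [l Hl]. exists l. intros n.
  rewrite Rabs_minus_sym.
  assert (Hl' : is_lim_seq (fun m => Rabs (x (n + m)%nat - x n)) (Rabs (l - x n))).
  { apply (is_lim_seq_abs _ (l - x n)). apply is_lim_seq_minus'; [|apply is_lim_seq_const].
    apply is_lim_seq_ext with (fun m => x (m + n)%nat); [intros; f_equal; lia|].
    now apply is_lim_seq_incr_n. }
  apply (is_lim_seq_le _ _ (Rabs (l - x n)) (2 * e * (/2) ^ n) (Hd' n) Hl' (is_lim_seq_const _)).
Qed.

Lemma exp_le_compat (x y : R) : x <= y -> exp x <= exp y.
Proof. intros [h|<-]; [now apply Rlt_le, exp_increasing | apply Rle_refl]. Qed.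

(** The weight grows away from the diagonal in both directions, so integrating it from the diagonal
    reproduces it with a gain [1 / Lam]. *)
Lemma Rabs_int1_exp_le (f : R -> R -> R) (D Lam a b : R) :
  jcont f -> 0 < Lam ->
  (forall x, Rabs (f x b) <= D * exp (Lam * Rabs (x - b))) ->
  Rabs (int1 f a b) <= D / Lam * exp (Lam * Rabs (a - b)).
Proof.
  intros Hf HL HB. unfold int1.
  assert (HC : forall x, continuous (fun x => f x b) x) by (intros; now apply jcont_slice1).
  assert (HD : 0 <= D).
  { specialize (HB b). rewrite Rminus_diag, Rabs_R0, Rmult_0_r, exp_0 in HB.
    generalize (Rabs_pos (f b b)). lra. }
  assert (HDL : 0 <= D / Lam) by (apply Rdiv_le_0_compat; lra).
  destruct (Rle_dec b a) as [h|h].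
  - apply Rle_trans with (D / Lam * exp (Lam * (a - b)) - D / Lam * exp (Lam * (b - b))).
    + apply (norm_RInt_le (V := R_NormedModule) (fun x => f x b) (fun x => D * exp (Lam * (x - b))) b a); [exact h| | |].
      * intros x Hx. specialize (HB x). now rewrite (Rabs_pos_eq (x - b)) in HB by lra.
      * apply (RInt_correct (V := R_CompleteNormedModule)). now apply ex_RInt_cont.
      * apply (is_RInt_derive (fun x => D / Lam * exp (Lam * (x - b)))).
        -- intros x _. auto_derive; [trivial|]. unfold Rminus. field. lra.
        -- intros x _. apply (ex_derive_continuous (fun x => D * exp (Lam * (x - b)))). auto_derive. trivial.
    + rewrite Rminus_diag, Rmult_0_r, exp_0, Rabs_pos_eq by lra. lra.
  - rewrite <- (opp_RInt_swap (fun x => f x b)) by now apply ex_RInt_cont.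
    unfold opp; simpl. rewrite Rabs_Ropp.
    apply Rle_trans with (- (D / Lam) * exp (Lam * (b - b)) - - (D / Lam) * exp (Lam * (b - a))).
    + apply (norm_RInt_le (V := R_NormedModule) (fun x => f x b) (fun x => D * exp (Lam * (b - x))) a b); [lra| | |].
      * intros x Hx. specialize (HB x).
        rewrite (Rabs_left1 (x - b)) in HB by lra.
        now replace (- (x - b)) with (b - x) in HB by ring.
      * apply (RInt_correct (V := R_CompleteNormedModule)). now apply ex_RInt_cont.
      * apply (is_RInt_derive (fun x => - (D / Lam) * exp (Lam * (b - x)))).
        -- intros x _. auto_derive; [trivial|]. unfold Rminus. field. lra.
        -- intros x _. apply (ex_derive_continuous (fun x => D * exp (Lam * (b - x)))). auto_derive. trivial.
    + rewrite Rminus_diag, Rmult_0_r, exp_0, Rabs_left by lra.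
      replace (- (a - b)) with (b - a) by ring. lra.
Qed.

Lemma int1_minus (f g : R -> R -> R) (a b : R) :
  jcont f -> jcont g -> int1 (fun a b => f a b - g a b) a b = int1 f a b - int1 g a b.
Proof.
  intros Hf Hg. unfold int1.
  apply (RInt_minus (V := R_CompleteNormedModule) (fun x => f x b) (fun x => g x b)); apply ex_RInt_cont; intros; now apply jcont_slice1.
Qed.

(* Each unknown [U i] solves an ordinary differential equation along one of the two
   coordinate directions ([dir i = true]: the first), with data on the diagonal. *)
Section Picard.
Variables (dir : nat -> bool) (g : nat -> R -> R).
Variable F : nat -> R -> R -> (nat -> R) -> R.
Variables L C : R.
Hypothesis Lpos : 0 < L.
Hypothesis g_cont : forall i x, continuous (g i) x.
Hypothesis F_cont : forall U, (forall j, jcont (U j)) ->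
  forall i, jcont (fun a b => F i a b (fun j => U j a b)).
Hypothesis F_lip : forall i a b z z' D,
  (forall j, Rabs (z j - z' j) <= D) -> Rabs (F i a b z - F i a b z') <= L * D.

Let U0 (i : nat) (a b : R) := g i (if dir i then b else a).

Hypothesis F_bound : forall i a b, Rabs (F i a b (fun j => U0 j a b)) <= C.

Definition picard_op (U : nat -> R -> R -> R) (i : nat) (a b : R) : R :=
  let f := fun a b => F i a b (fun j => U j a b) in
  U0 i a b + (if dir i then int1 f a b else int1 (flip f) b a).

Lemma jcont_U0 i : jcont (U0 i).
Proof.
  unfold U0. destruct (dir i).
  - apply (jcont_comp1 (g i) (fun _ b => b)); auto using jcont_snd.
  - apply (jcont_comp1 (g i) (fun a _ => a)); auto using jcont_fst.
Qed.

Lemma jcont_picard_op U : (forall j, jcont (U j)) -> forall i, jcont (picard_op U i).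
Proof.
  intros HU i. unfold picard_op. apply jcont_plus; [apply jcont_U0|].
  destruct (dir i).
  - apply jcont_int1, F_cont, HU.
  - apply (jcont_flip (int1 (flip (fun a b => F i a b (fun j => U j a b))))).
    apply jcont_int1, jcont_flip, F_cont, HU.
Qed.

(** With the weight [exp (2 * L * Rabs (a - b))] one integration gains [1 / (2 * L)] against the
    Lipschitz constant [L]. The operator thus contracts by one half on the whole plane, without any
    restriction to a small neighbourhood of the diagonal. *)
Lemma picard_op_contract U U' D :
  (forall j, jcont (U j)) -> (forall j, jcont (U' j)) ->
  (forall j a b, Rabs (U j a b - U' j a b) <= D * exp (2 * L * Rabs (a - b))) ->
  forall i a b, Rabs (picard_op U i a b - picard_op U' i a b)
                <= D / 2 * exp (2 * L * Rabs (a - b)).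
Proof.
  intros HU HU' HD i a b. unfold picard_op.
  set (f := fun a b => F i a b (fun j => U j a b)).
  set (f' := fun a b => F i a b (fun j => U' j a b)).
  assert (Hf : jcont f) by now apply F_cont.
  assert (Hf' : jcont f') by now apply F_cont.
  assert (Hff : forall a b, Rabs (f a b - f' a b) <= L * D * exp (2 * L * Rabs (a - b))).
  { intros x y. rewrite Rmult_assoc. apply F_lip. intros j. apply HD. }
  replace (D / 2) with (L * D / (2 * L)) by (field; lra).
  match goal with |- Rabs (U0 i a b + ?p - (U0 i a b + ?q)) <= _ =>
    replace (U0 i a b + p - (U0 i a b + q)) with (p - q) by ring end.
  destruct (dir i).
  - rewrite <- int1_minus by assumption.
    apply (Rabs_int1_exp_le (fun a b => f a b - f' a b)); [now apply jcont_minus | lra |].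
    intros x. apply Hff.
  - rewrite <- int1_minus by now apply jcont_flip.
    rewrite (Rabs_minus_sym a b).
    apply (Rabs_int1_exp_le (fun a b => flip f a b - flip f' a b)); [| lra |].
    + apply jcont_minus; now apply jcont_flip.
    + intros x. unfold flip. rewrite Rabs_minus_sym, (Rabs_minus_sym x).
      rewrite Rabs_minus_sym. apply Hff.
Qed.

Fixpoint picard_seq (n : nat) : nat -> R -> R -> R :=
  match n with O => U0 | S n => picard_op (picard_seq n) end.

Lemma jcont_picard_seq n j : jcont (picard_seq n j).
Proof.
  revert j. induction n as [|n IH]; simpl.
  - apply jcont_U0.
  - now apply jcont_picard_op.
Qed.

Lemma picard_seq_step n i a b :
  Rabs (picard_seq (S n) i a b - picard_seq n i a b)
  <= C / (2 * L) * exp (2 * L * Rabs (a - b)) * (/2) ^ n.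
Proof.
  revert i a b. induction n as [|n IH]; intros i a b.
  - simpl. rewrite Rmult_1_r. unfold picard_op. 
    match goal with |- Rabs (?u + ?p - ?u) <= _ => replace (u + p - u) with p by ring end.
    assert (Hf := F_cont U0 jcont_U0 i).
    assert (HC : 0 <= C) by (eapply Rle_trans; [apply Rabs_pos | apply (F_bound i 0 0)]).
    assert (Hle : forall x y, C <= C * exp (2 * L * Rabs (x - y))).
    { intros x y. rewrite <- (Rmult_1_r C) at 1. apply Rmult_le_compat_l; [exact HC|].
      rewrite <- exp_0. apply exp_le_compat. apply Rmult_le_pos; [lra | apply Rabs_pos]. }
    destruct (dir i).
    + apply Rabs_int1_exp_le; [exact Hf | lra |].
      intros x. eapply Rle_trans; [apply F_bound | apply Hle].
    + rewrite (Rabs_minus_sym a b).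
      apply Rabs_int1_exp_le; [now apply jcont_flip | lra |].
      intros x. eapply Rle_trans; [apply F_bound | apply Hle].
  - replace (C / (2 * L) * exp (2 * L * Rabs (a - b)) * (/ 2) ^ S n)
      with ((C / (2 * L) * (/2) ^ n) / 2 * exp (2 * L * Rabs (a - b))) by (simpl; field; lra).
    apply (picard_op_contract (picard_seq (S n)) (picard_seq n) _ (jcont_picard_seq (S n)) (jcont_picard_seq n)).
    intros j x y. eapply Rle_trans; [apply IH | right; ring].
Qed.

Theorem picard_integral :
  exists U : nat -> R -> R -> R,
    (forall j, jcont (U j)) /\ forall i a b, U i a b = picard_op U i a b.
Proof.
  set (B := C / (2 * L)).
  assert (HB : 0 <= B).
  { apply Rdiv_le_0_compat; [|lra].
    eapply Rle_trans; [apply Rabs_pos | apply (F_bound 0%nat 0 0)]. }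
  assert (HU : forall q : nat * (R * R), exists l, forall n,
     Rabs (picard_seq n (fst q) (fst (snd q)) (snd (snd q)) - l)
     <= 2 * (B * exp (2 * L * Rabs (fst (snd q) - snd (snd q)))) * (/2) ^ n).
  { intros [i [a b]]. simpl. apply geometric_limit. intros n. apply picard_seq_step. }
  destruct (functional_choice _ HU) as [U' HU'].
  set (U := fun i a b => U' (i, (a, b))).
  assert (Hlim : forall n i a b, Rabs (picard_seq n i a b - U i a b)
            <= 2 * B * (/2) ^ n * exp (2 * L * Rabs (a - b))).
  { intros n i a b. eapply Rle_trans; [apply (HU' (i, (a, b)) n) | right; simpl; ring]. }
  assert (Hp : forall n, 0 < (/2) ^ n) by (intros; apply pow_lt; lra).
  assert (Hsmall : forall K eps, 0 < eps -> 0 <= K -> exists n, K * (/2) ^ n < eps).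
  { intros K eps He HK.
    destruct (pow_lt_1_zero (/2) ltac:(rewrite Rabs_pos_eq; lra) (eps / (K + 1))) as [N HN].
    { apply Rdiv_lt_0_compat; lra. }
    exists N. specialize (HN N (le_n _)). rewrite Rabs_pos_eq in HN by (apply Rlt_le, Hp).
    apply Rle_lt_trans with ((K + 1) * (/2) ^ N).
    { apply Rmult_le_compat_r; [apply Rlt_le, Hp | lra]. }
    apply Rlt_le_trans with ((K + 1) * (eps / (K + 1))).
    { apply Rmult_lt_compat_l; lra. }
    right. field. lra. }
  assert (HUc : forall j, jcont (U j)).
  { intros j a b eps.
    (* Within distance [1] in each coordinate the weight is at most its value at [Rabs (a - b) + 2];
       convergence is therefore locally uniform and the limit is continuous. *)
    set (K := 2 * B * exp (2 * L * (Rabs (a - b) + 2))).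
    assert (HK : 0 <= K) by (apply Rmult_le_pos; [lra | apply Rlt_le, exp_pos]).
    destruct (Hsmall K (eps / 3) ltac:(generalize (cond_pos eps); lra) HK) as [n Hn].
    assert (He3 : 0 < eps / 3) by (generalize (cond_pos eps); lra).
    destruct (jcont_picard_seq n j a b (mkposreal _ He3)) as [d Hd]. simpl in Hd.
    assert (Hm : 0 < Rmin d 1) by (apply Rmin_pos; [apply cond_pos | lra]).
    exists (mkposreal _ Hm). simpl. intros u v Hu Hv.
    assert (A1 := Rmin_l d 1). assert (A2 := Rmin_r d 1).
    assert (Hb : forall u v, Rabs (u - a) < 1 -> Rabs (v - b) < 1 ->
                 Rabs (picard_seq n j u v - U j u v) < eps / 3).
    { intros x y Hx Hy. eapply Rle_lt_trans; [apply Hlim|].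
      apply Rle_lt_trans with (K * (/2) ^ n); [|exact Hn].
      unfold K. replace (2 * B * exp (2 * L * (Rabs (a - b) + 2)) * (/ 2) ^ n)
        with (2 * B * (/2) ^ n * exp (2 * L * (Rabs (a - b) + 2))) by ring.
      apply Rmult_le_compat_l.
      { apply Rmult_le_pos; [lra | apply Rlt_le, Hp]. }
      apply exp_le_compat, Rmult_le_compat_l; [lra|].
      replace (x - y) with ((x - a) + ((a - b) - (y - b))) by ring.
      eapply Rle_trans; [apply Rabs_triang|].
      assert (T := Rabs_triang (a - b) (- (y - b))). rewrite Rabs_Ropp in T.
      unfold Rminus in *. lra. }
    specialize (Hd u v ltac:(lra) ltac:(lra)).
    assert (H1 := Hb u v ltac:(lra) ltac:(lra)).
    assert (H2 : Rabs (picard_seq n j a b - U j a b) < eps / 3).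
    { apply Hb; rewrite Rminus_diag, Rabs_R0; lra. }
    replace (U j u v - U j a b) with
      (- (picard_seq n j u v - U j u v) + ((picard_seq n j u v - picard_seq n j a b)
        + (picard_seq n j a b - U j a b))) by ring.
    eapply Rle_lt_trans; [apply Rabs_triang|]. rewrite Rabs_Ropp.
    assert (T := Rabs_triang (picard_seq n j u v - picard_seq n j a b) (picard_seq n j a b - U j a b)).
    lra. }
  exists U. split; [exact HUc|].
  intros i a b.
  apply Rminus_diag_uniq, Rabs_eq_0, Rle_antisym; [|apply Rabs_pos].
  apply le_epsilon. intros eps He. rewrite Rplus_0_l.
  set (K := 2 * (2 * B * exp (2 * L * Rabs (a - b)))).
  assert (HK : 0 <= K).
  { apply Rmult_le_pos; [lra|]. apply Rmult_le_pos; [lra | apply Rlt_le, exp_pos]. }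
  destruct (Hsmall K eps He HK) as [n Hn].
  assert (H1 := Hlim (S n) i a b). simpl in H1.
  assert (H2 := picard_op_contract (picard_seq n) U (2 * B * (/2) ^ n)
    (jcont_picard_seq n) HUc (Hlim n) i a b).
  replace (U i a b - picard_op U i a b) with
    (- (picard_op (picard_seq n) i a b - U i a b) + (picard_op (picard_seq n) i a b - picard_op U i a b)) by ring.
  eapply Rle_trans; [apply Rabs_triang|]. rewrite Rabs_Ropp.
  apply Rle_trans with (K * (/2) ^ n); [|lra].
  unfold K. eapply Rle_trans; [apply Rplus_le_compat; [exact H1 | exact H2]|].
  assert (0 <= B * (/2) ^ n * exp (2 * L * Rabs (a - b))).
  { apply Rmult_le_pos; [|apply Rlt_le, exp_pos]. apply Rmult_le_pos; [lra | apply Rlt_le, Hp]. }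
  lra.
Qed.

(** The integral form is kept beside the differential one for unknowns integrated in the first
    direction: their derivative in the second direction is found by differentiating under that
    integral. *)
Corollary picard_differential :
  exists U : nat -> R -> R -> R,
    (forall j, jcont (U j)) /\
    (forall i x, U i x x = g i x) /\
    (forall i, dir i = true -> forall a b, U i a b = g i b + int1 (fun a b => F i a b (fun j => U j a b)) a b) /\
    (forall i, dir i = true -> forall a b,
       is_derive (fun x => U i x b) a (F i a b (fun j => U j a b))) /\
    (forall i, dir i = false -> forall a b,
       is_derive (fun y => U i a y) b (F i a b (fun j => U j a b))).
Proof.
  destruct picard_integral as (U & HU & HE). exists U. split; [exact HU|].
  split; [|split; [|split]].
  - intros i x. rewrite HE. unfold picard_op, U0.
    destruct (dir i); rewrite int1_diag; ring.
  - intros i Hi a b. rewrite HE. unfold picard_op, U0. now rewrite Hi.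
  - intros i Hi a b.
    apply is_derive_ext with (fun x => g i b + int1 (fun a b => F i a b (fun j => U j a b)) x b).
    { intros x. rewrite HE. unfold picard_op, U0. now rewrite Hi. }
    assert (D := is_derive_int1_fst _ a b (F_cont U HU i)). cbv beta in D.
    rewrite <- (Rplus_0_l (F i a b _)).
    apply (is_derive_plus (V := R_NormedModule)); [apply (is_derive_const (V := R_NormedModule)) | exact D].
  - intros i Hi a b.
    apply is_derive_ext with (fun y => g i a + int1 (flip (fun a b => F i a b (fun j => U j a b))) y a).
    { intros y. rewrite HE. unfold picard_op, U0. now rewrite Hi. }
    assert (D := is_derive_int1_fst _ b a (jcont_flip _ (F_cont U HU i))). unfold flip at 2 in D. cbv beta in D.
    rewrite <- (Rplus_0_l (F i a b _)).
    apply (is_derive_plus (V := R_NormedModule)); [apply (is_derive_const (V := R_NormedModule)) | exact D].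
Qed.
End Picard.

(** * The truncated characteristic system *)

Definition clamp (M x : R) : R := Rmax (- M) (Rmin x M).

Lemma Rabs_clamp_le (M x : R) : 0 <= M -> Rabs (clamp M x) <= M.
Proof.
  intros HM. unfold clamp. apply Rabs_le.
  split; [apply Rmax_l | apply Rmax_lub; [lra | apply Rmin_r]].
Qed.

Lemma clamp_id (M x : R) : Rabs x <= M -> clamp M x = x.
Proof.
  intros Hx. apply Rabs_le_between in Hx. unfold clamp.
  rewrite Rmin_left, Rmax_right; lra.
Qed.

Lemma clamp_lip (M x y : R) : Rabs (clamp M x - clamp M y) <= Rabs (x - y).
Proof.
  unfold clamp, Rmax, Rmin.
  repeat destruct Rle_dec; unfold Rabs; repeat destruct Rcase_abs; lra.
Qed.

Lemma continuous_lip (f : R -> R) (L : R) :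
  (forall x y, Rabs (f x - f y) <= L * Rabs (x - y)) -> forall x, continuous f x.
Proof.
  intros H x. apply continuity_pt_filterlim. intros eps He.
  assert (HL : 0 <= L).
  { specialize (H 1 0). rewrite Rminus_0_r, Rabs_R1 in H. generalize (Rabs_pos (f 1 - f 0)). lra. }
  exists (eps / (L + 1)). split; [apply Rdiv_lt_0_compat; lra|].
  intros y [_ Hy]. simpl in Hy |- *. unfold Rdist in *.
  eapply Rle_lt_trans; [apply H|].
  apply Rle_lt_trans with ((L + 1) * Rabs (y - x)).
  { apply Rmult_le_compat_r; [apply Rabs_pos | lra]. }
  replace eps with ((L + 1) * (eps / (L + 1))) by (field; lra).
  apply Rmult_lt_compat_l; lra.
Qed.

Lemma int1_scal (f : R -> R -> R) (c a b : R) :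
  jcont f -> int1 (fun a b => c * f a b) a b = c * int1 f a b.
Proof.
  intros Hf. unfold int1.
  apply (RInt_scal (V := R_CompleteNormedModule) (fun x => f x b)).
  apply ex_RInt_cont. intros; now apply jcont_slice1.
Qed.

Lemma int1_ext (f g : R -> R -> R) (a b : R) :
  (forall x, Rmin b a < x < Rmax b a -> f x b = g x b) -> int1 f a b = int1 g a b.
Proof. intros H. unfold int1. now apply RInt_ext. Qed.

Lemma Rabs_mult_diff_le (x x' y y' A B D E : R) :
  Rabs x <= A -> Rabs y' <= B -> Rabs (x - x') <= D -> Rabs (y - y') <= E ->
  Rabs (x * y - x' * y') <= A * E + D * B.
Proof.
  intros Hx Hy HD HE.
  replace (x * y - x' * y') with (x * (y - y') + (x - x') * y') by ring.
  eapply Rle_trans; [apply Rabs_triang|]. rewrite !Rabs_mult.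
  apply Rplus_le_compat; apply Rmult_le_compat; auto using Rabs_pos.
Qed.

Section Core.
Variables (kap dmp : R -> R) (Kk Kl Ad Al Lam : R).
Hypothesis kap_bound : forall x, Rabs (kap x) <= Kk.
Hypothesis kap_lip : forall x y, Rabs (kap x - kap y) <= Kl * Rabs (x - y).
Hypothesis dmp_bound : forall x, Rabs (dmp x) <= Ad.
Hypothesis dmp_lip : forall x y, Rabs (dmp x - dmp y) <= Al * Rabs (x - y).
Hypothesis Lam_pos : 0 < Lam.

Definition clamped_J (P Q Y V : R) : R :=
  clamp Lam Q * clamp Lam Y + clamp Lam P * clamp Lam V.

Lemma clamped_J_bound P Q Y V : Rabs (clamped_J P Q Y V) <= 2 * (Lam * Lam).
Proof.
  unfold clamped_J. eapply Rle_trans; [apply Rabs_triang|]. rewrite !Rabs_mult.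
  assert (H : forall x, Rabs (clamp Lam x) <= Lam) by (intros; apply Rabs_clamp_le; lra).
  assert (H' : forall x y, Rabs (clamp Lam x) * Rabs (clamp Lam y) <= Lam * Lam).
  { intros. apply Rmult_le_compat; auto using Rabs_pos. }
  generalize (H' Q Y) (H' P V). lra.
Qed.

Lemma clamped_J_lip P Q Y V P' Q' Y' V' D :
  Rabs (P - P') <= D -> Rabs (Q - Q') <= D -> Rabs (Y - Y') <= D -> Rabs (V - V') <= D ->
  Rabs (clamped_J P Q Y V - clamped_J P' Q' Y' V') <= 4 * Lam * D.
Proof.
  intros HP HQ HY HV. unfold clamped_J.
  assert (H : forall x, Rabs (clamp Lam x) <= Lam) by (intros; apply Rabs_clamp_le; lra).
  assert (H' : forall x y, Rabs (x - y) <= D -> Rabs (clamp Lam x - clamp Lam y) <= D).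
  { intros x y Hxy. eapply Rle_trans; [apply clamp_lip | exact Hxy]. }
  assert (T : forall x x' y y', Rabs (x - x') <= D -> Rabs (y - y') <= D ->
    Rabs (clamp Lam x * clamp Lam y - clamp Lam x' * clamp Lam y') <= Lam * D + D * Lam).
  { intros. apply Rabs_mult_diff_le; auto. }
  replace (clamp Lam Q * clamp Lam Y + clamp Lam P * clamp Lam V -
    (clamp Lam Q' * clamp Lam Y' + clamp Lam P' * clamp Lam V'))
  with ((clamp Lam Q * clamp Lam Y - clamp Lam Q' * clamp Lam Y') +
    (clamp Lam P * clamp Lam V - clamp Lam P' * clamp Lam V')) by ring.
  eapply Rle_trans; [apply Rabs_triang|].
  generalize (T _ _ _ _ HQ HY) (T _ _ _ _ HP HV). lra.
Qed.

Lemma clamped_J_id P Q Y V :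
  Rabs P <= Lam -> Rabs Q <= Lam -> Rabs Y <= Lam -> Rabs V <= Lam ->
  clamped_J P Q Y V = Q * Y + P * V.
Proof. intros. unfold clamped_J. now rewrite !clamp_id. Qed.

Lemma jcont_clamp (f : R -> R -> R) : jcont f -> jcont (fun a b => clamp Lam (f a b)).
Proof.
  intros Hf. apply (jcont_comp1 (clamp Lam)); [|exact Hf].
  apply continuous_lip with 1. intros. rewrite Rmult_1_l. apply clamp_lip.
Qed.

Lemma jcont_clamped_J (P Q Y V : R -> R -> R) :
  jcont P -> jcont Q -> jcont Y -> jcont V ->
  jcont (fun a b => clamped_J (P a b) (Q a b) (Y a b) (V a b)).
Proof.
  intros. unfold clamped_J.
  apply jcont_plus; apply jcont_mult; now apply jcont_clamp.
Qed.

Variables (P0 Y0 V0 th0 : R -> R) (B0 : R).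
Hypothesis P0_cont : forall x, continuous P0 x.
Hypothesis Y0_cont : forall x, continuous Y0 x.
Hypothesis V0_cont : forall x, continuous V0 x.
Hypothesis th0_derive : forall x, is_derive th0 x (2 * V0 x - 2 * Y0 x).
Hypothesis P0_bound : forall x, Rabs (P0 x) <= B0.
Hypothesis Y0_bound : forall x, Rabs (Y0 x) <= B0.

(** The indices [0] to [5] stand for [P], [Q], [Y], [V], [th], [t]; the remaining ones are
    identically zero. [P] and [Y] are integrated in the second coordinate. [Q] receives the data of
    [P] because [t = 0] on the diagonal forces [t_al + t_be = P - Q = 0] there. *)
Definition core_dir (i : nat) : bool :=
  match i with 0%nat | 2%nat => false | _ => true end.

Definition core_data (i : nat) : R -> R :=
  match i with
  | 0%nat => P0 | 1%nat => P0 | 2%nat => Y0 | 3%nat => V0 | 4%nat => th0 | _ => fun _ => 0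
  end.

Definition core_rhs (i : nat) (_ _ : R) (z : nat -> R) : R :=
  let J := clamped_J (z 0%nat) (z 1%nat) (z 2%nat) (z 3%nat) in
  match i with
  | 0%nat => - (kap (z 4%nat) * J)
  | 1%nat => kap (z 4%nat) * J
  | 2%nat => dmp (z 5%nat) / 2 * J
  | 3%nat => - (dmp (z 5%nat) / 2 * J)
  | 4%nat => - 2 * z 2%nat
  | 5%nat => z 0%nat
  | _ => 0
  end.

(** All four equations contain the same truncated [J], so the compatibility relations
    [P_be = - Q_al] and [Y_be = - V_al] survive truncation. Hence [t] and [th], built by integration
    in the first coordinate only, have the expected second partial derivatives on the whole plane.
    The analogous relations for [x] and [v] use the actual value of [J] and hold only where the
    truncation is inactive. *)
Lemma core_system :
  exists P Q Y V th t : R -> R -> R,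
    let J := fun a b => clamped_J (P a b) (Q a b) (Y a b) (V a b) in
    (jcont P /\ jcont Q /\ jcont Y /\ jcont V) /\
    (forall a b, is_derive (fun y => P a y) b (- (kap (th a b) * J a b))) /\
    (forall a b, is_derive (fun x => Q x b) a (kap (th a b) * J a b)) /\
    (forall a b, is_derive (fun y => Y a y) b (dmp (t a b) / 2 * J a b)) /\
    (forall a b, is_derive (fun x => V x b) a (- (dmp (t a b) / 2 * J a b))) /\
    C1_plane th (fun a b => - 2 * Y a b) (fun a b => 2 * V a b) /\
    C1_plane t P (fun a b => - Q a b) /\
    (forall x, P x x = P0 x /\ Q x x = P0 x /\ Y x x = Y0 x /\ V x x = V0 x /\
               th x x = th0 x /\ t x x = 0).
Proof.
  assert (HKk : 0 <= Kk) by (eapply Rle_trans; [apply Rabs_pos | apply (kap_bound 0)]).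
  assert (HAd : 0 <= Ad) by (eapply Rle_trans; [apply Rabs_pos | apply (dmp_bound 0)]).
  assert (HB0 : 0 <= B0) by (eapply Rle_trans; [apply Rabs_pos | apply (P0_bound 0)]).
  assert (HKl : 0 <= Kl).
  { specialize (kap_lip 1 0). rewrite Rminus_0_r, Rabs_R1 in kap_lip.
    generalize (Rabs_pos (kap 1 - kap 0)). lra. }
  assert (HAl : 0 <= Al).
  { specialize (dmp_lip 1 0). rewrite Rminus_0_r, Rabs_R1 in dmp_lip.
    generalize (Rabs_pos (dmp 1 - dmp 0)). lra. }
  (* The two brackets are the Lipschitz constants of [kap * J] and of the damping term, and [2] is
     that of [- 2 Y]; [C] bounds the right-hand sides on the initial iterate. *)
  set (L := (Kk * (4 * Lam) + Kl * (2 * (Lam * Lam))) + (Ad * (4 * Lam) + Al * (2 * (Lam * Lam))) + 2).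
  set (C := Kk * (2 * (Lam * Lam)) + Ad * (2 * (Lam * Lam)) + 2 * B0).
  assert (HLL : 0 < Lam * Lam) by (apply Rmult_lt_0_compat; lra).
  assert (N1 : 0 <= Kk * (4 * Lam)) by (apply Rmult_le_pos; lra).
  assert (N2 : 0 <= Kl * (2 * (Lam * Lam))) by (apply Rmult_le_pos; lra).
  assert (N3 : 0 <= Ad * (4 * Lam)) by (apply Rmult_le_pos; lra).
  assert (N4 : 0 <= Al * (2 * (Lam * Lam))) by (apply Rmult_le_pos; lra).
  assert (N5 : 0 <= Kk * (2 * (Lam * Lam))) by (apply Rmult_le_pos; lra).
  assert (N6 : 0 <= Ad * (2 * (Lam * Lam))) by (apply Rmult_le_pos; lra).
  assert (th0_cont : forall x, continuous th0 x).
  { intros x. apply (ex_derive_continuous th0). eexists. apply th0_derive. }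
  assert (kap_cont : forall x, continuous kap x) by (apply continuous_lip with Kl; exact kap_lip).
  assert (dmp_cont : forall x, continuous dmp x) by (apply continuous_lip with Al; exact dmp_lip).
  assert (BK : forall x P Q Y V, Rabs (kap x * clamped_J P Q Y V) <= Kk * (2 * (Lam * Lam))).
  { intros. rewrite Rabs_mult.
    apply Rmult_le_compat; try apply Rabs_pos; [apply kap_bound | apply clamped_J_bound]. }
  assert (BA : forall x P Q Y V, Rabs (dmp x / 2 * clamped_J P Q Y V) <= Ad * (2 * (Lam * Lam))).
  { intros. rewrite Rabs_mult.
    apply Rmult_le_compat; try apply Rabs_pos; [|apply clamped_J_bound].
    unfold Rdiv. rewrite Rabs_mult, (Rabs_pos_eq (/2)) by lra.
    generalize (dmp_bound x) (Rabs_pos (dmp x)). lra. }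
  destruct (picard_differential core_dir core_data core_rhs L C) as (U & HU & Hdiag & Hint & Hd1 & Hd2).
  - unfold L. lra.
  - intros i x. unfold core_data.
    do 5 (destruct i as [|i]; auto). apply continuous_const.
  - intros U HU i. unfold core_rhs.
    assert (HJ := jcont_clamped_J _ _ _ _ (HU 0%nat) (HU 1%nat) (HU 2%nat) (HU 3%nat)).
    assert (HK := jcont_comp1 kap _ kap_cont (HU 4%nat)).
    assert (HA : jcont (fun a b => dmp (U 5%nat a b) / 2)).
    { apply (jcont_mult (fun a b => dmp (U 5%nat a b)) (fun _ _ => / 2)); [|apply jcont_const].
      apply (jcont_comp1 dmp _ dmp_cont (HU 5%nat)). }
    destruct i as [|i]; [now apply jcont_opp, jcont_mult|].
    destruct i as [|i]; [now apply jcont_mult|].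
    destruct i as [|i]; [now apply jcont_mult|].
    destruct i as [|i]; [now apply jcont_opp, jcont_mult|].
    destruct i as [|i]; [apply jcont_mult; [apply jcont_const | apply HU]|].
    destruct i as [|i]; [apply HU | apply jcont_const].
  - intros i a b z z' D HD.
    assert (HD0 : 0 <= D) by (eapply Rle_trans; [apply Rabs_pos | apply (HD 0%nat)]).
    set (J := clamped_J (z 0%nat) (z 1%nat) (z 2%nat) (z 3%nat)).
    set (J' := clamped_J (z' 0%nat) (z' 1%nat) (z' 2%nat) (z' 3%nat)).
    assert (HJ : Rabs (J - J') <= 4 * Lam * D) by now apply clamped_J_lip.
    assert (E1 : Rabs (kap (z 4%nat) * J - kap (z' 4%nat) * J')
             <= (Kk * (4 * Lam) + Kl * (2 * (Lam * Lam))) * D).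
    { replace ((Kk * (4 * Lam) + Kl * (2 * (Lam * Lam))) * D)
        with (Kk * (4 * Lam * D) + Kl * D * (2 * (Lam * Lam))) by ring.
      apply Rabs_mult_diff_le; [apply kap_bound | apply clamped_J_bound | | exact HJ].
      eapply Rle_trans; [apply kap_lip|]. apply Rmult_le_compat_l; [exact HKl | apply HD]. }
    assert (E2 : Rabs (dmp (z 5%nat) / 2 * J - dmp (z' 5%nat) / 2 * J')
             <= (Ad * (4 * Lam) + Al * (2 * (Lam * Lam))) * D).
    { replace (dmp (z 5%nat) / 2 * J - dmp (z' 5%nat) / 2 * J')
        with ((dmp (z 5%nat) * J - dmp (z' 5%nat) * J') * / 2) by field.
      rewrite Rabs_mult, (Rabs_pos_eq (/2)) by lra.
      assert (T : Rabs (dmp (z 5%nat) * J - dmp (z' 5%nat) * J')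
        <= (Ad * (4 * Lam) + Al * (2 * (Lam * Lam))) * D).
      { replace ((Ad * (4 * Lam) + Al * (2 * (Lam * Lam))) * D)
          with (Ad * (4 * Lam * D) + Al * D * (2 * (Lam * Lam))) by ring.
        apply Rabs_mult_diff_le; [apply dmp_bound | apply clamped_J_bound | | exact HJ].
        eapply Rle_trans; [apply dmp_lip|]. apply Rmult_le_compat_l; [exact HAl | apply HD]. }
      generalize (Rabs_pos (dmp (z 5%nat) * J - dmp (z' 5%nat) * J')). lra. }
    assert (M1 : (Kk * (4 * Lam) + Kl * (2 * (Lam * Lam))) * D <= L * D).
    { apply Rmult_le_compat_r; unfold L; lra. }
    assert (M2 : (Ad * (4 * Lam) + Al * (2 * (Lam * Lam))) * D <= L * D).
    { apply Rmult_le_compat_r; unfold L; lra. }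
    assert (M3 : 2 * D <= L * D).
    { apply Rmult_le_compat_r; unfold L; lra. }
    unfold core_rhs. fold J J'.
    assert (Eo : forall x y, - x - - y = - (x - y)) by (intros; ring).
    destruct i as [|i]; [rewrite Eo, Rabs_Ropp; lra|].
    destruct i as [|i]; [lra|].
    destruct i as [|i]; [lra|].
    destruct i as [|i]; [rewrite Eo, Rabs_Ropp; lra|].
    destruct i as [|i].
    { replace (- 2 * z 2%nat - - 2 * z' 2%nat) with (- (2 * (z 2%nat - z' 2%nat))) by ring.
      rewrite Rabs_Ropp, Rabs_mult, (Rabs_pos_eq 2) by lra. generalize (HD 2%nat). lra. }
    destruct i as [|i]; [generalize (HD 0%nat); lra|].
    rewrite Rminus_diag, Rabs_R0. lra.
  - intros i a b. unfold core_rhs, C.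
    destruct i as [|i]; [rewrite Rabs_Ropp; eapply Rle_trans; [apply BK | lra]|].
    destruct i as [|i]; [eapply Rle_trans; [apply BK | lra]|].
    destruct i as [|i]; [eapply Rle_trans; [apply BA | lra]|].
    destruct i as [|i]; [rewrite Rabs_Ropp; eapply Rle_trans; [apply BA | lra]|].
    destruct i as [|i].
    { simpl. rewrite Rabs_mult, Rabs_left by lra. generalize (Y0_bound a). lra. }
    destruct i as [|i]; [simpl; generalize (P0_bound a); lra|].
    rewrite Rabs_R0. lra.
  - exists (U 0%nat), (U 1%nat), (U 2%nat), (U 3%nat), (U 4%nat), (U 5%nat). intros J.
    assert (HJ : jcont J) by now apply jcont_clamped_J.
    assert (HK : jcont (fun a b => kap (U 4%nat a b))) by now apply jcont_comp1.
    assert (HA : jcont (fun a b => dmp (U 5%nat a b) / 2)).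
    { apply (jcont_mult (fun a b => dmp (U 5%nat a b)) (fun _ _ => / 2)); [|apply jcont_const].
      now apply jcont_comp1. }
    assert (DP : forall a b, is_derive (fun y => U 0%nat a y) b (- (kap (U 4%nat a b) * J a b))).
    { intros a b. apply (Hd2 0%nat eq_refl a b). }
    assert (DY : forall a b, is_derive (fun y => U 2%nat a y) b (dmp (U 5%nat a b) / 2 * J a b)).
    { intros a b. apply (Hd2 2%nat eq_refl a b). }
    split; [auto|].
    split; [exact DP|].
    split; [intros a b; apply (Hd1 1%nat eq_refl a b)|].
    split; [exact DY|].
    split; [intros a b; apply (Hd1 3%nat eq_refl a b)|].
    split; [|split].
    + split; [intros a b; apply (Hd1 4%nat eq_refl a b)|].
      split; [|split; apply jcont_mult; auto using jcont_const].
      intros a b.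
      apply is_derive_ext with (fun y => th0 y + int1 (fun a b => -2 * U 2%nat a b) a y).
      { intros y. symmetry. apply (Hint 4%nat eq_refl). }
      (* Differentiating the integral for [th] leaves [2 * V0] plus an integral of the source of
         [- 2 * Y]; the integral equation for [V] identifies this with [2 * V]. *)
      assert (E := Hint 3%nat eq_refl a b). unfold core_rhs, core_data in E.
      replace (2 * U 3%nat a b) with
        ((2 * V0 b - 2 * Y0 b) + (int1 (fun a b => - 2 * (dmp (U 5%nat a b) / 2 * J a b)) a b
            - (- 2 * U 2%nat b b))).
      { apply (is_derive_plus (V := R_NormedModule)); [apply th0_derive|].
        apply (is_derive_int1_snd (fun a b => - 2 * U 2%nat a b)).
        - apply jcont_mult; auto using jcont_const.
        - apply jcont_mult; [apply jcont_const | now apply jcont_mult].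
        - intros x y. apply (is_derive_scal (fun y => U 2%nat x y)), DY. }
      rewrite E, (Hdiag 2%nat). simpl core_data.
      rewrite (int1_ext (fun a0 b0 => - (dmp (U 5%nat a0 b0) / 2 *
        clamped_J (U 0%nat a0 b0) (U 1%nat a0 b0) (U 2%nat a0 b0) (U 3%nat a0 b0)))
        (fun a b => -1 * (dmp (U 5%nat a b) / 2 * J a b))).
      2:{ intros. unfold J. ring. }
      rewrite !int1_scal by now apply jcont_mult. ring.
    + split; [intros a b; apply (Hd1 5%nat eq_refl a b)|].
      split; [|split; auto using jcont_opp].
      intros a b.
      apply is_derive_ext with (fun y => 0 + int1 (U 0%nat) a y).
      { intros y. symmetry. apply (Hint 5%nat eq_refl). }
      assert (E := Hint 1%nat eq_refl a b). unfold core_rhs, core_data in E.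
      replace (- U 1%nat a b) with
        (0 + (int1 (fun a b => - (kap (U 4%nat a b) * J a b)) a b - U 0%nat b b)).
      { apply (is_derive_plus (V := R_NormedModule)); [apply (is_derive_const (V := R_NormedModule))|].
        apply is_derive_int1_snd; auto.
        now apply jcont_opp, jcont_mult. }
      rewrite E, (Hdiag 0%nat). simpl core_data. fold J.
      rewrite (int1_ext (fun a0 b0 => - (kap (U 4%nat a0 b0) * J a0 b0))
        (fun a b => -1 * (kap (U 4%nat a b) * J a b))) by (intros; ring).
      rewrite !int1_scal by now apply jcont_mult. unfold J. ring.
    + intros x. rewrite !Hdiag. simpl. auto 10.
Qed.
End Core.

(** * Estimates along one characteristic *)

Lemma is_derive_continuous (f : R -> R) (x l : R) : is_derive f x l -> continuous f x.
Proof. intros H. apply (ex_derive_continuous f). now exists l. Qed.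

Lemma nondecreasing_of_derive (f df : R -> R) (l u : R) :
  l <= u -> (forall x, l <= x <= u -> is_derive f x (df x)) ->
  (forall x, l <= x <= u -> 0 <= df x) -> f l <= f u.
Proof.
  intros Hlu Hd Hp.
  destruct (MVT_gen f l u df) as [c [Hc He]].
  - rewrite Rmin_left, Rmax_right by lra. intros x Hx. apply Hd. lra.
  - rewrite Rmin_left, Rmax_right by lra. intros x Hx.
    apply continuity_pt_filterlim, (is_derive_continuous f x (df x)), Hd, Hx.
  - rewrite Rmin_left, Rmax_right in Hc by lra.
    assert (0 <= df c * (u - l)) by (apply Rmult_le_pos; [auto | lra]). lra.
Qed.

Lemma Rabs_diff_le_of_derive (f df : R -> R) (l u M : R) :
  l <= u -> (forall x, l <= x <= u -> is_derive f x (df x)) ->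
  (forall x, l <= x <= u -> Rabs (df x) <= M) -> Rabs (f u - f l) <= M * (u - l).
Proof.
  intros Hlu Hd Hp.
  destruct (MVT_gen f l u df) as [c [Hc He]].
  - rewrite Rmin_left, Rmax_right by lra. intros x Hx. apply Hd. lra.
  - rewrite Rmin_left, Rmax_right by lra. intros x Hx.
    apply continuity_pt_filterlim, (is_derive_continuous f x (df x)), Hd, Hx.
  - rewrite Rmin_left, Rmax_right in Hc by lra.
    rewrite He, Rabs_mult, (Rabs_pos_eq (u - l)) by lra.
    apply Rmult_le_compat_r; [lra | auto].
Qed.

(* Run backwards from [u], [f] starts negative and cannot reach [0], since there it
   would have to cross [0] with positive slope. *)
Lemma barrier (f : R -> R) (l u : R) :
  (forall x, l <= x <= u -> continuous f x) -> f u < 0 ->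
  (forall x, l <= x < u -> f x = 0 -> exists d, is_derive f x d /\ 0 < d) ->
  forall x, l <= x <= u -> f x < 0.
Proof.
  intros Hc Hu Hd x0 Hx0. apply Rnot_le_lt. intros Hpos.
  (* [s] is the last place where [f] is nonnegative. A negative value there contradicts that such
     places accumulate at [s], a positive one that it is the last, and a zero is excluded by the
     slope. *)
  destruct (completeness (fun x => x0 <= x <= u /\ 0 <= f x)) as [s [Hub Hlub]].
  { exists u. intros x [Hx _]. lra. }
  { exists x0. lra. }
  assert (Hs1 : x0 <= s) by (apply Hub; lra).
  assert (Hs2 : s <= u) by (apply Hlub; intros x [Hx _]; lra).
  assert (HC : forall eps, 0 < eps -> exists d, 0 < d /\
            forall y, Rabs (y - s) < d -> Rabs (f y - f s) < eps).
  { intros eps He. destruct (Hc s ltac:(lra) (ball (f s) (mkposreal eps He))) as [d Hd'].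
    { now exists (mkposreal eps He). }
    exists d. split; [apply cond_pos|]. exact Hd'. }
  destruct (Rtotal_order (f s) 0) as [Hn|[H0|Hp]].
  - destruct (HC (- f s) ltac:(lra)) as [d [dpos Hd']].
    assert (s <= s - d); [|lra].
    apply Hlub. intros x [Hx1 Hx2].
    assert (x <= s) by (apply Hub; lra).
    apply Rnot_lt_le. intros Hxs.
    assert (T := Hd' x ltac:(apply Rabs_def1; lra)). apply Rabs_def2 in T. lra.
  - assert (Hsu : s < u).
    { destruct Hs2 as [h|h]; [exact h | subst s; lra]. }
    destruct (Hd s ltac:(lra) H0) as [d [Hder Hdpos]].
    apply is_derive_Reals in Hder. destruct (Hder d Hdpos) as [e He].
    set (h := Rmin (e / 2) (u - s)).
    assert (ep := cond_pos e).
    assert (Hh : 0 < h) by (apply Rmin_pos; lra).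
    assert (Hh1 : h <= e / 2) by apply Rmin_l.
    assert (Hh2 : h <= u - s) by apply Rmin_r.
    specialize (He h ltac:(lra) ltac:(rewrite Rabs_pos_eq; lra)).
    apply Rabs_def2 in He. rewrite H0, Rminus_0_r in He.
    assert (Hq : 0 < f (s + h) / h) by lra.
    assert (0 < f (s + h)).
    { replace (f (s + h)) with (f (s + h) / h * h) by (field; lra).
      now apply Rmult_lt_0_compat. }
    assert (s + h <= s); [|lra].
    apply Hub. lra.
  - destruct (HC (f s) Hp) as [d [dpos Hd']].
    assert (Hsu : s < u).
    { destruct Hs2 as [h|h]; [exact h | subst s; lra]. }
    set (h := Rmin (d / 2) (u - s)).
    assert (Hh : 0 < h) by (apply Rmin_pos; lra).
    assert (Hh1 : h <= d / 2) by apply Rmin_l.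
    assert (Hh2 : h <= u - s) by apply Rmin_r.
    assert (T := Hd' (s + h) ltac:(apply Rabs_def1; lra)). apply Rabs_def2 in T.
    assert (s + h <= s); [|lra].
    apply Hub. lra.
Qed.

(* [kap] is [c' / c], [dmp] the damping coefficient [a], [N] is [sqrt c], [Eh] the
   exponential of half the integrated damping and [beta] the barrier. *)
Section Char.
Variables (kap dmp : R -> R).

(* One characteristic, parametrized by the foot of the characteristics that cross it;
   it runs backwards in this parameter, from time [0] at [u]. *)
Definition char_curve (P Q Y V th t : R -> R) (l u : R) : Prop :=
  l <= u /\ t u = 0 /\
  forall b, l <= b <= u ->
    0 < P b /\ 0 < Q b /\
    is_derive P b (- (kap (th b) * (Q b * Y b + P b * V b))) /\
    is_derive Y b (dmp (t b) / 2 * (Q b * Y b + P b * V b)) /\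
    is_derive th b (2 * V b) /\
    is_derive t b (- Q b).

Lemma char_time_pos P Q Y V th t l u b :
  char_curve P Q Y V th t l u -> l <= b < u -> 0 < t b.
Proof.
  intros (H1 & H2 & H3) Hb.
  destruct (MVT_gen t b u (fun b => - Q b)) as [c [Hc He]].
  - rewrite Rmin_left, Rmax_right by lra. intros x Hx. apply H3. lra.
  - rewrite Rmin_left, Rmax_right by lra. intros x Hx.
    apply continuity_pt_filterlim, (is_derive_continuous t x (- Q x)), H3. lra.
  - rewrite Rmin_left, Rmax_right in Hc by lra.
    assert (0 < Q c) by (apply H3; lra).
    assert (0 < Q c * (u - b)) by (apply Rmult_lt_0_compat; lra). lra.
Qed.

Lemma char_time_nonneg P Q Y V th t l u b :
  char_curve P Q Y V th t l u -> l <= b <= u -> 0 <= t b.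
Proof.
  intros H [Hb1 [Hb2|Hb2]].
  - apply Rlt_le, (char_time_pos _ _ _ _ _ _ _ _ b H). lra.
  - destruct H as (H1 & H2 & H3). subst b. lra.
Qed.

Section Invariant.
Variable Eh : R -> R.
Hypothesis Eh_derive : forall t, is_derive Eh t (dmp t / 2 * Eh t).
Hypothesis Eh_pos : forall t, 0 < Eh t.
Hypothesis Eh_0 : Eh 0 = 1.

(** As [v] is the mean of [r] and [s], half of the damping acts on [r] itself and is removed by the
    integrating factor [Eh]; the other half acts through [s], bounded by [D]. After division by
    [Eh (t l)] the bound is a mean of [M] and [D] in which [M] has weight [1 / Eh (t l)]. *)
Lemma char_invariant_bound (Q t r s : R -> R) (l u M D : R) :
  l <= u -> t u = 0 ->
  (forall b, l <= b <= u -> 0 < Q b /\ 0 <= dmp (t b) /\ Rabs (s b) <= D /\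
     is_derive t b (- Q b) /\ is_derive r b (dmp (t b) * Q b * (r b + s b) / 2)) ->
  Rabs (r u) <= M ->
  Rabs (r l) * Eh (t l) <= M + D * (Eh (t l) - 1).
Proof.
  intros Hlu Htu H HM.
  assert (key : forall sg, sg = 1 \/ sg = -1 ->
    (sg * r l) * Eh (t l) <= M + D * (Eh (t l) - 1)).
  { intros sg Hsg.
    assert (K := nondecreasing_of_derive (fun b => sg * r b * Eh (t b) - D * Eh (t b))
      (fun b => Eh (t b) * (dmp (t b) / 2) * Q b * (D + sg * s b)) l u Hlu).
    cbv beta in K. rewrite Htu, Eh_0 in K.
    assert (sg * r u <= M).
    { apply Rabs_le_between in HM. destruct Hsg as [->| ->]; lra. }
    enough (sg * r l * Eh (t l) - D * Eh (t l) <= sg * r u * 1 - D * 1) by lra.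
    apply K.
    - intros b Hb. destruct (H b Hb) as (H1 & H2 & H3 & H4 & H5).
      assert (H6 : is_derive (fun b => Eh (t b)) b (- Q b * (dmp (t b) / 2 * Eh (t b)))).
      { apply (is_derive_comp (V := R_NormedModule) Eh t); [apply Eh_derive | exact H4]. }
      evar_last.
      { apply (is_derive_minus (V := R_NormedModule)).
        - apply (is_derive_mult (fun b => sg * r b) (fun b => Eh (t b))).
          + apply (is_derive_scal r), H5.
          + exact H6.
          + intros; apply Rmult_comm.
        - apply (is_derive_scal (fun b => Eh (t b))), H6. }
      unfold minus, plus, opp, mult; simpl. field.
    - intros b Hb. destruct (H b Hb) as (H1 & H2 & H3 & H4 & H5).
      apply Rabs_le_between in H3.
      apply Rmult_le_pos; [apply Rmult_le_pos; [apply Rmult_le_pos|]|];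
        try (generalize (Eh_pos (t b)); lra).
      destruct Hsg as [->| ->]; lra. }
  unfold Rabs. destruct Rcase_abs.
  - generalize (key (-1) ltac:(auto)). lra.
  - generalize (key 1 ltac:(auto)). lra.
Qed.
End Invariant.

Variable N : R -> R.
Hypothesis N_derive : forall x, is_derive N x (kap x / 2 * N x).
Hypothesis N_pos : forall x, 0 < N x.

(** Since [N' = kap / 2 * N] and [th] has derivative [2 * V], the variation of [N] cancels the
    summand [P * V] of [J]. Only the gradient carried by this characteristic remains. *)
Lemma char_NP_derive P Q Y V th t l u b :
  char_curve P Q Y V th t l u -> l <= b <= u ->
  is_derive (fun b => N (th b) * P b) b (- (kap (th b) * N (th b) * Q b * Y b)).
Proof.
  intros (H1 & H2 & H3) Hb. destruct (H3 b Hb) as (h1 & h2 & h3 & h4 & h5 & h6).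
  evar_last.
  { apply (is_derive_mult (fun b => N (th b)) P).
    - apply (is_derive_comp (V := R_NormedModule) N th); [apply N_derive | exact h5].
    - exact h3.
    - intros; apply Rmult_comm. }
  unfold plus, mult, scal; simpl. unfold mult; simpl. field.
Qed.

(** A Gronwall estimate in time: the hypothesis bounds the logarithmic time derivative of [N * P] by
    [C], so [N * P * exp (C * t)] and [N * P * exp (- C * t)] are monotone. *)
Lemma char_density_bounds P Q Y V th t l u C :
  char_curve P Q Y V th t l u ->
  (forall b, l <= b <= u -> Rabs (kap (th b) * N (th b) * Y b) <= C * (N (th b) * P b)) ->
  N (th u) * P u * exp (- C * t l) <= N (th l) * P l <= N (th u) * P u * exp (C * t l).
Proof.
  intros HC HB.
  assert (Hlu : l <= u) by apply HC. assert (Htu : t u = 0) by apply HC.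
  assert (DE : forall sg b, l <= b <= u ->
    is_derive (fun b => exp (sg * t b)) b (- sg * Q b * exp (sg * t b))).
  { intros sg b Hb. evar_last.
    - apply (is_derive_comp (V := R_NormedModule) exp (fun b => sg * t b)).
      + apply is_derive_exp.
      + apply (is_derive_scal t). apply HC, Hb.
    - unfold scal; simpl. unfold mult; simpl. ring. }
  assert (DW : forall sg b, l <= b <= u ->
    is_derive (fun b => N (th b) * P b * exp (sg * t b)) b
      (- (exp (sg * t b) * Q b * (kap (th b) * N (th b) * Y b + sg * (N (th b) * P b))))).
  { intros sg b Hb. evar_last.
    - apply (is_derive_mult (fun b => N (th b) * P b) (fun b => exp (sg * t b))).
      + apply (char_NP_derive _ _ _ _ _ _ _ _ b HC Hb).
      + apply DE, Hb.
      + intros; apply Rmult_comm.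
    - unfold plus, mult; simpl. ring. }
  assert (HQ : forall b, l <= b <= u -> 0 < Q b) by (intros b Hb; apply HC, Hb).
  assert (E0 : forall sg, exp (sg * t l) * exp (- sg * t l) = 1).
  { intros sg. rewrite <- exp_plus, <- exp_0. f_equal. ring. }
  assert (Epos := exp_pos).
  split.
  - assert (K := nondecreasing_of_derive (fun b => - (N (th b) * P b * exp (C * t b)))
      (fun b => - - (exp (C * t b) * Q b * (kap (th b) * N (th b) * Y b + C * (N (th b) * P b)))) l u Hlu).
    cbv beta in K. rewrite Htu, Rmult_0_r, exp_0, Rmult_1_r in K.
    assert (N (th u) * P u <= N (th l) * P l * exp (C * t l)).
    { apply Ropp_le_cancel, K.
      - intros b Hb. apply (is_derive_opp (V := R_NormedModule)), DW, Hb.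
      - intros b Hb. rewrite Ropp_involutive. specialize (HB b Hb). apply Rabs_le_between in HB.
        apply Rmult_le_pos; [|lra].
        apply Rmult_le_pos; [apply Rlt_le, Epos | apply Rlt_le, HQ, Hb]. }
    replace (N (th l) * P l) with (N (th l) * P l * exp (C * t l) * exp (- C * t l)).
    + apply Rmult_le_compat_r; [apply Rlt_le, Epos | assumption].
    + rewrite Rmult_assoc, E0. ring.
  - assert (K := nondecreasing_of_derive (fun b => (N (th b) * P b * exp (- C * t b)))
      (fun b => - (exp (- C * t b) * Q b * (kap (th b) * N (th b) * Y b + - C * (N (th b) * P b)))) l u Hlu).
    cbv beta in K. rewrite Htu, Rmult_0_r, exp_0, Rmult_1_r in K.
    assert (N (th l) * P l * exp (- C * t l) <= N (th u) * P u).
    { apply K.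
      - intros b Hb. apply DW, Hb.
      - intros b Hb. specialize (HB b Hb). apply Rabs_le_between in HB.
        replace (- (exp (- C * t b) * Q b * (kap (th b) * N (th b) * Y b + - C * (N (th b) * P b))))
          with (exp (- C * t b) * Q b * (- (kap (th b) * N (th b) * Y b) + C * (N (th b) * P b))) by ring.
        apply Rmult_le_pos; [|lra].
        apply Rmult_le_pos; [apply Rlt_le, Epos | apply Rlt_le, HQ, Hb]. }
    replace (N (th l) * P l) with (N (th l) * P l * exp (- C * t l) * exp (C * t l)).
    + apply Rmult_le_compat_r; [apply Rlt_le, Epos | assumption].
    + rewrite Rmult_assoc, (Rmult_comm (exp (- C * t l))), E0. ring.
Qed.

Variables (G dmp' beta beta' : R -> R) (Kk Gm : R).
Hypothesis G_derive : forall x, is_derive G x (/ (4 * N x)).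
Hypothesis kap_bound : forall x, Rabs (kap x) <= Kk.
Hypothesis dmp_cont : forall x, continuous dmp x.
Hypothesis dmp_derive : forall x, 0 < x -> is_derive dmp x (dmp' x).
Hypothesis beta_cont : forall x, 0 <= x -> continuous beta x.
Hypothesis beta_derive : forall x, 0 < x -> is_derive beta x (beta' x).
Hypothesis dmp_nonneg : forall x, 0 <= dmp x.
Hypothesis beta_nonneg : forall x, 0 <= x -> 0 <= beta x.
(** The left side bounds all that can push the corrected Riccati variable through [beta]: the
    quadratic term, with [N <= 2] and [Rabs y <= beta + dmp * Gm], and the two remainders of the
    correction [dmp * G], one from the damping acting on it and one from its time derivative. The
    right side is the damping at the barrier plus the slope of the barrier. *)
Hypothesis beta_barrier : forall x, 0 < x ->
  2 * Kk * (beta x + dmp x * Gm) ^ 2 + (dmp x ^ 2 / 2 + Rabs (dmp' x)) * Gm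
  < dmp x / 2 * beta x + beta' x.

(* Subtracting [dmp * G] from the Riccati variable [Y / (N P)] removes the coupling to
   the other characteristic family, because [V] is the derivative of [th / 2]. *)
Lemma char_gradient_bound P Q Y V th t l u :
  char_curve P Q Y V th t l u ->
  (forall b, l <= b <= u -> Rabs (G (th b)) <= Gm /\ N (th b) <= 2) ->
  Rabs (Y u / (N (th u) * P u)) + dmp 0 * Gm < beta 0 ->
  Rabs (Y l) <= (beta (t l) + dmp (t l) * Gm) * (N (th l) * P l).
Proof.
  intros HC HG Hu.
  assert (Hlu : l <= u) by apply HC. assert (Htu : t u = 0) by apply HC.
  set (y := fun b => Y b / (N (th b) * P b)).
  set (z := fun b => y b - dmp (t b) * G (th b)).
  assert (HNP : forall b, l <= b <= u -> 0 < N (th b) * P b).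
  { intros b Hb. apply Rmult_lt_0_compat; [apply N_pos | apply HC, Hb]. }
  assert (Dy : forall b, l <= b <= u -> is_derive y b
    (Q b * (dmp (t b) / 2 * y b + kap (th b) * N (th b) * y b ^ 2) + dmp (t b) * V b / (2 * N (th b)))).
  { intros b Hb. assert (HW := HNP b Hb). assert (HN := N_pos (th b)).
    destruct (proj2 (proj2 HC) b Hb) as (HP & _ & _ & DY & _).
    evar_last.
    - apply (is_derive_div Y (fun b => N (th b) * P b)).
      + exact DY.
      + apply (char_NP_derive _ _ _ _ _ _ _ _ b HC Hb).
      + lra.
    - unfold y. field. lra. }
  assert (DG : forall b, l <= b <= u -> is_derive (fun b => G (th b)) b (V b / (2 * N (th b)))).
  { intros b Hb. assert (HN := N_pos (th b)). evar_last.
    - destruct (proj2 (proj2 HC) b Hb) as (_ & _ & _ & _ & Dth & _).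
      apply (is_derive_comp (V := R_NormedModule) G th); [apply G_derive | exact Dth].
    - unfold scal; simpl. unfold mult; simpl. field. lra. }
  assert (Dt : forall b, l <= b <= u -> is_derive t b (- Q b)) by (intros b Hb; apply HC, Hb).
  assert (Dz : forall b, l <= b < u -> is_derive z b
    (Q b * (dmp (t b) / 2 * y b + kap (th b) * N (th b) * y b ^ 2 + dmp' (t b) * G (th b)))).
  { intros b Hb. assert (HN := N_pos (th b)).
    assert (Htb := char_time_pos _ _ _ _ _ _ _ _ b HC Hb).
    evar_last.
    - apply (is_derive_minus (V := R_NormedModule) y).
      + apply Dy. lra.
      + apply (is_derive_mult (fun b => dmp (t b)) (fun b => G (th b))).
        * apply (is_derive_comp (V := R_NormedModule) dmp t); [apply dmp_derive, Htb | apply Dt; lra].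
        * apply DG. lra.
        * intros; apply Rmult_comm.
    - unfold minus, plus, opp, mult, scal; simpl. unfold mult; simpl. field. lra. }
  assert (Db : forall b, l <= b < u ->
    is_derive (fun b => beta (t b)) b (- Q b * beta' (t b))).
  { intros b Hb. assert (Htb := char_time_pos _ _ _ _ _ _ _ _ b HC Hb).
    apply (is_derive_comp (V := R_NormedModule) beta t); [apply beta_derive, Htb | apply Dt; lra]. }
  assert (Cz : forall b, l <= b <= u -> continuous z b).
  { intros b Hb. apply (continuous_minus (V := R_NormedModule)).
    - eapply is_derive_continuous, Dy, Hb.
    - apply (continuous_mult (K := R_AbsRing)).
      + apply (continuous_comp t dmp); [eapply is_derive_continuous, Dt, Hb | apply dmp_cont].
      + eapply is_derive_continuous, DG, Hb. }
  assert (Cb : forall b, l <= b <= u -> continuous (fun b => beta (t b)) b).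
  { intros b Hb. apply (continuous_comp t beta); [eapply is_derive_continuous, Dt, Hb|].
    apply beta_cont. apply (char_time_nonneg _ _ _ _ _ _ _ _ b HC Hb). }
  assert (Hz : Rabs (z u) < beta 0).
  { unfold z. rewrite Htu. eapply Rle_lt_trans; [|exact Hu].
    eapply Rle_trans; [apply Rabs_triang|]. fold (y u).
    apply Rplus_le_compat_l. rewrite Rabs_Ropp, Rabs_mult, (Rabs_pos_eq (dmp 0)) by auto.
    apply Rmult_le_compat_l; [auto | apply HG; lra]. }
  apply Rabs_def2 in Hz.
  (* At contact [z = sg * beta], hence [y = sg * beta + dmp * G]. Damping of the first summand is
     the favourable term; everything else is absorbed by [beta_barrier]. *)
  assert (Hslope : forall sg b, sg = 1 \/ sg = -1 -> l <= b < u -> sg * z b - beta (t b) = 0 ->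
     0 < sg * (Q b * (dmp (t b) / 2 * y b + kap (th b) * N (th b) * y b ^ 2 + dmp' (t b) * G (th b)))
         - - Q b * beta' (t b)).
  { intros sg b Hsg Hb Hz0.
    assert (Htb := char_time_pos _ _ _ _ _ _ _ _ b HC Hb).
    assert (HQ : 0 < Q b) by (apply HC; lra).
    destruct (HG b ltac:(lra)) as [Hg HN2]. assert (HN := N_pos (th b)).
    assert (Hbar := beta_barrier (t b) Htb).
    assert (Hb0 := beta_nonneg (t b) ltac:(lra)). assert (Hd0 := dmp_nonneg (t b)).
    set (d := dmp (t b)) in *. set (d' := dmp' (t b)) in *. set (g := G (th b)) in *.
    set (be := beta (t b)) in *. set (kN := kap (th b) * N (th b)).
    assert (Hy : y b = sg * be + d * g).
    { unfold z in Hz0. fold d g in Hz0. destruct Hsg as [->| ->]; lra. }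
    assert (Hdg : Rabs (d * g) <= d * Gm).
    { rewrite Rabs_mult, (Rabs_pos_eq d) by assumption. now apply Rmult_le_compat_l. }
    assert (Hyb : Rabs (y b) <= be + d * Gm).
    { rewrite Hy. eapply Rle_trans; [apply Rabs_triang|]. apply Rplus_le_compat; [|exact Hdg].
      rewrite Rabs_mult, (Rabs_pos_eq be) by assumption.
      destruct Hsg as [->| ->]; [rewrite Rabs_R1 | rewrite Rabs_left by lra]; lra. }
    assert (Hy2 : y b ^ 2 <= (be + d * Gm) ^ 2).
    { rewrite <- (pow2_abs (y b)). apply pow_incr. split; [apply Rabs_pos | exact Hyb]. }
    assert (HkN : Rabs kN <= 2 * Kk).
    { unfold kN. rewrite Rabs_mult, (Rabs_pos_eq (N (th b))) by lra.
      rewrite Rmult_comm. apply Rmult_le_compat; auto using Rabs_pos; lra. }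
    assert (T1 : Rabs (kN * y b ^ 2) <= 2 * Kk * (be + d * Gm) ^ 2).
    { rewrite Rabs_mult, (Rabs_pos_eq (y b ^ 2)) by apply pow2_ge_0.
      apply Rmult_le_compat; auto using Rabs_pos, pow2_ge_0. }
    assert (T2 : Rabs (d / 2 * (d * g)) <= d ^ 2 / 2 * Gm).
    { rewrite Rabs_mult, (Rabs_pos_eq (d / 2)) by lra.
      replace (d ^ 2 / 2 * Gm) with (d / 2 * (d * Gm)) by field.
      apply Rmult_le_compat_l; lra. }
    assert (T3 : Rabs (d' * g) <= Rabs d' * Gm).
    { rewrite Rabs_mult. apply Rmult_le_compat_l; [apply Rabs_pos | exact Hg]. }
    apply Rabs_le_between in T1. apply Rabs_le_between in T2. apply Rabs_le_between in T3.
    replace (sg * (Q b * (d / 2 * y b + kN * y b ^ 2 + d' * g)) - - Q b * beta' (t b))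
      with (Q b * (sg * (d / 2 * y b + kN * y b ^ 2 + d' * g) + beta' (t b))) by ring.
    apply Rmult_lt_0_compat; [exact HQ|].
    assert (Hs2 : sg * (d / 2 * y b) = d / 2 * be + sg * (d / 2 * (d * g))).
    { rewrite Hy. destruct Hsg as [->| ->]; ring. }
    rewrite !Rmult_plus_distr_l, Hs2.
    destruct Hsg as [->| ->]; lra. }
  assert (Hfin : forall sg, sg = 1 \/ sg = -1 -> sg * z l - beta (t l) < 0).
  { intros sg Hsg. apply (barrier (fun b => sg * z b - beta (t b)) l u); [| | |lra].
    - intros b Hb. apply (continuous_minus (V := R_NormedModule)); [|apply Cb, Hb].
      apply (continuous_scal_r (V := R_NormedModule) sg z), Cz, Hb.
    - rewrite Htu. destruct Hsg as [->| ->]; lra.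
    - intros b Hb H0. eexists. split.
      + apply (is_derive_minus (V := R_NormedModule) (fun b => sg * z b)).
        * apply (is_derive_scal z), Dz, Hb.
        * apply Db, Hb.
      + unfold minus, plus, opp; simpl. apply (Hslope sg b Hsg Hb H0). }
  assert (F1 := Hfin 1 ltac:(auto)). assert (F2 := Hfin (-1) ltac:(auto)).
  assert (Hyl : Rabs (y l) <= beta (t l) + dmp (t l) * Gm).
  { replace (y l) with (z l + dmp (t l) * G (th l)) by (unfold z; ring).
    eapply Rle_trans; [apply Rabs_triang|]. apply Rplus_le_compat.
    - apply Rabs_le. lra.
    - rewrite Rabs_mult, (Rabs_pos_eq (dmp (t l))) by auto.
      apply Rmult_le_compat_l; [auto | apply HG; lra]. }
  assert (HW := HNP l ltac:(lra)).
  replace (Y l) with (y l * (N (th l) * P l)).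
  - rewrite Rabs_mult, (Rabs_pos_eq (N (th l) * P l)) by lra.
    apply Rmult_le_compat_r; lra.
  - assert (HN := N_pos (th l)). assert (HP : 0 < P l) by (apply HC; lra).
    unfold y. field. lra.
Qed.
End Char.

(** * Solutions on a strip of characteristic coordinates *)

(** Starting from any finite bound, the step replaces the excess over [M] by [q] times itself, so
    the excess tends to [0]. This serves on unbounded regions, where a maximum need not be attained;
    some crude bound must be known first. *)
Lemma sup_contraction {I : Type} (S : I -> Prop) (f : I -> R) (M q : R) :
  0 <= q < 1 -> (exists D, forall i, S i -> f i <= D) ->
  (forall D, M <= D -> (forall i, S i -> f i <= D) -> forall i, S i -> f i <= M + q * (D - M)) ->
  forall i, S i -> f i <= M.
Proof.
  intros Hq [D0 HD0] Hstep.
  set (D := Rmax M D0).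
  assert (HMD : M <= D) by apply Rmax_l.
  assert (Hn : forall n i, S i -> f i <= M + q ^ n * (D - M)).
  { induction n as [|n IH].
    - intros i Hi. simpl. specialize (HD0 i Hi). assert (D0 <= D) by apply Rmax_r. lra.
    - intros i Hi.
      assert (Hp : 0 <= q ^ n) by (apply pow_le; lra).
      assert (H := Hstep (M + q ^ n * (D - M)) ltac:(assert (0 <= q ^ n * (D - M)) by (apply Rmult_le_pos; lra); lra) IH i Hi).
      simpl. replace (q * q ^ n * (D - M)) with (q * (M + q ^ n * (D - M) - M)) by ring. exact H. }
  intros i Hi. apply le_epsilon. intros eps He.
  destruct (pow_lt_1_zero q ltac:(rewrite Rabs_pos_eq; lra) (eps / (D - M + 1))) as [n Hn'].
  { apply Rdiv_lt_0_compat; lra. }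
  specialize (Hn' n (le_n _)). specialize (Hn n i Hi).
  assert (Hp : 0 <= q ^ n) by (apply pow_le; lra).
  rewrite Rabs_pos_eq in Hn' by assumption.
  assert (q ^ n * (D - M) <= eps).
  { apply Rle_trans with (q ^ n * (D - M + 1)); [apply Rmult_le_compat_l; lra|].
    apply Rle_trans with (eps / (D - M + 1) * (D - M + 1)); [apply Rmult_le_compat_r; lra|].
    right. field. lra. }
  lra.
Qed.

(* A primitive of the form [A da + B db], defined by integrating [A] only; the form need
   only be closed on the segment under consideration. *)
Lemma primitive_of_form (f0 df0 : R -> R) (A Ab B : R -> R -> R) :
  (forall x, is_derive f0 x (df0 x)) -> (forall x, continuous df0 x) ->
  jcont A -> jcont Ab -> (forall a b, is_derive (fun y => A a y) b (Ab a b)) ->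
  (forall x, df0 x = A x x + B x x) ->
  exists f fb : R -> R -> R,
    C1_plane f A fb /\ (forall x, f x x = f0 x) /\
    (forall a b, f a b = f0 b + int1 A a b) /\
    forall a b, b <= a -> (forall x, b <= x <= a -> is_derive (fun x => B x b) x (Ab x b)) ->
      fb a b = B a b.
Proof.
  intros Hf0 Hdf0 HA HAb HD Hdiag.
  exists (fun a b => f0 b + int1 A a b), (fun a b => df0 b + (int1 Ab a b - A b b)).
  destruct (C1_plane_int1 A Ab HA HAb HD) as (H1 & H2 & H3 & H4).
  split; [split; [|split; [|split]]|split; [|split]].
  - intros a b. rewrite <- (Rplus_0_l (A a b)).
    apply (is_derive_plus (V := R_NormedModule)); [apply (is_derive_const (V := R_NormedModule)) | apply H1].
  - intros a b. apply (is_derive_plus (V := R_NormedModule)); [apply Hf0 | apply H2].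
  - exact HA.
  - apply jcont_plus; [|exact H4]. apply (jcont_comp1 df0); [exact Hdf0 | apply jcont_snd].
  - intros x. rewrite int1_diag. ring.
  - reflexivity.
  - intros a b Hab Hx.
    assert (E : int1 Ab a b = B a b - B b b).
    { unfold int1. apply is_RInt_unique, (is_RInt_derive (fun x => B x b) (fun x => Ab x b)).
      - intros x. rewrite Rmin_left, Rmax_right by lra. apply Hx.
      - intros x _. now apply jcont_slice1. }
    rewrite E, Hdiag. ring.
Qed.

Lemma range_of_sqr (n : R) : 0 < n -> / 2 <= n ^ 2 <= 2 -> / 2 <= n <= 2.
Proof.
  intros Hn H. split; apply Rnot_lt_le; intros h.
  - assert (n ^ 2 < / 2); [|lra]. simpl. rewrite Rmult_1_r.
    apply Rle_lt_trans with (/ 2 * n); [apply Rmult_le_compat_r; lra | lra].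
  - assert (2 < n ^ 2); [|lra]. simpl. rewrite Rmult_1_r.
    apply Rlt_le_trans with (2 * n); [lra | apply Rmult_le_compat_r; lra].
Qed.

Lemma is_derive_along_opp (f : R -> R) (x l : R) :
  is_derive f (- x) l -> is_derive (fun x => f (- x)) x (- l).
Proof.
  intros H. replace (- l) with (scal (-1) l) by (unfold scal; simpl; unfold mult; simpl; ring).
  apply (is_derive_comp (V := R_NormedModule) f (fun x => - x)); [exact H|].
  auto_derive; [trivial | ring].
Qed.

Ltac jc :=
  repeat first [ assumption | apply jcont_const | apply jcont_opp | apply jcont_plus
               | apply jcont_minus | apply jcont_mult ].

(** All functions are differentiable on the whole plane, while equations and estimates hold on the
    closed strip only. This allows derivatives up to the edge of the strip, in particular at
    [t = 0], without one-sided calculus in the characteristic coordinates. *)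
Record strip_solution (kap dmp N bnd v0 th0 : R -> R) (M W ell Lam : R)
    (P Q Y V th t v x vb xb : R -> R -> R) : Prop := {
  ss_ell : 0 < ell;
  ss_cont : jcont P /\ jcont Q /\ jcont Y /\ jcont V;
  ss_th : C1_plane th (fun a b => - 2 * Y a b) (fun a b => 2 * V a b);
  ss_t : C1_plane t P (fun a b => - Q a b);
  ss_v : C1_plane v (fun a b => Y a b - dmp (t a b) * P a b * v a b) vb;
  ss_x : C1_plane x (fun a b => N (th a b) ^ 2 * P a b) xb;
  ss_diag : forall z, th z z = th0 z /\ t z z = 0 /\ v z z = v0 z /\ x z z = z;
  ss_vb : forall a b, 0 <= a - b <= W -> vb a b = V a b + dmp (t a b) * Q a b * v a b;
  ss_xb : forall a b, 0 <= a - b <= W -> xb a b = N (th a b) ^ 2 * Q a b;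
  ss_PQ : forall a b, 0 <= a - b <= W -> ell <= P a b <= Lam /\ ell <= Q a b <= Lam;
  ss_bounds : forall a b, 0 <= a - b <= W -> Rabs (th a b) <= 2 * M /\ Rabs (v a b) <= M;
  ss_t_pos : forall a b, 0 <= a - b <= W -> 0 <= t a b;
  ss_x_t : forall a b, 0 <= a - b <= W ->
    x a b - b <= 2 * t a b /\ a - x a b <= 2 * t a b /\ b <= x a b <= a;
  ss_grad : forall a b, 0 <= a - b <= W ->
    Rabs (Y a b) <= bnd (t a b) * (N (th a b) * P a b) /\
    Rabs (V a b) <= bnd (t a b) * (N (th a b) * Q a b)
}.
Arguments ss_ell {kap dmp N bnd v0 th0 M W ell Lam P Q Y V th t v x vb xb} _.
Arguments ss_cont {kap dmp N bnd v0 th0 M W ell Lam P Q Y V th t v x vb xb} _.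
Arguments ss_th {kap dmp N bnd v0 th0 M W ell Lam P Q Y V th t v x vb xb} _.
Arguments ss_t {kap dmp N bnd v0 th0 M W ell Lam P Q Y V th t v x vb xb} _.
Arguments ss_v {kap dmp N bnd v0 th0 M W ell Lam P Q Y V th t v x vb xb} _.
Arguments ss_x {kap dmp N bnd v0 th0 M W ell Lam P Q Y V th t v x vb xb} _.
Arguments ss_diag {kap dmp N bnd v0 th0 M W ell Lam P Q Y V th t v x vb xb} _.
Arguments ss_vb {kap dmp N bnd v0 th0 M W ell Lam P Q Y V th t v x vb xb} _.
Arguments ss_xb {kap dmp N bnd v0 th0 M W ell Lam P Q Y V th t v x vb xb} _.
Arguments ss_PQ {kap dmp N bnd v0 th0 M W ell Lam P Q Y V th t v x vb xb} _.
Arguments ss_bounds {kap dmp N bnd v0 th0 M W ell Lam P Q Y V th t v x vb xb} _.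
Arguments ss_t_pos {kap dmp N bnd v0 th0 M W ell Lam P Q Y V th t v x vb xb} _.
Arguments ss_x_t {kap dmp N bnd v0 th0 M W ell Lam P Q Y V th t v x vb xb} _.
Arguments ss_grad {kap dmp N bnd v0 th0 M W ell Lam P Q Y V th t v x vb xb} _.

Section Strip.
Variables (kap dmp dmp' N G Eh beta beta' : R -> R) (Kk Kl Ad Al M M1 Gm Bm : R).
Hypothesis kap_bound : forall x, Rabs (kap x) <= Kk.
Hypothesis kap_lip : forall x y, Rabs (kap x - kap y) <= Kl * Rabs (x - y).
Hypothesis dmp_bound : forall x, Rabs (dmp x) <= Ad.
Hypothesis dmp_lip : forall x y, Rabs (dmp x - dmp y) <= Al * Rabs (x - y).
Hypothesis dmp_nonneg : forall x, 0 <= dmp x.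
Hypothesis dmp_derive : forall x, 0 < x -> is_derive dmp x (dmp' x).
Hypothesis N_derive : forall x, is_derive N x (kap x / 2 * N x).
Hypothesis N_pos : forall x, 0 < N x.
Hypothesis G_derive : forall x, is_derive G x (/ (4 * N x)).
Hypothesis Eh_derive : forall t, is_derive Eh t (dmp t / 2 * Eh t).
Hypothesis Eh_pos : forall t, 0 < Eh t.
Hypothesis Eh_0 : Eh 0 = 1.
Hypothesis M_nonneg : 0 <= M.
Hypothesis N_range : forall x, Rabs x <= 2 * M -> / 2 <= N x ^ 2 <= 2.
Hypothesis Gm_nonneg : 0 <= Gm.
Hypothesis G_range : forall x, Rabs x <= 2 * M -> Rabs (G x) <= Gm.
Hypothesis beta_cont : forall x, 0 <= x -> continuous beta x.
Hypothesis beta_derive : forall x, 0 < x -> is_derive beta x (beta' x).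
Hypothesis beta_nonneg : forall x, 0 <= x -> 0 <= beta x.
Hypothesis beta_barrier : forall x, 0 < x ->
  2 * Kk * (beta x + dmp x * Gm) ^ 2 + (dmp x ^ 2 / 2 + Rabs (dmp' x)) * Gm
  < dmp x / 2 * beta x + beta' x.
Hypothesis Bm_bound : forall x, 0 <= x -> beta x + dmp x * Gm <= Bm.

Variables (v0 dv0 th0 dth0 : R -> R).
Hypothesis v0_derive : forall x, is_derive v0 x (dv0 x).
Hypothesis th0_derive : forall x, is_derive th0 x (dth0 x).
Hypothesis dv0_cont : forall x, continuous dv0 x.
Hypothesis dth0_cont : forall x, continuous dth0 x.
Hypothesis r0_bound : forall x, Rabs (v0 x - th0 x / 2) <= M.
Hypothesis s0_bound : forall x, Rabs (v0 x + th0 x / 2) <= M.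
Hypothesis dr0_bound : forall x, Rabs (dv0 x - dth0 x / 2) <= M1.
Hypothesis ds0_bound : forall x, Rabs (dv0 x + dth0 x / 2) <= M1.
Hypothesis beta_init : 2 * M1 + dmp 0 * Gm < beta 0.

Lemma N_le_2 x : Rabs x <= 2 * M -> / 2 <= N x <= 2.
Proof. intros Hx. now apply range_of_sqr, N_range. Qed.

Lemma th0_bound x : Rabs (th0 x) <= 2 * M.
Proof.
  generalize (r0_bound x) (s0_bound x). intros H1 H2.
  apply Rabs_le_between in H1. apply Rabs_le_between in H2. apply Rabs_le. lra.
Qed.

Lemma Eh_mono t t' : t <= t' -> Eh t <= Eh t'.
Proof.
  intros H. apply (nondecreasing_of_derive Eh (fun t => dmp t / 2 * Eh t)); auto.
  intros x _. apply Rmult_le_pos; [generalize (dmp_nonneg x); lra | apply Rlt_le, Eh_pos].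
Qed.

Lemma dmp_cont x : continuous dmp x.
Proof. apply (continuous_lip dmp Al dmp_lip). Qed.

Section Width.
Variables (P Q Y V th t v x vb xb : R -> R -> R) (Lam ell : R).
Hypothesis ell_pos : 0 < ell.
Hypothesis Lam_pos : 0 < Lam.
Let J := fun a b => clamped_J Lam (P a b) (Q a b) (Y a b) (V a b).
Hypothesis P_b : forall a b, is_derive (fun y => P a y) b (- (kap (th a b) * J a b)).
Hypothesis Q_a : forall a b, is_derive (fun x => Q x b) a (kap (th a b) * J a b).
Hypothesis Y_b : forall a b, is_derive (fun y => Y a y) b (dmp (t a b) / 2 * J a b).
Hypothesis V_a : forall a b, is_derive (fun x => V x b) a (- (dmp (t a b) / 2 * J a b)).
Hypothesis th_C1 : C1_plane th (fun a b => - 2 * Y a b) (fun a b => 2 * V a b).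
Hypothesis t_C1 : C1_plane t P (fun a b => - Q a b).
Hypothesis v_C1 : C1_plane v (fun a b => Y a b - dmp (t a b) * P a b * v a b) vb.
Hypothesis x_C1 : C1_plane x (fun a b => N (th a b) ^ 2 * P a b) xb.
(** On the diagonal [t = 0] and [x z z = z], so [P = Q] and [c * (P + Q) = 1], that is
    [P = Q = 1 / (2 c)] with [c = N ^ 2]. Then [Y = c r_x P] and [V = c s_x Q] are half the initial
    slopes of the invariants. *)
Hypothesis diag : forall z,
  P z z = / (2 * N (th0 z) ^ 2) /\ Q z z = / (2 * N (th0 z) ^ 2) /\
  Y z z = (dv0 z - dth0 z / 2) / 2 /\ V z z = (dv0 z + dth0 z / 2) / 2 /\
  th z z = th0 z /\ t z z = 0 /\ v z z = v0 z /\ x z z = z.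

Let th_a a b : is_derive (fun z => th z b) a (- 2 * Y a b) := proj1 th_C1 a b.
Let th_b a b : is_derive (fun z => th a z) b (2 * V a b) := proj1 (proj2 th_C1) a b.
Let t_a a b : is_derive (fun z => t z b) a (P a b) := proj1 t_C1 a b.
Let t_b a b : is_derive (fun z => t a z) b (- Q a b) := proj1 (proj2 t_C1) a b.
Let v_a a b : is_derive (fun z => v z b) a (Y a b - dmp (t a b) * P a b * v a b) := proj1 v_C1 a b.
Let v_b a b : is_derive (fun z => v a z) b (vb a b) := proj1 (proj2 v_C1) a b.
Let x_a a b : is_derive (fun z => x z b) a (N (th a b) ^ 2 * P a b) := proj1 x_C1 a b.
Let x_b a b : is_derive (fun z => x a z) b (xb a b) := proj1 (proj2 x_C1) a b.

Definition loose (a b : R) : Prop :=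
  ell <= P a b <= Lam /\ ell <= Q a b <= Lam /\ Rabs (Y a b) <= Lam /\ Rabs (V a b) <= Lam.

(** The form defining [v] is closed only where the truncation is inactive. Its primitive integrates
    in the first coordinate from the diagonal, so the second partial derivative is correct once that
    one segment is loose; the same holds for [x]. *)
Hypothesis vb_spec : forall a b, b <= a -> (forall z, b <= z <= a -> loose z b) ->
  vb a b = V a b + dmp (t a b) * Q a b * v a b.
Hypothesis xb_spec : forall a b, b <= a -> (forall z, b <= z <= a -> loose z b) ->
  xb a b = N (th a b) ^ 2 * Q a b.

Section Height.
Variable h : R.
Hypothesis loose_h : forall a b, 0 <= a - b <= h -> loose a b.

Lemma loose_J a b : loose a b -> J a b = Q a b * Y a b + P a b * V a b.
Proof.
  intros (H1 & H2 & H3 & H4). unfold J. apply clamped_J_id; auto; rewrite Rabs_pos_eq; lra.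
Qed.

Lemma char_r a b : 0 <= a - b <= h ->
  char_curve kap dmp (P a) (Q a) (Y a) (V a) (th a) (t a) b a.
Proof.
  intros Hab. split; [lra|]. split; [apply diag|].
  intros b' Hb'. assert (HL := loose_h a b' ltac:(lra)).
  rewrite <- (loose_J a b' HL). destruct HL as (H1 & H2 & H3 & H4).
  split; [lra|]. split; [lra|].
  split; [apply P_b|]. split; [apply Y_b|]. split; [apply th_b | apply t_b].
Qed.

(** For fixed [b], time increases with the first coordinate, opposite to the convention of
    [char_curve]. The reflection [z -> - z] restores it and exchanges the roles of [(P, Y)] and
    [(Q, V)], so every estimate along one family also serves the other. *)
Lemma char_s a b : 0 <= a - b <= h ->
  char_curve kap dmp (fun z => Q (- z) b) (fun z => P (- z) b) (fun z => V (- z) b)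
    (fun z => Y (- z) b) (fun z => th (- z) b) (fun z => t (- z) b) (- a) (- b).
Proof.
  intros Hab. split; [lra|]. split; [rewrite Ropp_involutive; apply diag|].
  intros z Hz. assert (HL := loose_h (- z) b ltac:(lra)).
  rewrite (Rplus_comm (P (- z) b * V (- z) b)), <- (loose_J (- z) b HL).
  destruct HL as (H1 & H2 & H3 & H4).
  split; [lra|]. split; [lra|].
  split; [apply (is_derive_along_opp (fun z => Q z b)); apply (Q_a (- z) b)|].
  split; [|split].
  - rewrite <- (Ropp_involutive (_ / 2 * _)). apply (is_derive_along_opp (fun z => V z b)); apply (V_a (- z) b).
  - replace (2 * Y (- z) b) with (- (- 2 * Y (- z) b)) by ring.
    apply (is_derive_along_opp (fun z => th z b)); apply th_a.
  - apply (is_derive_along_opp (fun z => t z b)); apply t_a.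
Qed.

Lemma strip_time a b : 0 <= a - b <= h -> 0 <= t a b <= Lam * (a - b).
Proof.
  intros Hab. split.
  - apply (char_time_nonneg _ _ _ _ _ _ _ _ _ _ _ (char_r a b Hab)). lra.
  - assert (K := Rabs_diff_le_of_derive (fun z => t z b) (fun z => P z b) b a Lam ltac:(lra)).
    cbv beta in K. destruct (diag b) as (_ & _ & _ & _ & _ & Ht & _). rewrite Ht, Rminus_0_r in K.
    eapply Rle_trans; [apply Rle_abs|]. apply K.
    + intros z _. apply t_a.
    + intros z Hz. destruct (loose_h z b ltac:(lra)) as (H1 & _). rewrite Rabs_pos_eq; lra.
Qed.

(** Only finiteness matters here: this is the starting bound for [sup_contraction], obtained from
    the loose bounds and allowed to depend on [Lam] and [h]. *)
Lemma strip_invariants_crude : 0 <= h ->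
  exists D, forall a b, 0 <= a - b <= h ->
    Rabs (v a b - th a b / 2) <= D /\ Rabs (v a b + th a b / 2) <= D.
Proof.
  intros Hh.
  set (E2 := Eh (Lam * h) ^ 2).
  exists ((M + E2 * Lam * h) + (2 * M + 2 * Lam * h)).
  intros a b Hab.
  assert (Hth : Rabs (th a b) <= 2 * M + 2 * Lam * h).
  { assert (K := Rabs_diff_le_of_derive (fun z => th z b) (fun z => - 2 * Y z b) b a (2 * Lam) ltac:(lra)).
    cbv beta in K. destruct (diag b) as (_ & _ & _ & _ & Ht & _). rewrite Ht in K.
    assert (K' : Rabs (th a b - th0 b) <= 2 * Lam * (a - b)).
    { apply K; [intros z _; apply th_a|].
      intros z Hz. destruct (loose_h z b ltac:(lra)) as (_ & _ & H1 & _).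
      rewrite Rabs_mult, Rabs_left by lra. lra. }
    replace (th a b) with ((th a b - th0 b) + th0 b) by ring.
    eapply Rle_trans; [apply Rabs_triang|]. generalize (th0_bound b).
    assert (2 * Lam * (a - b) <= 2 * Lam * h) by (apply Rmult_le_compat_l; lra). lra. }
  assert (Hv : Rabs (v a b) <= M + E2 * Lam * h).
  { assert (Ht := fun z Hz => strip_time z b Hz).
    (* The factor [Eh ^ 2] is the exponential of the full integrated damping; it removes [v] from
       the right-hand side of its own equation. *)
    assert (K := Rabs_diff_le_of_derive (fun z => v z b * Eh (t z b) ^ 2) (fun z => Eh (t z b) ^ 2 * Y z b) b a (E2 * Lam) ltac:(lra)).
    cbv beta in K. destruct (diag b) as (_ & _ & _ & _ & _ & Ht0 & Hv0 & _).
    rewrite Ht0, Hv0, Eh_0 in K.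
    assert (HE : forall z, b <= z <= a -> Eh (t z b) ^ 2 <= E2).
    { intros z Hz. unfold E2. apply pow_incr. split; [apply Rlt_le, Eh_pos|].
      apply Eh_mono. destruct (Ht z ltac:(lra)) as [_ H2].
      eapply Rle_trans; [exact H2|]. apply Rmult_le_compat_l; lra. }
    assert (K' : Rabs (v a b * Eh (t a b) ^ 2 - v0 b * 1 ^ 2) <= E2 * Lam * (a - b)).
    { apply K.
      - intros z Hz. evar_last.
        + apply (is_derive_mult (fun z => v z b) (fun z => Eh (t z b) ^ 2)).
          * apply v_a.
          * apply (is_derive_pow (fun z => Eh (t z b)) 2).
            apply (is_derive_comp (V := R_NormedModule) Eh (fun z => t z b)); [apply Eh_derive | apply t_a].
          * intros; apply Rmult_comm.
        + unfold plus, mult, scal; simpl. unfold mult; simpl. field.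
      - intros z Hz. rewrite Rabs_mult, (Rabs_pos_eq (Eh (t z b) ^ 2)) by apply pow2_ge_0.
        destruct (loose_h z b ltac:(lra)) as (_ & _ & H1 & _).
        apply Rmult_le_compat; auto using pow2_ge_0, Rabs_pos. }
    assert (HE1 : 1 <= Eh (t a b) ^ 2).
    { rewrite <- (pow1 2). apply pow_incr. split; [lra|].
      rewrite <- Eh_0. apply Eh_mono. apply Ht, Hab. }
    assert (Hv0b : Rabs (v0 b) <= M).
    { generalize (r0_bound b) (s0_bound b). intros H1 H2.
      apply Rabs_le_between in H1. apply Rabs_le_between in H2. apply Rabs_le. lra. }
    apply Rle_trans with (Rabs (v a b * Eh (t a b) ^ 2)).
    { rewrite Rabs_mult, (Rabs_pos_eq (Eh (t a b) ^ 2)) by lra.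
      rewrite <- (Rmult_1_r (Rabs (v a b))) at 1. apply Rmult_le_compat_l; [apply Rabs_pos | lra]. }
    replace (v a b * Eh (t a b) ^ 2) with ((v a b * Eh (t a b) ^ 2 - v0 b * 1 ^ 2) + v0 b) by ring.
    eapply Rle_trans; [apply Rabs_triang|].
    assert (E2 * Lam * (a - b) <= E2 * Lam * h).
    { apply Rmult_le_compat_l; [|lra]. apply Rmult_le_pos; [apply pow2_ge_0 | lra]. }
    lra. }
  assert (T2 : Rabs (th a b / 2) <= Rabs (th a b)).
  { unfold Rdiv. rewrite Rabs_mult, (Rabs_pos_eq (/2)) by lra. generalize (Rabs_pos (th a b)). lra. }
  split.
  - eapply Rle_trans; [apply Rabs_triang|]. rewrite Rabs_Ropp. lra.
  - eapply Rle_trans; [apply Rabs_triang|]. lra.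
Qed.

(** The estimate of each invariant uses a bound for the other, so both enter a single supremum. On
    the strip [Eh (t a b)] is at most [e1 = Eh (Lam * h)], which makes the contraction factor
    [1 - / e1] uniform. The limit bound [M] no longer depends on [Lam] or [h]. *)
Lemma strip_invariants a b : 0 <= a - b <= h ->
  Rabs (v a b - th a b / 2) <= M /\ Rabs (v a b + th a b / 2) <= M.
Proof.
  intros Hab0. assert (Hh : 0 <= h) by lra.
  set (S := fun p : R * R => 0 <= fst p - snd p <= h).
  set (f := fun p : R * R => Rmax (Rabs (v (fst p) (snd p) - th (fst p) (snd p) / 2))
                                  (Rabs (v (fst p) (snd p) + th (fst p) (snd p) / 2))).
  set (e1 := Eh (Lam * h)).
  assert (He1 : 1 <= e1).
  { unfold e1. rewrite <- Eh_0. apply Eh_mono. apply Rmult_le_pos; lra. }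
  assert (Hie : 0 < / e1 <= 1).
  { split; [apply Rinv_0_lt_compat; lra|]. rewrite <- Rinv_1. apply Rinv_le_contravar; lra. }
  assert (K : forall p, S p -> f p <= M).
  { apply (sup_contraction S f M (1 - / e1)); [lra| |].
    - destruct (strip_invariants_crude Hh) as [D HD]. exists D.
      intros [a' b'] Hp. apply Rmax_lub; apply (HD a' b' Hp).
    - intros D HMD HD [a' b'] Hp. unfold S in Hp; simpl in Hp.
      assert (HD' : forall a b, 0 <= a - b <= h ->
        Rabs (v a b - th a b / 2) <= D /\ Rabs (v a b + th a b / 2) <= D).
      { intros a'' b'' H. specialize (HD (a'', b'') H). unfold f in HD; simpl in HD.
        split; eapply Rle_trans; [apply Rmax_l | exact HD | apply Rmax_r | exact HD]. }
      destruct (strip_time a' b' Hp) as [Ht0 Ht1].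
      assert (HEt : 1 <= Eh (t a' b') <= e1).
      { split; [rewrite <- Eh_0; now apply Eh_mono|].
        apply Eh_mono. eapply Rle_trans; [exact Ht1|]. apply Rmult_le_compat_l; lra. }
      assert (Hconv : forall z, z * Eh (t a' b') <= M + D * (Eh (t a' b') - 1) ->
                z <= M + (1 - / e1) * (D - M)).
      { intros z Hz. set (e := Eh (t a' b')) in *.
        assert (z <= D - (D - M) * / e).
        { apply Rmult_le_reg_r with e; [lra|].
          replace ((D - (D - M) * / e) * e) with (M + D * (e - 1)) by (field; lra). exact Hz. }
        assert (/ e1 <= / e) by (apply Rinv_le_contravar; lra).
        assert ((D - M) * / e1 <= (D - M) * / e) by (apply Rmult_le_compat_l; lra).
        lra. }
      assert (Hr : forall a b, 0 <= a - b <= h -> is_derive (fun y => v a y - th a y / 2) b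
         (dmp (t a b) * Q a b * ((v a b - th a b / 2) + (v a b + th a b / 2)) / 2)).
      { intros a1 b1 H1. evar_last.
        - apply (is_derive_minus (V := R_NormedModule) (fun y => v a1 y) (fun y => th a1 y / 2)).
          + apply v_b.
          + apply (is_derive_ext (fun y => / 2 * th a1 y)); [intros; apply Rmult_comm|].
            apply (is_derive_scal (fun y => th a1 y)), th_b.
        - rewrite (vb_spec a1 b1); [|lra|intros; apply loose_h; lra].
          unfold minus, plus, opp; simpl. field. }
      assert (Hs : forall a b, 0 <= a - b <= h -> is_derive (fun z => v z b + th z b / 2) a
         (- (dmp (t a b) * P a b * ((v a b + th a b / 2) + (v a b - th a b / 2)) / 2))).
      { intros a1 b1 H1. evar_last.
        - apply (is_derive_plus (V := R_NormedModule) (fun z => v z b1) (fun z => th z b1 / 2)).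
          + apply v_a.
          + apply (is_derive_ext (fun z => / 2 * th z b1)); [intros; apply Rmult_comm|].
            apply (is_derive_scal (fun z => th z b1)), th_a.
        - unfold plus; simpl. field. }
      apply Rmax_lub; apply Hconv; simpl.
      + apply (char_invariant_bound dmp Eh Eh_derive Eh_pos Eh_0 (Q a') (t a')
          (fun y => v a' y - th a' y / 2) (fun y => v a' y + th a' y / 2) b' a'); [lra | apply diag | |].
        * intros y Hy. destruct (loose_h a' y ltac:(lra)) as (_ & H2 & _).
          split; [lra|]. split; [apply dmp_nonneg|]. split; [apply HD'; lra|].
          split; [apply t_b | apply Hr; lra].
        * destruct (diag a') as (_ & _ & _ & _ & -> & _ & -> & _). apply r0_bound.
      + assert (T := char_invariant_bound dmp Eh Eh_derive Eh_pos Eh_0 (fun z => P (- z) b') (fun z => t (- z) b')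
          (fun z => v (- z) b' + th (- z) b' / 2) (fun z => v (- z) b' - th (- z) b' / 2) (- a') (- b') M D).
        cbv beta in T. rewrite !Ropp_involutive in T. apply T; [lra | apply diag | |].
        * intros y Hy. destruct (loose_h (- y) b' ltac:(lra)) as (H2 & _).
          split; [lra|]. split; [apply dmp_nonneg|]. split; [apply HD'; lra|].
          split; [apply (is_derive_along_opp (fun z => t z b')); apply t_a|].
          rewrite <- (Ropp_involutive (_ / 2)).
          apply (is_derive_along_opp (fun z => v z b' + th z b' / 2)). apply (Hs (- y) b'). lra.
        * destruct (diag b') as (_ & _ & _ & _ & -> & _ & -> & _). apply s0_bound. }
  specialize (K (a, b) Hab0). unfold f in K; simpl in K.
  split; eapply Rle_trans; [apply Rmax_l | exact K | apply Rmax_r | exact K].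
Qed.

Lemma strip_theta a b : 0 <= a - b <= h -> Rabs (th a b) <= 2 * M /\ Rabs (v a b) <= M.
Proof.
  intros Hab. destruct (strip_invariants a b Hab) as [H1 H2].
  apply Rabs_le_between in H1. apply Rabs_le_between in H2. split; apply Rabs_le; lra.
Qed.

(** The wave speed [N ^ 2] lies between [1/2] and [2], so suitable combinations of [x] and [t] are
    monotone along both coordinate lines. Adding the two lines gives [t <= a - b <= 4 * t]: the
    upper bound on [t] is free of [Lam], and the lower one explains strips of width [4 * T]. *)
Lemma strip_x_t a b : 0 <= a - b <= h ->
  t a b / 2 <= x a b - b <= 2 * t a b /\ t a b / 2 <= a - x a b <= 2 * t a b.
Proof.
  intros Hab.
  assert (Da : forall sg k z, is_derive (fun z => sg * x z b + k * t z b) z (sg * (N (th z b) ^ 2 * P z b) + k * P z b)).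
  { intros sg k z. apply (is_derive_plus (V := R_NormedModule) (fun z => sg * x z b) (fun z => k * t z b)).
    - apply (is_derive_scal (fun z => x z b)), x_a.
    - apply (is_derive_scal (fun z => t z b)), t_a. }
  assert (Db : forall sg k z, b <= z <= a ->
     is_derive (fun y => sg * x a y + k * t a y) z (sg * (N (th a z) ^ 2 * Q a z) + k * (- Q a z))).
  { intros sg k z Hz. rewrite <- (xb_spec a z); [|lra|intros; apply loose_h; lra].
    apply (is_derive_plus (V := R_NormedModule) (fun z => sg * x a z) (fun z => k * t a z)).
    - apply (is_derive_scal (fun z => x a z)), x_b.
    - apply (is_derive_scal (fun z => t a z)), t_b. }
  destruct (diag a) as (_ & _ & _ & _ & _ & Hta & _ & Hxa).
  destruct (diag b) as (_ & _ & _ & _ & _ & Htb & _ & Hxb).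
  assert (K1 := nondecreasing_of_derive (fun z => 1 * x z b + - / 2 * t z b) _ b a ltac:(lra) (fun z _ => Da 1 (- / 2) z)).
  assert (K2 := nondecreasing_of_derive (fun z => -1 * x z b + 2 * t z b) _ b a ltac:(lra) (fun z _ => Da (-1) 2 z)).
  assert (K3 := nondecreasing_of_derive (fun z => 1 * x a z + / 2 * t a z) _ b a ltac:(lra) (Db 1 (/ 2))).
  assert (K4 := nondecreasing_of_derive (fun z => -1 * x a z + - 2 * t a z) _ b a ltac:(lra) (Db (-1) (- 2))).
  cbv beta in K1, K2, K3, K4. rewrite Hta, Hxa in K3, K4. rewrite Htb, Hxb in K1, K2.
  assert (HP : forall z, b <= z <= a -> / 2 * P z b <= N (th z b) ^ 2 * P z b <= 2 * P z b).
  { intros z Hz. destruct (loose_h z b ltac:(lra)) as (H1 & _).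
    assert (H2 := N_range (th z b) (proj1 (strip_theta z b ltac:(lra)))).
    split; apply Rmult_le_compat_r; lra. }
  assert (HQ : forall z, b <= z <= a -> / 2 * Q a z <= N (th a z) ^ 2 * Q a z <= 2 * Q a z).
  { intros z Hz. destruct (loose_h a z ltac:(lra)) as (_ & H1 & _).
    assert (H2 := N_range (th a z) (proj1 (strip_theta a z ltac:(lra)))).
    split; apply Rmult_le_compat_r; lra. }
  specialize (K1 (fun z Hz => ltac:(generalize (HP z Hz); lra))).
  specialize (K2 (fun z Hz => ltac:(generalize (HP z Hz); lra))).
  specialize (K3 (fun z Hz => ltac:(generalize (HQ z Hz); lra))).
  specialize (K4 (fun z Hz => ltac:(generalize (HQ z Hz); lra))).
  lra.
Qed.

Lemma strip_gradient a b : 0 <= a - b <= h ->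
  Rabs (Y a b) <= (beta (t a b) + dmp (t a b) * Gm) * (N (th a b) * P a b) /\
  Rabs (V a b) <= (beta (t a b) + dmp (t a b) * Gm) * (N (th a b) * Q a b).
Proof.
  intros Hab.
  (* With [P = 1 / (2 N ^ 2)] the initial Riccati variable is [N] times the slope of the invariant,
     and [N <= 2]; hence the term [2 * M1] in [beta_init]. *)
  assert (Hini : forall z w p, Rabs (2 * w) <= M1 -> p = / (2 * N (th0 z) ^ 2) ->
            Rabs (w / (N (th0 z) * p)) + dmp 0 * Gm < beta 0).
  { intros z w p Hw ->. eapply Rle_lt_trans; [|exact beta_init]. apply Rplus_le_compat_r.
    assert (Hn := N_pos (th0 z)). destruct (N_le_2 (th0 z) (th0_bound z)) as [_ Hn2].
    replace (w / (N (th0 z) * / (2 * N (th0 z) ^ 2))) with (N (th0 z) * (2 * w)) by (field; lra).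
    rewrite Rabs_mult, (Rabs_pos_eq (N (th0 z))) by lra.
    apply Rmult_le_compat; auto using Rabs_pos; lra. }
  split.
  - apply (char_gradient_bound kap dmp N N_derive N_pos G dmp' beta beta' Kk Gm
      G_derive kap_bound dmp_cont dmp_derive beta_cont beta_derive dmp_nonneg beta_nonneg
      beta_barrier _ _ _ _ _ _ _ _ (char_r a b Hab)).
    + intros y Hy. assert (Hth := proj1 (strip_theta a y ltac:(lra))).
      split; [now apply G_range | now apply N_le_2].
    + destruct (diag a) as (HP & HQ & HY & HV & Hth & _). rewrite Hth. apply Hini; [|exact HP].
      rewrite HY. replace (2 * ((dv0 a - dth0 a / 2) / 2)) with (dv0 a - dth0 a / 2) by field. apply dr0_bound.
  - assert (T := char_gradient_bound kap dmp N N_derive N_pos G dmp' beta beta' Kk Gm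
      G_derive kap_bound dmp_cont dmp_derive beta_cont beta_derive dmp_nonneg beta_nonneg
      beta_barrier _ _ _ _ _ _ _ _ (char_s a b Hab)).
    cbv beta in T. rewrite !Ropp_involutive in T. apply T.
    + intros y Hy. assert (Hth := proj1 (strip_theta (- y) b ltac:(lra))).
      split; [now apply G_range | now apply N_le_2].
    + destruct (diag b) as (HP & HQ & HY & HV & Hth & _). rewrite Hth. apply Hini; [|exact HQ].
      rewrite HV. replace (2 * ((dv0 b + dth0 b / 2) / 2)) with (dv0 b + dth0 b / 2) by field. apply ds0_bound.
Qed.

Lemma strip_density a b : 0 <= a - b <= h ->
  / 4 * exp (- (2 * Kk * Bm) * t a b) <= N (th a b) * P a b <= exp (2 * Kk * Bm * t a b) /\
  / 4 * exp (- (2 * Kk * Bm) * t a b) <= N (th a b) * Q a b <= exp (2 * Kk * Bm * t a b).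
Proof.
  intros Hab.
  assert (Hini : forall z p, p = / (2 * N (th0 z) ^ 2) -> / 4 <= N (th0 z) * p <= 1).
  { intros z p ->. assert (Hn := N_pos (th0 z)). destruct (N_le_2 (th0 z) (th0_bound z)) as [Hn1 Hn2].
    replace (N (th0 z) * / (2 * N (th0 z) ^ 2)) with (/ (2 * N (th0 z))) by (field; lra).
    split.
    - apply Rinv_le_contravar; lra.
    - rewrite <- Rinv_1. apply Rinv_le_contravar; lra. }
  assert (Hkey : forall th y n p tt, Rabs th <= 2 * M -> n = N th -> 0 < p -> 0 <= tt ->
    Rabs y <= (beta tt + dmp tt * Gm) * (n * p) -> Rabs (kap th * n * y) <= 2 * Kk * Bm * (n * p)).
  { intros th1 y n p tt Hth -> Hp Htt Hy.
    assert (Hn := N_pos th1). destruct (N_le_2 th1 Hth) as [_ Hn2].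
    assert (HK : 0 <= Kk) by (eapply Rle_trans; [apply Rabs_pos | apply (kap_bound 0)]).
    assert (Hy' : Rabs y <= Bm * (N th1 * p)).
    { eapply Rle_trans; [exact Hy|]. apply Rmult_le_compat_r; [|now apply Bm_bound].
      apply Rmult_le_pos; lra. }
    rewrite !Rabs_mult, (Rabs_pos_eq (N th1)) by lra.
    replace (2 * Kk * Bm * (N th1 * p)) with ((Kk * 2) * (Bm * (N th1 * p))) by ring.
    apply Rmult_le_compat; [| |apply Rmult_le_compat|]; auto using Rabs_pos.
    - apply Rmult_le_pos; [apply Rabs_pos | lra].
    - lra. }
  assert (Hfin : forall w q e1 e2, / 4 <= w <= 1 -> 0 < e1 -> 0 < e2 -> w * e1 <= q <= w * e2 ->
             / 4 * e1 <= q <= e2).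
  { intros w q e1 e2 Hw He1 He2 Hq.
    assert (/ 4 * e1 <= w * e1) by (apply Rmult_le_compat_r; lra).
    assert (w * e2 <= 1 * e2) by (apply Rmult_le_compat_r; lra). lra. }
  split.
  - destruct (diag a) as (HP & HQ & HY & HV & Hth & _).
    apply (Hfin (N (th0 a) * P a a)); auto using exp_pos.
    rewrite <- Hth at 1 2.
    apply (char_density_bounds kap dmp N N_derive _ _ _ _ _ _ _ _ _ (char_r a b Hab)).
    intros y Hy. assert (Hc : 0 <= a - y <= h) by lra.
    destruct (loose_h a y Hc) as (H1 & H2 & _).
    apply (Hkey _ _ _ _ (t a y)); [apply strip_theta; lra | reflexivity | lra | apply strip_time; lra | apply strip_gradient; lra].
  - destruct (diag b) as (HP & HQ & HY & HV & Hth & _).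
    apply (Hfin (N (th0 b) * Q b b)); auto using exp_pos.
    rewrite <- Hth at 1 2.
    assert (T := char_density_bounds kap dmp N N_derive _ _ _ _ _ _ _ _ (2 * Kk * Bm) (char_s a b Hab)).
    cbv beta in T. rewrite !Ropp_involutive in T. apply T.
    intros y Hy. assert (Hc : 0 <= - y - b <= h) by lra.
    destruct (loose_h (- y) b Hc) as (H1 & H2 & _).
    apply (Hkey _ _ _ _ (t (- y) b)); [apply strip_theta; lra | reflexivity | lra | apply strip_time; lra | apply strip_gradient; lra].
Qed.
End Height.

(** * Continuation up to a prescribed width *)

Variable W : R.
Hypothesis W_pos : 0 < W.
(** [N * P] starts between [1/4] and [1] and changes at most by the factor [exp (2 * Kk * Bm * W)]
    either way, while [N] stays between [1/2] and [2]. This gives [2 * ell] as a lower bound for [P]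
    and twice the exponential as an upper one; the gradients are at most [Bm] times the
    exponential. *)
Hypothesis ell_def : ell = / 16 * exp (- (2 * Kk * Bm * W)).
Hypothesis Lam_def : Lam = (2 + Bm) * exp (2 * Kk * Bm * W) + 1.

Lemma Kk_nonneg : 0 <= Kk.
Proof. eapply Rle_trans; [apply Rabs_pos | apply (kap_bound 0)]. Qed.

Lemma Bm_nonneg : 0 <= Bm.
Proof.
  eapply Rle_trans; [|apply (Bm_bound 0); lra].
  apply Rplus_le_le_0_compat; [apply beta_nonneg; lra | apply Rmult_le_pos; auto].
Qed.

(** The gap to [loose], of size [ell] below and [1] above, pays for the next step of the
    continuation. *)
Definition tight (a b : R) : Prop :=
  2 * ell <= P a b <= Lam - 1 /\ 2 * ell <= Q a b <= Lam - 1 /\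
  Rabs (Y a b) <= Lam - 1 /\ Rabs (V a b) <= Lam - 1.

Lemma tight_of_loose h : 0 <= h <= W ->
  (forall a b, 0 <= a - b <= h -> loose a b) -> forall a b, 0 <= a - b <= h -> tight a b.
Proof.
  intros Hh HL a b Hab.
  assert (HK := Kk_nonneg). assert (HB := Bm_nonneg).
  destruct (strip_theta h HL a b Hab) as [Hth _].
  destruct (N_le_2 _ Hth) as [Hn1 Hn2]. assert (Hn := N_pos (th a b)).
  destruct (strip_gradient h HL a b Hab) as [HY HV].
  destruct (strip_density h HL a b Hab) as [HP HQ].
  destruct (strip_time h HL a b Hab) as [Ht0 _].
  destruct (strip_x_t h HL a b Hab) as [Hx1 Hx2].
  destruct (HL a b Hab) as (LP & LQ & _).
  (* Taken from the wave speed bounds. The estimate [t <= Lam * (a - b)] would make the choice of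
     [Lam] circular. *)
  assert (Htab : t a b <= W) by lra.
  assert (HKB : 0 <= 2 * Kk * Bm) by (apply Rmult_le_pos; lra).
  set (X := exp (2 * Kk * Bm * W)) in *.
  assert (HX : exp (2 * Kk * Bm * t a b) <= X).
  { apply exp_le_compat, Rmult_le_compat_l; assumption. }
  assert (HX' : exp (- (2 * Kk * Bm * W)) <= exp (- (2 * Kk * Bm) * t a b)).
  { apply exp_le_compat. rewrite <- Ropp_mult_distr_l. apply Ropp_le_contravar, Rmult_le_compat_l; assumption. }
  assert (HXp : 0 < X) by apply exp_pos.
  assert (HBt := Bm_bound (t a b) Ht0).
  assert (HBX : 0 <= Bm * X) by (apply Rmult_le_pos; lra).
  assert (KP : forall p, 0 < p -> / 4 * exp (- (2 * Kk * Bm) * t a b) <= N (th a b) * p <= exp (2 * Kk * Bm * t a b) ->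
     2 * ell <= p <= Lam - 1).
  { intros p Hp H.
    assert (N (th a b) * p <= 2 * p) by (apply Rmult_le_compat_r; lra).
    assert (/ 2 * p <= N (th a b) * p) by (apply Rmult_le_compat_r; lra).
    rewrite ell_def, Lam_def. split; lra. }
  assert (KY : forall y p, 0 < p -> / 4 * exp (- (2 * Kk * Bm) * t a b) <= N (th a b) * p <= exp (2 * Kk * Bm * t a b) ->
     Rabs y <= (beta (t a b) + dmp (t a b) * Gm) * (N (th a b) * p) -> Rabs y <= Lam - 1).
  { intros y p Hp H Hy.
    assert (Rabs y <= Bm * X).
    { eapply Rle_trans; [exact Hy|].
      apply Rle_trans with (Bm * (N (th a b) * p)).
      - apply Rmult_le_compat_r; [apply Rmult_le_pos; lra | assumption].
      - apply Rmult_le_compat_l; lra. }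
    rewrite Lam_def. lra. }
  repeat split; try (apply (KP (P a b)); [lra | exact HP]); try (apply (KP (Q a b)); [lra | exact HQ]).
  - apply (KY _ (P a b)); [lra | exact HP | exact HY].
  - apply (KY _ (Q a b)); [lra | exact HQ | exact HV].
Qed.

(* Continuous induction in the width, with a uniform step: the truncated system has
   bounded right-hand sides. *)
Lemma strip_loose a b : 0 <= a - b <= W -> loose a b.
Proof.
  assert (HK := Kk_nonneg).
  assert (HAd : 0 <= Ad) by (eapply Rle_trans; [apply Rabs_pos | apply (dmp_bound 0)]).
  set (R0 := (Kk + Ad) * (2 * (Lam * Lam)) + 1).
  assert (HLL : 0 < Lam * Lam) by (apply Rmult_lt_0_compat; lra).
  assert (HKLL : 0 <= Kk * (2 * (Lam * Lam))) by (apply Rmult_le_pos; lra).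
  assert (HALL : 0 <= Ad * (2 * (Lam * Lam))) by (apply Rmult_le_pos; lra).
  assert (HR0 : 1 <= R0) by (unfold R0; lra).
  assert (HJ : forall a b, Rabs (J a b) <= 2 * (Lam * Lam)).
  { intros. apply clamped_J_bound. exact Lam_pos. }
  assert (HkJ : forall a b, Rabs (kap (th a b) * J a b) <= R0).
  { intros a' b'. rewrite Rabs_mult. apply Rle_trans with (Kk * (2 * (Lam * Lam))); [|unfold R0; lra].
    apply Rmult_le_compat; auto using Rabs_pos. }
  assert (HdJ : forall a b, Rabs (dmp (t a b) / 2 * J a b) <= R0).
  { intros a' b'. rewrite Rabs_mult. apply Rle_trans with (Ad * (2 * (Lam * Lam))); [|unfold R0; lra].
    apply Rmult_le_compat; auto using Rabs_pos.
    unfold Rdiv. rewrite Rabs_mult, (Rabs_pos_eq (/ 2)) by lra.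
    generalize (dmp_bound (t a' b')) (Rabs_pos (dmp (t a' b'))). lra. }
  set (m := Rmin ell 1). assert (Hm1 : m <= ell) by apply Rmin_l. assert (Hm2 : m <= 1) by apply Rmin_r.
  assert (Hm : 0 < m) by (apply Rmin_pos; lra).
  (* Moving by [d] changes each of the four unknowns by at most [m], which is no more than the gap
     between [tight] and [loose]. *)
  set (d := m / R0). assert (Hd : 0 < d) by (apply Rdiv_lt_0_compat; lra).
  assert (HdR : R0 * d = m) by (unfold d; field; lra).
  assert (Hstep : forall a b, b <= a -> (forall a' b', a' - b' = Rmax 0 (a - b - d) -> tight a' b') -> loose a b).
  { intros a' b' Hab HT.
    (* [P] and [Y] are compared with [(a', b' + e)] and [Q] and [V] with [(a' - e, b')]: each moves
       in the direction of its own equation, and both reference points lie on the same earlier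
       width, cut off at [0]. *)
    set (e := a' - b' - Rmax 0 (a' - b' - d)).
    assert (He : 0 <= e <= d).
    { unfold e, Rmax. destruct Rle_dec; lra. }
    assert (T1 : tight a' (b' + e)) by (apply HT; unfold e; ring).
    assert (T2 : tight (a' - e) b') by (apply HT; unfold e; ring).
    assert (Hes : R0 * e <= m) by (rewrite <- HdR; apply Rmult_le_compat_l; lra).
    assert (B1 := Rabs_diff_le_of_derive (fun y => P a' y) _ b' (b' + e) R0 ltac:(lra) (fun y _ => P_b a' y)).
    assert (B2 := Rabs_diff_le_of_derive (fun y => Y a' y) _ b' (b' + e) R0 ltac:(lra) (fun y _ => Y_b a' y)).
    assert (B3 := Rabs_diff_le_of_derive (fun y => Q y b') _ (a' - e) a' R0 ltac:(lra) (fun y _ => Q_a y b')).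
    assert (B4 := Rabs_diff_le_of_derive (fun y => V y b') _ (a' - e) a' R0 ltac:(lra) (fun y _ => V_a y b')).
    cbv beta in B1, B2, B3, B4.
    specialize (B1 (fun y _ => ltac:(rewrite Rabs_Ropp; apply HkJ))).
    specialize (B2 (fun y _ => HdJ a' y)).
    specialize (B3 (fun y _ => HkJ y b')).
    specialize (B4 (fun y _ => ltac:(rewrite Rabs_Ropp; apply HdJ))).
    replace (R0 * (b' + e - b')) with (R0 * e) in B1, B2 by ring.
    replace (R0 * (a' - (a' - e))) with (R0 * e) in B3, B4 by ring.
    apply Rabs_le_between in B1. apply Rabs_le_between in B2.
    apply Rabs_le_between in B3. apply Rabs_le_between in B4.
    destruct T1 as (t1 & _ & t3 & _). destruct T2 as (_ & t2 & _ & t4).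
    apply Rabs_le_between in t3. apply Rabs_le_between in t4.
    repeat split; try (apply Rabs_le; split); lra. }
  assert (Hbase : forall a b, a - b = 0 -> tight a b).
  { intros a' b' Hab. replace b' with a' by lra.
    assert (HB := Bm_nonneg).
    assert (HKB : 0 <= 2 * Kk * Bm) by (apply Rmult_le_pos; lra).
    set (X := exp (2 * Kk * Bm * W)) in *.
    assert (HX1 : 1 <= X).
    { rewrite <- exp_0. apply exp_le_compat. apply Rmult_le_pos; lra. }
    assert (HX2 : exp (- (2 * Kk * Bm * W)) <= 1).
    { rewrite <- exp_0. apply exp_le_compat. assert (0 <= 2 * Kk * Bm * W) by (apply Rmult_le_pos; lra). lra. }
    assert (HBX : Bm <= Bm * X).
    { rewrite <- (Rmult_1_r Bm) at 1. apply Rmult_le_compat_l; lra. }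
    unfold tight. destruct (diag a') as (-> & -> & -> & -> & _).
    destruct (N_range (th0 a') (th0_bound a')) as [Hn1 Hn2].
    assert (HI : / 4 <= / (2 * N (th0 a') ^ 2) <= 1).
    { split; [apply Rinv_le_contravar; lra|].
      rewrite <- Rinv_1. apply Rinv_le_contravar; lra. }
    assert (HM : 2 * M1 <= Bm).
    { assert (B0 := Bm_bound 0 ltac:(lra)). assert (0 <= dmp 0 * Gm) by (apply Rmult_le_pos; auto). lra. }
    assert (Hr := dr0_bound a'). assert (Hs := ds0_bound a').
    apply Rabs_le_between in Hr. apply Rabs_le_between in Hs.
    rewrite ell_def, Lam_def.
    repeat split; try (apply Rabs_le; split); lra. }
  assert (Hn : forall n a b, 0 <= a - b <= Rmin W (INR n * d) -> tight a b).
  { induction n as [|n IH].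
    - intros a' b' Hab. simpl in Hab. rewrite Rmult_0_l, Rmin_right in Hab by lra. apply Hbase. lra.
    - set (h := Rmin W (INR (S n) * d)).
      assert (Hh0 : 0 <= h).
      { apply Rmin_glb; [lra|]. apply Rmult_le_pos; [apply pos_INR | lra]. }
      assert (Hh1 : h <= W) by apply Rmin_l.
      assert (Hh2 : h <= INR (S n) * d) by apply Rmin_r.
      apply (tight_of_loose h); [lra|].
      intros a' b' Hab. apply Hstep; [lra|].
      intros a'' b'' H. apply IH. rewrite H.
      rewrite S_INR in Hh2.
      split; [apply Rmax_l|].
      apply Rmax_lub; apply Rmin_glb; try lra.
      apply Rmult_le_pos; [apply pos_INR | lra]. }
  intros Hab.
  destruct (INR_archimed d W Hd) as [n Hn'].
  assert (Ht : tight a b).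
  { apply (Hn n). rewrite Rmin_left; lra. }
  destruct Ht as (t1 & t2 & t3 & t4). repeat split; lra.
Qed.

Lemma strip_solution_intro :
  jcont P -> jcont Q -> jcont Y -> jcont V ->
  strip_solution kap dmp N (fun t => beta t + dmp t * Gm) v0 th0 M W ell Lam P Q Y V th t v x vb xb.
Proof.
  intros HP HQ HY HV.
  assert (HL := strip_loose).
  constructor; auto.
  - intros z. apply diag.
  - intros a b Hab. apply vb_spec; [lra | intros; apply HL; lra].
  - intros a b Hab. apply xb_spec; [lra | intros; apply HL; lra].
  - intros a b Hab. destruct (HL a b Hab) as (H1 & H2 & _). auto.
  - apply (strip_theta W HL).
  - intros a b Hab. apply (strip_time W HL a b Hab).
  - intros a b Hab. assert (H := strip_x_t W HL a b Hab). assert (H' := strip_time W HL a b Hab). lra.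
  - apply (strip_gradient W HL).
Qed.
End Width.

Theorem strip_solution_exists (W : R) : 0 < W ->
  exists ell Lam P Q Y V th t v x vb xb,
    strip_solution kap dmp N (fun t => beta t + dmp t * Gm) v0 th0 M W ell Lam P Q Y V th t v x vb xb.
Proof.
  intros HW.
  set (ell := / 16 * exp (- (2 * Kk * Bm * W))).
  set (Lam := (2 + Bm) * exp (2 * Kk * Bm * W) + 1).
  assert (HB : 0 <= Bm).
  { eapply Rle_trans; [|apply (Bm_bound 0); lra].
    apply Rplus_le_le_0_compat; [apply beta_nonneg; lra | apply Rmult_le_pos; auto]. }
  assert (Hell : 0 < ell) by (apply Rmult_lt_0_compat; [lra | apply exp_pos]).
  assert (HLam : 0 < Lam).
  { assert (0 <= (2 + Bm) * exp (2 * Kk * Bm * W)); [|unfold Lam; lra].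
    apply Rmult_le_pos; [lra | apply Rlt_le, exp_pos]. }
  assert (N_cont : forall z, continuous N z) by (intros; eapply is_derive_continuous, N_derive).
  assert (th0_cont : forall z, continuous th0 z) by (intros; eapply is_derive_continuous, th0_derive).
  assert (HM1 : 0 <= M1) by (eapply Rle_trans; [apply Rabs_pos | apply (dr0_bound 0)]).
  assert (HN0 : forall z, 0 < N (th0 z) ^ 2).
  { intros z. apply pow_lt, N_pos. }
  assert (CN0 : forall z, continuous (fun z => / (2 * N (th0 z) ^ 2)) z).
  { intros z. apply (ex_derive_continuous (fun z => / (2 * N (th0 z) ^ 2))).
    assert (ex_derive N (th0 z)) by (eexists; apply N_derive).
    assert (ex_derive th0 z) by (eexists; apply th0_derive).
    auto_derive. split; [auto|]. split; [auto|]. split; [|auto]. generalize (HN0 z). simpl. lra. }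
  assert (Csum : forall sg z, continuous (fun z => (dv0 z + sg * (dth0 z / 2)) / 2) z).
  { intros sg z.
    apply (continuous_ext (fun z => / 2 * dv0 z + (sg / 4) * dth0 z)).
    - intros y. change (/ 2 * dv0 y + sg / 4 * dth0 y = (dv0 y + sg * (dth0 y / 2)) / 2). field.
    - apply (continuous_plus (V := R_NormedModule)).
      + apply (continuous_scal_r (V := R_NormedModule) (/ 2) dv0), dv0_cont.
      + apply (continuous_scal_r (V := R_NormedModule) (sg / 4) dth0), dth0_cont. }
  destruct (core_system kap dmp Kk Kl Ad Al Lam kap_bound kap_lip dmp_bound dmp_lip HLam
    (fun z => / (2 * N (th0 z) ^ 2)) (fun z => (dv0 z - dth0 z / 2) / 2)
    (fun z => (dv0 z + dth0 z / 2) / 2) th0 (1 + M1))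
    as (P & Q & Y & V & th & t & (HP & HQ & HY & HV) & Pb & Qa & Yb & Va & Hth & Ht & Hdiag).
  { exact CN0. }
  { intros z. apply (continuous_ext (fun z => (dv0 z + -1 * (dth0 z / 2)) / 2)); [|apply Csum].
    intros y. change ((dv0 y + -1 * (dth0 y / 2)) / 2 = (dv0 y - dth0 y / 2) / 2). field. }
  { intros z. apply (continuous_ext (fun z => (dv0 z + 1 * (dth0 z / 2)) / 2)); [|apply Csum].
    intros y. change ((dv0 y + 1 * (dth0 y / 2)) / 2 = (dv0 y + dth0 y / 2) / 2). field. }
  { intros z. replace (2 * _ - 2 * _) with (dth0 z) by field. apply th0_derive. }
  { intros z. destruct (N_range (th0 z) (th0_bound z)) as [Hn _].
    rewrite Rabs_pos_eq by (apply Rlt_le, Rinv_0_lt_compat; lra).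
    apply Rle_trans with (/ 1); [apply Rinv_le_contravar; lra | rewrite Rinv_1; lra]. }
  { intros z. unfold Rdiv at 1. rewrite Rabs_mult, (Rabs_pos_eq (/ 2)) by lra.
    generalize (dr0_bound z) (Rabs_pos (dv0 z - dth0 z / 2)). lra. }
  set (J := fun a b => clamped_J Lam (P a b) (Q a b) (Y a b) (V a b)) in *.
  assert (HJ : jcont J) by (apply jcont_clamped_J; auto).
  assert (Cth := C1_plane_jcont _ _ _ Hth). assert (Ct := C1_plane_jcont _ _ _ Ht).
  assert (Hth' := Hth). assert (Ht' := Ht).
  destruct Hth as (th_a & th_b & _ & _). destruct Ht as (t_a & t_b & _ & _).
  assert (CE : jcont (fun a b => Eh (t a b) ^ 2)).
  { apply (jcont_comp1 (fun s => Eh s ^ 2)); [|exact Ct]. intros s.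
    apply (ex_derive_continuous (fun s => Eh s ^ 2)). apply ex_derive_pow. eexists. apply Eh_derive. }
  assert (CN : jcont (fun a b => N (th a b) ^ 2)).
  { apply (jcont_comp1 (fun s => N s ^ 2)); [|exact Cth]. intros s.
    apply (ex_derive_continuous (fun s => N s ^ 2)). apply ex_derive_pow. eexists. apply N_derive. }
  assert (Cd : jcont (fun a b => dmp (t a b))) by (apply jcont_comp1; [apply dmp_cont | exact Ct]).
  assert (kap_cont : forall z, continuous kap z) by (apply (continuous_lip kap Kl kap_lip)).
  assert (Ck : jcont (fun a b => kap (th a b))) by (apply jcont_comp1; assumption).
  assert (DE : forall (f : R -> R) z l, is_derive f z l ->
     is_derive (fun z => Eh (f z) ^ 2) z (dmp (f z) * l * Eh (f z) ^ 2)).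
  { intros f z l Hf. evar_last.
    - apply (is_derive_pow (fun z => Eh (f z)) 2).
      apply (is_derive_comp (V := R_NormedModule) Eh f); [apply Eh_derive | exact Hf].
    - unfold scal; simpl. unfold mult; simpl. field. }
  assert (DN : forall (f : R -> R) z l, is_derive f z l ->
     is_derive (fun z => N (f z) ^ 2) z (kap (f z) * l * N (f z) ^ 2)).
  { intros f z l Hf. evar_last.
    - apply (is_derive_pow (fun z => N (f z)) 2).
      apply (is_derive_comp (V := R_NormedModule) N f); [apply N_derive | exact Hf].
    - unfold scal; simpl. unfold mult; simpl. field. }
  assert (Dmul : forall (f g : R -> R) z l l', is_derive f z l -> is_derive g z l' ->
     is_derive (fun z => f z * g z) z (l * g z + f z * l')).
  { intros f g z l l' Hf Hg. apply (is_derive_mult f g); auto. intros; apply Rmult_comm. }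
  assert (HJl : forall a b, loose P Q Y V Lam ell a b -> J a b = Q a b * Y a b + P a b * V a b).
  { intros a b (H1 & H2 & H3 & H4). unfold J. apply clamped_J_id; auto; rewrite Rabs_pos_eq; lra. }
  (* The form for [v] contains [v] itself. Multiplied by the integrating factor it becomes the
     explicit form [Eh ^ 2 * (Y da + V db)] for [w = v * Eh ^ 2], and [v] is recovered by
     division. *)
  destruct (primitive_of_form v0 dv0 (fun a b => Eh (t a b) ^ 2 * Y a b)
    (fun a b => dmp (t a b) * (- Q a b) * Eh (t a b) ^ 2 * Y a b + Eh (t a b) ^ 2 * (dmp (t a b) / 2 * J a b))
    (fun a b => Eh (t a b) ^ 2 * V a b)) as (w & wb & Hw & w_diag & _ & w_b).
  { exact v0_derive. }
  { exact dv0_cont. }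
  { now apply jcont_mult. }
  { unfold Rdiv. jc. }
  { intros a b. apply (Dmul (fun y => Eh (t a y) ^ 2) (fun y => Y a y)); [|apply Yb].
    apply (DE (fun y => t a y)), t_b. }
  { intros z. destruct (Hdiag z) as (_ & _ & -> & -> & _ & ->). rewrite Eh_0. field. }
  destruct (primitive_of_form (fun z => z) (fun _ => 1) (fun a b => N (th a b) ^ 2 * P a b)
    (fun a b => kap (th a b) * (2 * V a b) * N (th a b) ^ 2 * P a b + N (th a b) ^ 2 * (- (kap (th a b) * J a b)))
    (fun a b => N (th a b) ^ 2 * Q a b)) as (x & xb & Hx & x_diag & _ & x_b).
  { intros z. apply (is_derive_id (K := R_AbsRing)). }
  { intros z. apply continuous_const. }
  { now apply jcont_mult. }
  { jc. }
  { intros a b. apply (Dmul (fun y => N (th a y) ^ 2) (fun y => P a y)); [|apply Pb].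
    apply (DN (fun y => th a y)), th_b. }
  { intros z. destruct (Hdiag z) as (-> & -> & _ & _ & -> & _). generalize (HN0 z). intros. field.
    generalize (N_pos (th0 z)). lra. }
  assert (HE : forall s, 0 < Eh s ^ 2) by (intros; apply pow_lt, Eh_pos).
  set (v := fun a b => w a b / Eh (t a b) ^ 2).
  assert (Cw := C1_plane_jcont _ _ _ Hw). destruct Hw as (w_a & w_b' & _ & w_d).
  assert (CiE : jcont (fun a b => / Eh (t a b) ^ 2)).
  { intros a b. apply continuity_2d_pt_inv; [apply CE|]. generalize (HE (t a b)). lra. }
  assert (Cv : jcont v) by now apply jcont_mult.
  assert (Hv : C1_plane v (fun a b => Y a b - dmp (t a b) * P a b * v a b)
     (fun a b => wb a b / Eh (t a b) ^ 2 + dmp (t a b) * Q a b * v a b)).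
  { split; [|split; [|split]].
    - intros a b. evar_last.
      + apply (is_derive_div (fun z => w z b) (fun z => Eh (t z b) ^ 2)); [apply w_a | apply (DE (fun z => t z b)), t_a|].
        generalize (HE (t a b)). lra.
      + unfold v. field. generalize (Eh_pos (t a b)). lra.
    - intros a b. evar_last.
      + apply (is_derive_div (fun z => w a z) (fun z => Eh (t a z) ^ 2)); [apply w_b' | apply (DE (fun z => t a z)), t_b|].
        generalize (HE (t a b)). lra.
      + unfold v. field. generalize (Eh_pos (t a b)). lra.
    - jc.
    - unfold Rdiv. jc. }
  exists ell, Lam, P, Q, Y, V, th, t, v, x, (fun a b => wb a b / Eh (t a b) ^ 2 + dmp (t a b) * Q a b * v a b), xb.
  apply strip_solution_intro; auto.
  - intros z. destruct (Hdiag z) as (h1 & h2 & h3 & h4 & h5 & h6).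
    repeat split; auto. unfold v. rewrite h6, w_diag, Eh_0. field.
  - intros a b Hab Hl. rewrite (w_b a b Hab).
    + unfold Rdiv. field. generalize (Eh_pos (t a b)). lra.
    + intros z Hz. assert (E := HJl z b (Hl z Hz)). evar_last.
      * apply (Dmul (fun z => Eh (t z b) ^ 2) (fun z => V z b)); [apply (DE (fun z => t z b)), t_a | apply Va].
      * fold (J z b). rewrite E. field.
  - intros a b Hab Hl. apply (x_b a b Hab).
    intros z Hz. assert (E := HJl z b (Hl z Hz)). evar_last.
    + apply (Dmul (fun z => N (th z b) ^ 2) (fun z => Q z b)); [apply (DN (fun z => th z b)), th_a | apply Qa].
    + fold (J z b). rewrite E. ring.
Qed.
End Strip.

(** * Inversion of the characteristic coordinates *)

Lemma jointly_continuous_on_eps (Om : R -> R -> Prop) (f : R -> R -> R) :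
  jointly_continuous_on Om f <->
  forall t x, Om t x -> forall eps, 0 < eps -> exists d, 0 < d /\
    forall t' x', Om t' x' -> Rabs (t' - t) < d -> Rabs (x' - x) < d ->
      Rabs (f t' x' - f t x) < eps.
Proof.
  split.
  - intros H t x Hom eps Heps.
    destruct (H (t, x) Hom (ball (f t x) (mkposreal eps Heps))) as [d Hd].
    { now exists (mkposreal eps Heps). }
    exists d. split; [apply cond_pos|]. intros t' x' Hom' Ht Hx.
    apply (Hd (t', x')); [split; assumption | exact Hom'].
  - intros H [t x] Hom P [eps HP]. simpl in Hom.
    destruct (H t x Hom eps (cond_pos eps)) as [d [Hd Hd']].
    exists (mkposreal d Hd). intros [t' x'] [Ht Hx] Hom'. apply HP.
    apply Hd'; assumption.
Qed.

Lemma C1_plane_comp (g g' : R -> R) (f fa fb : R -> R -> R) :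
  (forall x, is_derive g x (g' x)) -> (forall x, continuous g' x) -> C1_plane f fa fb ->
  C1_plane (fun a b => g (f a b)) (fun a b => g' (f a b) * fa a b) (fun a b => g' (f a b) * fb a b).
Proof.
  intros Hg Hg' Hf. assert (Cf := C1_plane_jcont _ _ _ Hf).
  destruct Hf as (H1 & H2 & H3 & H4).
  assert (Cg : jcont (fun a b => g' (f a b))) by now apply jcont_comp1.
  split; [|split; [|split]]; try now apply jcont_mult.
  - intros a b. rewrite Rmult_comm.
    apply (is_derive_comp (V := R_NormedModule) g (fun x => f x b)); auto.
  - intros a b. rewrite Rmult_comm.
    apply (is_derive_comp (V := R_NormedModule) g (fun y => f a y)); auto.
Qed.

Lemma C1_plane_lin (f fa fb g ga gb : R -> R -> R) (k : R) :
  C1_plane f fa fb -> C1_plane g ga gb ->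
  C1_plane (fun a b => f a b + k * g a b) (fun a b => fa a b + k * ga a b)
    (fun a b => fb a b + k * gb a b).
Proof.
  intros (F1 & F2 & F3 & F4) (G1 & G2 & G3 & G4).
  split; [|split; [|split]]; try (jc; fail).
  - intros a b. apply (is_derive_plus (V := R_NormedModule) (fun x => f x b)); [apply F1|].
    apply (is_derive_scal (fun x => g x b)), G1.
  - intros a b. apply (is_derive_plus (V := R_NormedModule) (fun y => f a y)); [apply F2|].
    apply (is_derive_scal (fun y => g a y)), G2.
Qed.

(** The Frechet derivative relative to [Om]. It treats interior and boundary times alike and yields
    both relative partial derivatives at once. *)
Definition total_derivative_on (Om : R -> R -> Prop) (F : R -> R -> R) (t x lt lx : R) : Prop :=
  forall eps, 0 < eps -> exists d, 0 < d /\ forall t' x', Om t' x' ->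
    Rabs (t' - t) < d -> Rabs (x' - x) < d ->
    Rabs (F t' x' - F t x - lt * (t' - t) - lx * (x' - x))
    <= eps * (Rabs (t' - t) + Rabs (x' - x)).

Lemma total_derivative_dt Om F t x lt lx :
  total_derivative_on Om F t x lt lx -> is_dt Om F t x lt.
Proof.
  intros H eps Heps. destruct (H (eps / 2) ltac:(lra)) as [d [Hd Hd']].
  exists d. split; [exact Hd|]. intros s [[Hom Hne] Hs]. simpl in Hs |- *. unfold Rdist in *.
  specialize (Hd' s x Hom Hs ltac:(rewrite Rminus_diag, Rabs_R0; exact Hd)).
  rewrite (Rminus_diag x), Rabs_R0, Rplus_0_r, Rmult_0_r, Rminus_0_r in Hd'.
  assert (Hst : s - t <> 0) by lra. assert (Hp := Rabs_pos_lt _ Hst).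
  replace ((F s x - F t x) / (s - t) - lt) with ((F s x - F t x - lt * (s - t)) / (s - t)) by (field; lra).
  unfold Rdiv. rewrite Rabs_mult, Rabs_inv.
  apply Rle_lt_trans with (eps / 2 * Rabs (s - t) * / Rabs (s - t)).
  - apply Rmult_le_compat_r; [apply Rlt_le, Rinv_0_lt_compat, Hp | exact Hd'].
  - rewrite Rmult_assoc, Rinv_r by lra. lra.
Qed.

Lemma total_derivative_dx Om F t x lt lx :
  total_derivative_on Om F t x lt lx -> is_dx Om F t x lx.
Proof.
  intros H eps Heps. destruct (H (eps / 2) ltac:(lra)) as [d [Hd Hd']].
  exists d. split; [exact Hd|]. intros s [[Hom Hne] Hs]. simpl in Hs |- *. unfold Rdist in *.
  specialize (Hd' t s Hom ltac:(rewrite Rminus_diag, Rabs_R0; exact Hd) Hs).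
  rewrite (Rminus_diag t), Rabs_R0, Rplus_0_l, Rmult_0_r, Rminus_0_r in Hd'.
  assert (Hst : s - x <> 0) by lra. assert (Hp := Rabs_pos_lt _ Hst).
  replace ((F t s - F t x) / (s - x) - lx) with ((F t s - F t x - lx * (s - x)) / (s - x)) by (field; lra).
  unfold Rdiv. rewrite Rabs_mult, Rabs_inv.
  apply Rle_lt_trans with (eps / 2 * Rabs (s - x) * / Rabs (s - x)).
  - apply Rmult_le_compat_r; [apply Rlt_le, Rinv_0_lt_compat, Hp | exact Hd'].
  - rewrite Rmult_assoc, Rinv_r by lra. lra.
Qed.

Section Inverse.
Variables (kap dmp N bnd v0 th0 : R -> R) (M T ell Lam : R).
Variables (P Q Y V th t v x vb xb : R -> R -> R).
Hypothesis S : strip_solution kap dmp N bnd v0 th0 M (4 * T) ell Lam P Q Y V th t v x vb xb.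
Hypothesis T_pos : 0 < T.
Hypothesis N_pos : forall z, 0 < N z.
Hypothesis N_cont : forall z, continuous N z.
Hypothesis N_range : forall z, Rabs z <= 2 * M -> / 2 <= N z ^ 2 <= 2.

Let W := 4 * T.

Lemma strip_convex a1 b1 a2 b2 s :
  0 <= a1 - b1 <= W -> 0 <= a2 - b2 <= W -> 0 <= s <= 1 ->
  0 <= (a1 + s * (a2 - a1)) - (b1 + s * (b2 - b1)) <= W.
Proof.
  intros H1 H2 Hs.
  replace ((a1 + s * (a2 - a1)) - (b1 + s * (b2 - b1)))
    with ((1 - s) * (a1 - b1) + s * (a2 - b2)) by ring.
  assert (0 <= (1 - s) * (a1 - b1) <= (1 - s) * W).
  { split; [apply Rmult_le_pos; lra | apply Rmult_le_compat_l; lra]. }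
  assert (0 <= s * (a2 - b2) <= s * W).
  { split; [apply Rmult_le_pos; lra | apply Rmult_le_compat_l; lra]. }
  lra.
Qed.

(* If the increments of the two characteristic coordinates have the same sign, [x]
   separates the points; otherwise [t] does. *)
Lemma inverse_lipschitz a1 b1 a2 b2 :
  0 <= a1 - b1 <= W -> 0 <= a2 - b2 <= W ->
  Rabs (a2 - a1) + Rabs (b2 - b1) <=
  2 / ell * (Rabs (t a2 b2 - t a1 b1) + Rabs (x a2 b2 - x a1 b1)).
Proof.
  intros H1 H2. assert (Hell := ss_ell S).
  apply Rmult_le_reg_l with (ell / 2); [lra|].
  replace (ell / 2 * (2 / ell * (Rabs (t a2 b2 - t a1 b1) + Rabs (x a2 b2 - x a1 b1))))
    with (Rabs (t a2 b2 - t a1 b1) + Rabs (x a2 b2 - x a1 b1)) by (field; lra).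
  destruct (C1_plane_MVT t _ _ a1 b1 a2 b2 (ss_t S)) as [s [Hs Et]].
  destruct (C1_plane_MVT x _ _ a1 b1 a2 b2 (ss_x S)) as [s' [Hs' Ex]].
  assert (C1 := strip_convex a1 b1 a2 b2 s H1 H2 Hs).
  assert (C2 := strip_convex a1 b1 a2 b2 s' H1 H2 Hs').
  set (as1 := a1 + s * (a2 - a1)) in *. set (bs1 := b1 + s * (b2 - b1)) in *.
  set (as2 := a1 + s' * (a2 - a1)) in *. set (bs2 := b1 + s' * (b2 - b1)) in *.
  rewrite (ss_xb S as2 bs2 C2) in Ex.
  destruct (ss_PQ S as1 bs1 C1) as [P1 Q1].
  destruct (ss_PQ S as2 bs2 C2) as [P2 Q2].
  assert (Hn := N_range _ (proj1 (ss_bounds S as2 bs2 C2))).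
  set (n := N (th as2 bs2) ^ 2) in *.
  assert (P3 : ell / 2 <= n * P as2 bs2).
  { replace (ell / 2) with (/ 2 * ell) by field. apply Rmult_le_compat; lra. }
  assert (Q3 : ell / 2 <= n * Q as2 bs2).
  { replace (ell / 2) with (/ 2 * ell) by field. apply Rmult_le_compat; lra. }
  rewrite Et, Ex. clear Et Ex.
  set (p1 := P as1 bs1) in *. set (q1 := Q as1 bs1) in *.
  set (p3 := n * P as2 bs2) in *. set (q3 := n * Q as2 bs2) in *.
  set (da := a2 - a1). set (db := b2 - b1).
  assert (key : forall p q u w, ell / 2 <= p -> ell / 2 <= q -> 0 <= u -> 0 <= w ->
     ell / 2 * (u + w) <= p * u + q * w).
  { intros p q u w Hp Hq Hu Hw. rewrite Rmult_plus_distr_l.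
    apply Rplus_le_compat; apply Rmult_le_compat_r; lra. }
  assert (A1 := Rabs_pos (p1 * da + - q1 * db)). assert (A2 := Rabs_pos (p3 * da + q3 * db)).
  destruct (Rle_dec 0 da) as [Ha|Ha]; destruct (Rle_dec 0 db) as [Hb|Hb].
  - assert (K := key p3 q3 da db P3 Q3 Ha Hb).
    rewrite (Rabs_pos_eq da), (Rabs_pos_eq db) by lra.
    assert (T1 := Rle_abs (p3 * da + q3 * db)). lra.
  - assert (K := key p1 q1 da (- db) ltac:(lra) ltac:(lra) Ha ltac:(lra)).
    rewrite (Rabs_pos_eq da), (Rabs_left db) by lra.
    assert (T1 := Rle_abs (p1 * da + - q1 * db)). lra.
  - assert (K := key p1 q1 (- da) db ltac:(lra) ltac:(lra) ltac:(lra) Hb).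
    rewrite (Rabs_pos_eq db), (Rabs_left da) by lra.
    assert (T1 := Rle_abs (- (p1 * da + - q1 * db))). rewrite Rabs_Ropp in T1. lra.
  - assert (K := key p3 q3 (- da) (- db) P3 Q3 ltac:(lra) ltac:(lra)).
    rewrite (Rabs_left da), (Rabs_left db) by lra.
    assert (T1 := Rle_abs (- (p3 * da + q3 * db))). rewrite Rabs_Ropp in T1. lra.
Qed.

(** For each [b] the intermediate value theorem gives a point [A b] at time [t0]. Along this level
    set [P da = Q db], so [A] is Lipschitz, and a second intermediate value argument along it
    reaches [x0]; [b <= x <= a] brackets [x0] between [b = x0 - W] and [b = x0]. *)
Lemma inverse_exists t0 x0 : 0 <= t0 <= T ->
  exists a b, 0 <= a - b <= W /\ t a b = t0 /\ x a b = x0.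
Proof.
  intros Ht0.
  assert (HSt := ss_t S).
  assert (Hell := ss_ell S).
  assert (Ct := C1_plane_jcont _ _ _ HSt).
  assert (Cx := C1_plane_jcont _ _ _ (ss_x S)).
  assert (Hxt := ss_x_t S).
  assert (HA : forall b, exists a, 0 <= a - b <= W /\ t a b = t0).
  { intros b.
    destruct (IVT_gen (fun a => t a b) b (b + W) t0) as [a [Ha E]].
    - intros a. apply continuity_pt_filterlim. now apply jcont_slice1.
    - destruct (ss_diag S b) as (_ & -> & _).
      (* At the far edge [a - b = 4 * T], while [a - b <= 4 * t]. *)
      assert (HW : T <= t (b + W) b).
      { destruct (Hxt (b + W) b) as (h1 & h2 & _); [unfold W; lra|]. unfold W in *. lra. }
      rewrite Rmin_left, Rmax_right; lra.
    - exists a. rewrite Rmin_left, Rmax_right in Ha by (unfold W; lra). split; [lra | exact E]. }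
  destruct (functional_choice _ HA) as [A HA'].
  assert (A_lip : forall b1 b2, Rabs (A b1 - A b2) <= Lam / ell * Rabs (b1 - b2)).
  { intros b2 b1. destruct (HA' b1) as [H1 E1]. destruct (HA' b2) as [H2 E2].
    destruct (C1_plane_MVT t _ _ (A b1) b1 (A b2) b2 HSt) as [s [Hs Et]].
    assert (C1 := strip_convex _ _ _ _ s H1 H2 Hs).
    destruct (ss_PQ S _ _ C1) as [P1 Q1].
    rewrite E1, E2, Rminus_diag in Et.
    set (p := P _ _) in *. set (q := Q _ _) in *.
    assert (E : p * (A b2 - A b1) = q * (b2 - b1)) by lra.
    assert (E' : p * Rabs (A b2 - A b1) = q * Rabs (b2 - b1)).
    { rewrite <- (Rabs_pos_eq p) at 1 by lra. rewrite <- (Rabs_pos_eq q) at 1 by lra.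
      rewrite <- !Rabs_mult. now f_equal. }
    apply Rmult_le_reg_l with ell; [exact Hell|].
    replace (ell * (Lam / ell * Rabs (b2 - b1))) with (Lam * Rabs (b2 - b1)) by (field; lra).
    apply Rle_trans with (p * Rabs (A b2 - A b1)).
    - apply Rmult_le_compat_r; [apply Rabs_pos | lra].
    - rewrite E'. apply Rmult_le_compat_r; [apply Rabs_pos | lra]. }
  assert (A_cont := continuous_lip A _ A_lip).
  assert (CX : forall b, continuous (fun b => x (A b) b) b).
  { intros b. apply (jcont_slice1 (fun b _ => x (A b) b) 0 b).
    apply (jcont_comp2 x (fun b _ => A b) (fun b _ => b)); [exact Cx | | apply jcont_fst].
    apply (jcont_comp1 A (fun b _ => b)); [exact A_cont | apply jcont_fst]. }
  destruct (IVT_gen (fun b => x (A b) b) (x0 - W) x0 x0) as [b [Hb E]].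
  - intros b. apply continuity_pt_filterlim, CX.
  - destruct (HA' (x0 - W)) as [H1 _]. destruct (HA' x0) as [H2 _].
    destruct (Hxt _ _ H1) as (_ & _ & h1). destruct (Hxt _ _ H2) as (_ & _ & h2).
    rewrite Rmin_left, Rmax_right; lra.
  - destruct (HA' b) as [H1 H2]. exists (A b), b. auto.
Qed.

Section Pullback.
Variables (al be : R -> R -> R).
Hypothesis inv : forall t0 x0, 0 <= t0 <= T ->
  0 <= al t0 x0 - be t0 x0 <= W /\ t (al t0 x0) (be t0 x0) = t0 /\ x (al t0 x0) (be t0 x0) = x0.

Lemma inverse_close t1 x1 t2 x2 : 0 <= t1 <= T -> 0 <= t2 <= T ->
  Rabs (al t2 x2 - al t1 x1) + Rabs (be t2 x2 - be t1 x1) <=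
  2 / ell * (Rabs (t2 - t1) + Rabs (x2 - x1)).
Proof.
  intros H1 H2. destruct (inv t1 x1 H1) as (h1 & e1 & f1). destruct (inv t2 x2 H2) as (h2 & e2 & f2).
  assert (K := inverse_lipschitz _ _ _ _ h1 h2). now rewrite e1, f1, e2, f2 in K.
Qed.

Lemma pullback_continuous (g : R -> R -> R) :
  (forall a b, 0 <= a - b <= W -> continuity_2d_pt g a b) ->
  jointly_continuous_on (strip T) (fun t x => g (al t x) (be t x)).
Proof.
  intros Hg. apply jointly_continuous_on_eps. intros t0 x0 Ht0 eps Heps.
  assert (Hell := ss_ell S).
  destruct (inv t0 x0 Ht0) as (h & _ & _).
  destruct (Hg _ _ h (mkposreal eps Heps)) as [d Hd]. simpl in Hd. assert (dp := cond_pos d).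
  exists (ell * d / 4). split; [apply Rdiv_lt_0_compat; [apply Rmult_lt_0_compat|]; lra|].
  intros t1 x1 Ht1 Hdt Hdx.
  assert (K := inverse_close t0 x0 t1 x1 Ht0 Ht1).
  assert (K' : 2 / ell * (Rabs (t1 - t0) + Rabs (x1 - x0)) < d).
  { apply Rlt_le_trans with (2 / ell * (ell * d / 4 + ell * d / 4)); [|right; field; lra].
    apply Rmult_lt_compat_l; [apply Rdiv_lt_0_compat; lra | lra]. }
  generalize (Rabs_pos (al t1 x1 - al t0 x0)) (Rabs_pos (be t1 x1 - be t0 x0)). intros.
  apply Hd; lra.
Qed.

(** The inverse of the chain rule [f_a = P (f_t + c f_x)], [f_b = Q (- f_t + c f_x)] with
    [c = N ^ 2]; [pull_x] is its other component. *)
Definition pull_t (fa fb : R -> R -> R) (a b : R) : R := (fa a b / P a b - fb a b / Q a b) / 2.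
Definition pull_x (fa fb : R -> R -> R) (a b : R) : R :=
  (fa a b / P a b + fb a b / Q a b) / (2 * N (th a b) ^ 2).

(** Subtracting [lt * t + lx * x] from [f] leaves a function whose gradient vanishes at the base
    point. Its increment is therefore small against that of [(a, b)], and the Lipschitz bound for
    the inverse turns this into smallness against the increment of [(t, x)]. No openness of the
    strip is involved. *)
Lemma pullback_total_derivative (f fa fb : R -> R -> R) t0 x0 :
  C1_plane f fa fb -> 0 <= t0 <= T ->
  total_derivative_on (strip T) (fun t x => f (al t x) (be t x)) t0 x0
    (pull_t fa fb (al t0 x0) (be t0 x0)) (pull_x fa fb (al t0 x0) (be t0 x0)).
Proof.
  intros Hf Ht0 eps Heps.
  assert (Hell := ss_ell S).
  destruct (inv t0 x0 Ht0) as (h & e1 & e2).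
  set (a0 := al t0 x0) in *. set (b0 := be t0 x0) in *.
  set (lt := pull_t fa fb a0 b0). set (lx := pull_x fa fb a0 b0).
  assert (Hg := C1_plane_lin _ _ _ _ _ _ (- lx)
    (C1_plane_lin _ _ _ _ _ _ (- lt) Hf (ss_t S))
    (ss_x S)).
  set (ga := fun a b => fa a b + - lt * P a b + - lx * (N (th a b) ^ 2 * P a b)) in Hg.
  set (gb := fun a b => fb a b + - lt * - Q a b + - lx * xb a b) in Hg.
  destruct (ss_PQ S _ _ h) as [HP HQ].
  assert (Hn := N_pos (th a0 b0)).
  assert (Ga : ga a0 b0 = 0).
  { unfold ga, lt, lx, pull_t, pull_x. field. lra. }
  assert (Gb : gb a0 b0 = 0).
  { unfold gb, lt, lx, pull_t, pull_x. rewrite (ss_xb S _ _ h).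
    field. lra. }
  assert (He : 0 < eps * ell / 2) by (apply Rdiv_lt_0_compat; [apply Rmult_lt_0_compat|]; lra).
  destruct Hg as (Hg1 & Hg2 & Hga & Hgb).
  destruct (Hga a0 b0 (mkposreal _ He)) as [d1 Hd1].
  destruct (Hgb a0 b0 (mkposreal _ He)) as [d2 Hd2]. simpl in Hd1, Hd2.
  assert (Hd : 0 < Rmin d1 d2) by (apply Rmin_pos; apply cond_pos).
  set (d := Rmin d1 d2) in *.
  assert (Hdd1 : d <= d1) by apply Rmin_l. assert (Hdd2 : d <= d2) by apply Rmin_r.
  exists (ell * d / 4). split; [apply Rdiv_lt_0_compat; [apply Rmult_lt_0_compat|]; lra|].
  intros t1 x1 Ht1 Hdt Hdx.
  assert (K := inverse_close t0 x0 t1 x1 Ht0 Ht1). fold a0 b0 in K.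
  assert (K' : 2 / ell * (Rabs (t1 - t0) + Rabs (x1 - x0)) < d).
  { apply Rlt_le_trans with (2 / ell * (ell * d / 4 + ell * d / 4)); [|right; field; lra].
    apply Rmult_lt_compat_l; [apply Rdiv_lt_0_compat; lra | lra]. }
  destruct (inv t1 x1 Ht1) as (h' & e1' & e2').
  set (a1 := al t1 x1) in *. set (b1 := be t1 x1) in *.
  assert (Pa := Rabs_pos (a1 - a0)). assert (Pb := Rabs_pos (b1 - b0)).
  destruct (C1_plane_MVT _ ga gb a0 b0 a1 b1 (conj Hg1 (conj Hg2 (conj Hga Hgb)))) as [s [Hs E]].
  rewrite e1, e2, e1', e2' in E.
  replace (f a1 b1 - f a0 b0 - lt * (t1 - t0) - lx * (x1 - x0))
    with (f a1 b1 + - lt * t1 + - lx * x1 - (f a0 b0 + - lt * t0 + - lx * x0)) by ring.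
  rewrite E.
  assert (Hsm : forall z, Rabs (s * z) <= Rabs z).
  { intros z. rewrite Rabs_mult, (Rabs_pos_eq s) by lra. rewrite <- (Rmult_1_l (Rabs z)) at 2.
    apply Rmult_le_compat_r; [apply Rabs_pos | lra]. }
  assert (S1 := Hsm (a1 - a0)). assert (S2 := Hsm (b1 - b0)).
  assert (D1 : Rabs (ga (a0 + s * (a1 - a0)) (b0 + s * (b1 - b0))) <= eps * ell / 2).
  { rewrite <- (Rminus_0_r (ga _ _)), <- Ga. apply Rlt_le, Hd1.
    - replace (a0 + s * (a1 - a0) - a0) with (s * (a1 - a0)) by ring. lra.
    - replace (b0 + s * (b1 - b0) - b0) with (s * (b1 - b0)) by ring. lra. }
  assert (D2 : Rabs (gb (a0 + s * (a1 - a0)) (b0 + s * (b1 - b0))) <= eps * ell / 2).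
  { rewrite <- (Rminus_0_r (gb _ _)), <- Gb. apply Rlt_le, Hd2.
    - replace (a0 + s * (a1 - a0) - a0) with (s * (a1 - a0)) by ring. lra.
    - replace (b0 + s * (b1 - b0) - b0) with (s * (b1 - b0)) by ring. lra. }
  eapply Rle_trans; [apply Rabs_triang|]. rewrite !Rabs_mult.
  apply Rle_trans with (eps * ell / 2 * (Rabs (a1 - a0) + Rabs (b1 - b0))).
  - rewrite Rmult_plus_distr_l. apply Rplus_le_compat; apply Rmult_le_compat_r; assumption.
  - apply Rle_trans with (eps * ell / 2 * (2 / ell * (Rabs (t1 - t0) + Rabs (x1 - x0)))).
    + apply Rmult_le_compat_l; lra.
    + right. field. lra.
Qed.

Lemma pull_continuous (fa fb : R -> R -> R) : jcont fa -> jcont fb ->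
  (forall a b, 0 <= a - b <= W -> continuity_2d_pt (pull_t fa fb) a b) /\
  (forall a b, 0 <= a - b <= W -> continuity_2d_pt (pull_x fa fb) a b).
Proof.
  intros Hfa Hfb.
  destruct (ss_cont S) as (CP & CQ & _ & _).
  assert (Hell := ss_ell S).
  assert (Cth := C1_plane_jcont _ _ _ (ss_th S)).
  assert (CN : jcont (fun a b => 2 * N (th a b) ^ 2)).
  { assert (CN1 : jcont (fun a b => N (th a b))) by now apply jcont_comp1.
    apply jcont_ext with (fun a b => 2 * (N (th a b) * N (th a b))); [intros; simpl; ring|]. jc. }
  assert (H1 : forall a b, 0 <= a - b <= W -> continuity_2d_pt (fun a b => fa a b / P a b) a b /\
             continuity_2d_pt (fun a b => fb a b / Q a b) a b).
  { intros a b Hab. destruct (ss_PQ S _ _ Hab) as [HP HQ].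
    split; apply continuity_2d_pt_mult; auto; apply continuity_2d_pt_inv; auto; lra. }
  split; intros a b Hab; destruct (H1 a b Hab) as [h1 h2].
  - unfold pull_t. apply (continuity_2d_pt_mult (fun a b => fa a b / P a b - fb a b / Q a b) (fun _ _ => / 2)).
    + now apply continuity_2d_pt_minus.
    + apply continuity_2d_pt_const.
  - unfold pull_x. apply (continuity_2d_pt_mult (fun a b => fa a b / P a b + fb a b / Q a b)).
    + now apply continuity_2d_pt_plus.
    + apply continuity_2d_pt_inv; [apply CN|]. generalize (pow_lt _ 2 (N_pos (th a b))). lra.
Qed.

Lemma pullback_C1b (f fa fb : R -> R -> R) (Mf : R) :
  C1_plane f fa fb ->
  (forall a b, 0 <= a - b <= W -> Rabs (f a b) <= Mf /\ Rabs (fa a b) <= Mf /\ Rabs (fb a b) <= Mf) ->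
  C1b (strip T) (fun t x => f (al t x) (be t x)).
Proof.
  intros Hf HM.
  assert (Hell := ss_ell S).
  assert (Cf := C1_plane_jcont _ _ _ Hf).
  destruct (pull_continuous fa fb) as [Ct Cx]; [apply Hf | apply Hf |].
  assert (HB : forall a b, 0 <= a - b <= W ->
    Rabs (fa a b / P a b) <= Mf / ell /\ Rabs (fb a b / Q a b) <= Mf / ell /\ / 2 <= N (th a b) ^ 2).
  { intros a b Hab. destruct (HM a b Hab) as (_ & H1 & H2).
    destruct (ss_PQ S _ _ Hab) as [HP HQ].
    assert (HM0 : 0 <= Mf) by (eapply Rle_trans; [apply Rabs_pos | exact H1]).
    assert (K : forall g p, Rabs g <= Mf -> ell <= p <= Lam -> Rabs (g / p) <= Mf / ell).
    { intros g p Hg Hp. unfold Rdiv. rewrite Rabs_mult, (Rabs_pos_eq (/ p)).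
      - apply Rmult_le_compat; [apply Rabs_pos | apply Rlt_le, Rinv_0_lt_compat; lra | exact Hg |].
        apply Rinv_le_contravar; lra.
      - apply Rlt_le, Rinv_0_lt_compat; lra. }
    split; [now apply K|]. split; [now apply K|].
    apply N_range. apply (ss_bounds S _ _ Hab). }
  split; [|split].
  - apply pullback_continuous. auto.
  - exists Mf. intros t0 x0 Ht0. apply HM. apply (inv t0 x0 Ht0).
  - exists (fun t x => pull_t fa fb (al t x) (be t x)), (fun t x => pull_x fa fb (al t x) (be t x)).
    split; [|split; [|split; [|split]]].
    + intros t0 x0 Ht0. assert (K := pullback_total_derivative f fa fb t0 x0 Hf Ht0).
      split; [eapply total_derivative_dt | eapply total_derivative_dx]; exact K.
    + now apply pullback_continuous.
    + exists (Mf / ell). intros t0 x0 Ht0. destruct (inv t0 x0 Ht0) as (h & _).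
      destruct (HB _ _ h) as (H1 & H2 & _). unfold pull_t.
      apply Rabs_le_between in H1. apply Rabs_le_between in H2. apply Rabs_le. lra.
    + now apply pullback_continuous.
    + exists (2 * (Mf / ell)). intros t0 x0 Ht0. destruct (inv t0 x0 Ht0) as (h & _).
      destruct (HB _ _ h) as (H1 & H2 & H3). unfold pull_x.
      unfold Rdiv at 1. rewrite Rabs_mult.
      assert (H4 : Rabs (/ (2 * N (th (al t0 x0) (be t0 x0)) ^ 2)) <= 1).
      { rewrite Rabs_pos_eq by (apply Rlt_le, Rinv_0_lt_compat; lra).
        rewrite <- Rinv_1. apply Rinv_le_contravar; lra. }
      rewrite <- (Rmult_1_r (2 * (Mf / ell))).
      apply Rmult_le_compat; auto using Rabs_pos.
      eapply Rle_trans; [apply Rabs_triang|]. lra.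
Qed.
End Pullback.
End Inverse.

Lemma total_derivative_ext (Om : R -> R -> Prop) (F G : R -> R -> R) (t x lt lx : R) :
  (forall t x, Om t x -> F t x = G t x) -> Om t x ->
  total_derivative_on Om F t x lt lx -> total_derivative_on Om G t x lt lx.
Proof.
  intros HFG Ho HF eps He. destruct (HF eps He) as [d [Hd Hd']].
  exists d. split; [exact Hd|]. intros t' x' Ho' Ht Hx. rewrite <- !HFG by assumption. auto.
Qed.

(** * Return to the original variables *)

Section StripToSolution.
Variables (gamma mu lambda : R) (kap dmp N bnd v0 th0 U U' p' : R -> R) (M T ell Lam Bm c0 c1 : R).
Variables (P Q Y V th t v x vb xb : R -> R -> R).
Hypothesis S : strip_solution kap dmp N bnd v0 th0 M (4 * T) ell Lam P Q Y V th t v x vb xb.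
Hypothesis T_pos : 0 < T.
Hypothesis M_nonneg : 0 <= M.
Hypothesis N_pos : forall z, 0 < N z.
Hypothesis N_cont : forall z, continuous N z.
Hypothesis N_range : forall z, Rabs z <= 2 * M -> / 2 <= N z ^ 2 <= 2.
Hypothesis bnd_range : forall s, 0 <= s -> 0 <= bnd s <= Bm.
Hypothesis dmp_eq : forall s, 0 <= s -> dmp s = lambda / Rpower (1 + s) mu.
Hypothesis dmp_nonneg : forall s, 0 <= dmp s.
Hypothesis dmp_bound : forall s, dmp s <= lambda.
Hypothesis U_derive : forall z, is_derive U z (U' z).
Hypothesis U'_cont : forall z, continuous U' z.
Hypothesis U'_eq : forall z, Rabs z <= 2 * M -> U' z = - / (2 * N z ^ 2).
Hypothesis p_derive : forall z, is_derive (fun z => pressure gamma (U z)) z (p' z).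
Hypothesis p'_cont : forall z, continuous p' z.
Hypothesis p'_eq : forall z, Rabs z <= 2 * M -> p' z = N z ^ 2 / 2.
Hypothesis U_range : forall z, Rabs z <= 2 * M -> c0 <= U z <= c1.
Hypothesis c0_pos : 0 < c0.
Hypothesis eta_U : forall z, Rabs z <= 2 * M -> eta gamma (U z) = 2 / (gamma - 1) + z / 2.

Theorem strip_to_solution :
  exists u w rt rx st sx : R -> R -> R,
    is_solution gamma mu lambda (fun z => U (th0 z)) v0 T u w /\
    forall s y, strip T s y ->
      is_dt (strip T) (riemann_r gamma u w) s y (rt s y) /\
      is_dx (strip T) (riemann_r gamma u w) s y (rx s y) /\
      is_dt (strip T) (riemann_s gamma u w) s y (st s y) /\
      is_dx (strip T) (riemann_s gamma u w) s y (sx s y) /\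
      Rabs (rt s y) <= 2 * bnd s + dmp s * M /\ Rabs (rx s y) <= 2 * bnd s + dmp s * M /\
      Rabs (st s y) <= 2 * bnd s + dmp s * M /\ Rabs (sx s y) <= 2 * bnd s + dmp s * M.
Proof.
  (* Choice needs a value for every pair; outside [[0, T]] the point [(0, 0)] is a placeholder. *)
  assert (HI : forall q : R * R, exists ab : R * R, 0 <= fst q <= T ->
    0 <= fst ab - snd ab <= 4 * T /\ t (fst ab) (snd ab) = fst q /\ x (fst ab) (snd ab) = snd q).
  { intros [t0 x0]. simpl. destruct (Rle_dec 0 t0) as [h|h]; [destruct (Rle_dec t0 T) as [h'|h']|].
    - destruct (inverse_exists _ _ _ _ _ _ _ _ _ _ _ _ _ _ _ _ _ _ _ _ S T_pos t0 x0 (conj h h'))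
        as (a & b & H). now exists (a, b).
    - exists (0, 0). lra.
    - exists (0, 0). lra. }
  destruct (functional_choice _ HI) as [Phi HPhi].
  set (al := fun s y => fst (Phi (s, y))). set (be := fun s y => snd (Phi (s, y))).
  assert (inv : forall t0 x0, 0 <= t0 <= T ->
    0 <= al t0 x0 - be t0 x0 <= 4 * T /\ t (al t0 x0) (be t0 x0) = t0 /\ x (al t0 x0) (be t0 x0) = x0).
  { intros t0 x0 H. apply (HPhi (t0, x0) H). }
  clear HI HPhi. clearbody al be. clear Phi.
  assert (TD := fun f fa fb t0 x0 => pullback_total_derivative _ _ _ _ _ _ _ _ _ _ _ _ _ _ _ _ _ _ _ _ S
    N_pos N_range al be inv f fa fb t0 x0).
  assert (TC := fun f fa fb Mf => pullback_C1b _ _ _ _ _ _ _ _ _ _ _ _ _ _ _ _ _ _ _ _ S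
    N_pos N_cont N_range al be inv f fa fb Mf).
  assert (Hell := ss_ell S).
  assert (Hth := ss_th S). assert (Hv := ss_v S).
  assert (HU := C1_plane_comp U U' th _ _ U_derive U'_cont Hth).
  assert (Hp := C1_plane_comp _ p' th _ _ p_derive p'_cont Hth).
  assert (Hr := C1_plane_lin _ _ _ _ _ _ (- / 2) Hv Hth).
  assert (Hs := C1_plane_lin _ _ _ _ _ _ (/ 2) Hv Hth).
  assert (HB : 0 <= Bm) by (generalize (bnd_range 0); lra).
  assert (HL : 0 <= lambda) by (generalize (dmp_nonneg 0) (dmp_bound 0); lra).
  assert (Hn2 : forall z, Rabs z <= 2 * M -> / 2 <= N z <= 2) by (intros z Hz; now apply range_of_sqr, N_range).
  assert (HYV : forall a b, 0 <= a - b <= 4 * T ->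
     Rabs (Y a b) <= Bm * (2 * Lam) /\ Rabs (V a b) <= Bm * (2 * Lam) /\ 0 <= Lam).
  { intros a b Hab. destruct (ss_grad S a b Hab) as [g1 g2]. destruct (ss_PQ S a b Hab) as [hP hQ].
    destruct (ss_bounds S a b Hab) as [hth _].
    assert (Hbn := bnd_range _ (ss_t_pos S a b Hab)). assert (Hn := Hn2 _ hth). assert (Hn' := N_pos (th a b)).
    assert (K : forall y p, 0 < p <= Lam -> Rabs y <= bnd (t a b) * (N (th a b) * p) -> Rabs y <= Bm * (2 * Lam)).
    { intros y p Hp' Hy. eapply Rle_trans; [exact Hy|].
      apply Rmult_le_compat; try lra; [apply Rmult_le_pos; lra | apply Rmult_le_compat; lra]. }
    split; [|split]; [apply (K _ (P a b)) | apply (K _ (Q a b)) |]; auto; lra. }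
  set (u := fun s y => U (th (al s y) (be s y))).
  set (w := fun s y => v (al s y) (be s y)).
  (* [fr] is [c r_x] and [fs] is [c s_x]; the transport equations then read [r_t = fr - dmp * v] and
     [s_t = - fs - dmp * v]. *)
  set (fr := fun s y => Y (al s y) (be s y) / P (al s y) (be s y)).
  set (fs := fun s y => V (al s y) (be s y) / Q (al s y) (be s y)).
  set (n2 := fun s y => N (th (al s y) (be s y)) ^ 2).
  exists u, w, (fun s y => fr s y - dmp s * w s y), (fun s y => fr s y / n2 s y),
    (fun s y => - fs s y - dmp s * w s y), (fun s y => fs s y / n2 s y).
  assert (Hfacts : forall s y, strip T s y -> 
     let a := al s y in let b := be s y in
     ell <= P a b /\ ell <= Q a b /\ Rabs (th a b) <= 2 * M /\ Rabs (v a b) <= M /\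
     vb a b = V a b + dmp s * Q a b * v a b /\ t a b = s /\ 0 < N (th a b)).
  { intros s y Hsy. cbv zeta. destruct (inv s y Hsy) as (h & h1 & h2).
    destruct (ss_PQ S _ _ h) as [hP hQ]. destruct (ss_bounds S _ _ h) as [hth hv].
    rewrite (ss_vb S _ _ h), h1. repeat split; auto; lra. }
  assert (DV : forall s y, strip T s y -> total_derivative_on (strip T) w s y
     ((fr s y - fs s y) / 2 - dmp s * w s y) ((fr s y + fs s y) / (2 * n2 s y))).
  { intros s y Hsy. destruct (Hfacts s y Hsy) as (hP & hQ & hth & hv & hvb & hts & hN).
    assert (K := TD _ _ _ s y Hv Hsy). unfold pull_t, pull_x in K. rewrite hvb, hts in K.
    replace ((fr s y - fs s y) / 2 - dmp s * w s y) with
      (((Y (al s y) (be s y) - dmp s * P (al s y) (be s y) * v (al s y) (be s y)) / P (al s y) (be s y) -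
        (V (al s y) (be s y) + dmp s * Q (al s y) (be s y) * v (al s y) (be s y)) / Q (al s y) (be s y)) / 2)
      by (unfold fr, fs, w; field; lra).
    replace ((fr s y + fs s y) / (2 * n2 s y)) with
      (((Y (al s y) (be s y) - dmp s * P (al s y) (be s y) * v (al s y) (be s y)) / P (al s y) (be s y) +
       (V (al s y) (be s y) + dmp s * Q (al s y) (be s y) * v (al s y) (be s y)) / Q (al s y) (be s y)) /
      (2 * N (th (al s y) (be s y)) ^ 2))
      by (unfold fr, fs, w, n2; field; lra).
    exact K. }
  assert (Dr : forall s y, strip T s y -> total_derivative_on (strip T) (riemann_r gamma u w) s y
     (fr s y - dmp s * w s y) (fr s y / n2 s y)).
  { intros s y Hsy. destruct (Hfacts s y Hsy) as (hP & hQ & hth & hv & hvb & hts & hN).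
    apply total_derivative_ext with (fun s y => v (al s y) (be s y) + - / 2 * th (al s y) (be s y)); [|exact Hsy|].
    - intros s' y' Hsy'. destruct (Hfacts s' y' Hsy') as (_ & _ & hth' & _).
      unfold riemann_r, u, w. rewrite eta_U by exact hth'. lra.
    - assert (K := TD _ _ _ s y Hr Hsy). unfold pull_t, pull_x in K. rewrite hvb, hts in K.
      set (a := al s y) in *. set (b := be s y) in *.
      replace (fr s y - dmp s * w s y) with
       (((Y a b - dmp s * P a b * v a b + - / 2 * (-2 * Y a b)) / P a b -
        (V a b + dmp s * Q a b * v a b + - / 2 * (2 * V a b)) / Q a b) / 2)
        by (unfold fr, w; fold a b; field; lra).
      replace (fr s y / n2 s y) with
       (((Y a b - dmp s * P a b * v a b + - / 2 * (-2 * Y a b)) / P a b +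
       (V a b + dmp s * Q a b * v a b + - / 2 * (2 * V a b)) / Q a b) / (2 * N (th a b) ^ 2))
        by (unfold fr, n2; fold a b; field; lra).
      exact K. }
  assert (Ds : forall s y, strip T s y -> total_derivative_on (strip T) (riemann_s gamma u w) s y
     (- fs s y - dmp s * w s y) (fs s y / n2 s y)).
  { intros s y Hsy. destruct (Hfacts s y Hsy) as (hP & hQ & hth & hv & hvb & hts & hN).
    apply total_derivative_ext with (fun s y => v (al s y) (be s y) + / 2 * th (al s y) (be s y)); [|exact Hsy|].
    - intros s' y' Hsy'. destruct (Hfacts s' y' Hsy') as (_ & _ & hth' & _).
      unfold riemann_s, u, w. rewrite eta_U by exact hth'. lra.
    - assert (K := TD _ _ _ s y Hs Hsy). unfold pull_t, pull_x in K. rewrite hvb, hts in K.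
      set (a := al s y) in *. set (b := be s y) in *.
      replace (- fs s y - dmp s * w s y) with
       (((Y a b - dmp s * P a b * v a b + / 2 * (-2 * Y a b)) / P a b -
        (V a b + dmp s * Q a b * v a b + / 2 * (2 * V a b)) / Q a b) / 2)
        by (unfold fs, w; fold a b; field; lra).
      replace (fs s y / n2 s y) with
       (((Y a b - dmp s * P a b * v a b + / 2 * (-2 * Y a b)) / P a b +
       (V a b + dmp s * Q a b * v a b + / 2 * (2 * V a b)) / Q a b) / (2 * N (th a b) ^ 2))
        by (unfold fs, n2; fold a b; field; lra).
      exact K. }
  split.
  - split; [|split; [|split; [|split]]].
    + apply (TC _ _ _ (c1 + (/ 2 + / 2) * (2 * (Bm * (2 * Lam)) * 2)) HU).
      intros a b Hab. destruct (ss_bounds S a b Hab) as [hth _].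
      destruct (HYV a b Hab) as (hY & hV & hLam). assert (hU := U_range _ hth). assert (hn := N_range _ hth).
      assert (hU' : Rabs (U' (th a b)) <= 1).
      { rewrite U'_eq by exact hth. rewrite Rabs_Ropp, Rabs_pos_eq by (apply Rlt_le, Rinv_0_lt_compat; lra).
        rewrite <- Rinv_1. apply Rinv_le_contravar; lra. }
      assert (K : forall z, Rabs z <= Bm * (2 * Lam) -> Rabs (U' (th a b) * (2 * z)) <= 2 * (Bm * (2 * Lam))).
      { intros z Hz. rewrite Rabs_mult. rewrite <- (Rmult_1_l (2 * (Bm * (2 * Lam)))).
        apply Rmult_le_compat; auto using Rabs_pos. rewrite Rabs_mult, (Rabs_pos_eq 2) by lra. lra. }
      assert (hBL : 0 <= Bm * (2 * Lam)) by (apply Rmult_le_pos; lra).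
      split; [rewrite Rabs_pos_eq by lra; lra|].
      assert (K1 := K _ hY). assert (K2 := K _ hV).
      replace (U' (th a b) * (-2 * Y a b)) with (- (U' (th a b) * (2 * Y a b))) by ring.
      rewrite Rabs_Ropp. lra.
    + apply (TC _ _ _ (M + Bm * (2 * Lam) + lambda * Lam * M) Hv).
      intros a b Hab. destruct (ss_bounds S a b Hab) as [hth hv].
      destruct (HYV a b Hab) as (hY & hV & hLam). destruct (ss_PQ S a b Hab) as [hP hQ].
      assert (hBL : 0 <= Bm * (2 * Lam)) by (apply Rmult_le_pos; lra).
      assert (hLM : 0 <= lambda * Lam * M) by (apply Rmult_le_pos; [apply Rmult_le_pos|]; lra).
      assert (K : forall p, 0 < p <= Lam -> Rabs (dmp (t a b) * p * v a b) <= lambda * Lam * M).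
      { intros p Hp'. rewrite Rabs_mult. assert (hd := dmp_nonneg (t a b)). assert (hd' := dmp_bound (t a b)).
        rewrite (Rabs_pos_eq (dmp (t a b) * p)) by (apply Rmult_le_pos; lra).
        apply Rmult_le_compat; auto using Rabs_pos; [apply Rmult_le_pos; lra | apply Rmult_le_compat; lra]. }
      assert (K1 := K (P a b) ltac:(lra)). assert (K2 := K (Q a b) ltac:(lra)).
      rewrite (ss_vb S a b Hab).
      split; [lra|]. split.
      * eapply Rle_trans; [apply Rabs_triang|]. rewrite Rabs_Ropp. lra.
      * eapply Rle_trans; [apply Rabs_triang|]. lra.
    + exists c0. split; [exact c0_pos|]. intros s y Hsy.
      destruct (Hfacts s y Hsy) as (_ & _ & hth & _). apply (U_range _ hth).
    + intros s y Hsy. destruct (Hfacts s y Hsy) as (hP & hQ & hth & hv & hvb & hts & hN).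
      exists ((fr s y + fs s y) / (2 * n2 s y)), ((fr s y - fs s y) / 2 - dmp s * w s y),
        ((fr s y + fs s y) / (2 * n2 s y)), (- (fr s y - fs s y) / 2).
      set (a := al s y) in *. set (b := be s y) in *.
      assert (Hnn : 0 < n2 s y) by (apply pow_lt; assumption).
      split; [|split; [|split; [|split; [|split]]]].
      * eapply total_derivative_dt. assert (K := TD _ _ _ s y HU Hsy). unfold pull_t in K.
        fold a b in K. rewrite U'_eq in K by exact hth.
        replace ((fr s y + fs s y) / (2 * n2 s y)) with
         ((- / (2 * N (th a b) ^ 2) * (-2 * Y a b) / P a b - - / (2 * N (th a b) ^ 2) * (2 * V a b) / Q a b) / 2)
         by (unfold fr, fs, n2; fold a b; field; lra).
        exact K.
      * eapply total_derivative_dt. apply DV, Hsy.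
      * eapply total_derivative_dx. apply DV, Hsy.
      * eapply total_derivative_dx. assert (K := TD _ _ _ s y Hp Hsy). unfold pull_x in K.
        fold a b in K. rewrite p'_eq in K by exact hth.
        replace (- (fr s y - fs s y) / 2) with
         ((N (th a b) ^ 2 / 2 * (-2 * Y a b) / P a b + N (th a b) ^ 2 / 2 * (2 * V a b) / Q a b) / (2 * N (th a b) ^ 2))
         by (unfold fr, fs; fold a b; field; lra).
        exact K.
      * field. lra.
      * rewrite dmp_eq by apply Hsy. field. apply Rgt_not_eq, exp_pos.
    (* At [t = 0] the inequalities between [x] and [t] collapse and force both characteristic
       coordinates to equal [y]. *)
    + intros y. destruct (inv 0 y ltac:(lra)) as (h & h1 & h2).
      destruct (ss_x_t S _ _ h) as (x1 & x2 & x3). rewrite h1, h2 in *.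
      unfold u, w. replace (al 0 y) with y by lra. replace (be 0 y) with y by lra.
      destruct (ss_diag S y) as (-> & _ & -> & _). auto.
  - intros s y Hsy. destruct (Hfacts s y Hsy) as (hP & hQ & hth & hv & hvb & hts & hN).
    destruct (inv s y Hsy) as (h & h1 & h2).
    destruct (ss_grad S _ _ h) as [g1 g2]. rewrite h1 in g1, g2.
    destruct (ss_PQ S _ _ h) as [hP' hQ'].
    assert (Hnn := Hn2 _ hth). assert (Hb := bnd_range s (proj1 Hsy)).
    assert (Hd := dmp_nonneg s).
    assert (K : forall z p, ell <= p -> Rabs z <= bnd s * (N (th (al s y) (be s y)) * p) ->
       Rabs (z / p) <= 2 * bnd s /\ Rabs (z / p / n2 s y) <= 2 * bnd s).
    { intros z p Hp' Hz. set (n := N (th (al s y) (be s y))) in *.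
      assert (K1 : Rabs (z / p) <= bnd s * n).
      { unfold Rdiv. rewrite Rabs_mult, (Rabs_pos_eq (/ p)) by (apply Rlt_le, Rinv_0_lt_compat; lra).
        apply Rmult_le_reg_r with p; [lra|]. rewrite Rmult_assoc, Rinv_l, Rmult_1_r by lra. lra. }
      split.
      - eapply Rle_trans; [exact K1|]. rewrite Rmult_comm. apply Rmult_le_compat_r; lra.
      - unfold Rdiv at 1. assert (Hn2p : 0 < n2 s y) by (apply pow_lt; exact hN).
        rewrite Rabs_mult, (Rabs_pos_eq (/ n2 s y)) by (apply Rlt_le, Rinv_0_lt_compat, Hn2p).
        apply Rle_trans with (bnd s * n * / n2 s y).
        + apply Rmult_le_compat_r; [apply Rlt_le, Rinv_0_lt_compat, Hn2p | exact K1].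
        + replace (bnd s * n * / n2 s y) with (bnd s * / n) by (unfold n2; fold n; field; lra).
          rewrite (Rmult_comm 2). apply Rmult_le_compat_l; [lra|].
          rewrite <- (Rinv_inv 2). apply Rinv_le_contravar; lra. }
    destruct (K _ _ hP g1) as [r1 r2]. destruct (K _ _ hQ g2) as [s1 s2].
    fold (fr s y) in r1, r2. fold (fs s y) in s1, s2.
    assert (Hdw : Rabs (dmp s * w s y) <= dmp s * M).
    { rewrite Rabs_mult, (Rabs_pos_eq (dmp s)) by exact Hd. apply Rmult_le_compat_l; [exact Hd | exact hv]. }
    assert (0 <= dmp s * M) by (apply Rmult_le_pos; lra).
    split; [eapply total_derivative_dt, Dr, Hsy|].
    split; [eapply total_derivative_dx, Dr, Hsy|].
    split; [eapply total_derivative_dt, Ds, Hsy|].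
    split; [eapply total_derivative_dx, Ds, Hsy|].
    split; [|split; [|split]].
    + eapply Rle_trans; [apply Rabs_triang|]. rewrite Rabs_Ropp. lra.
    + lra.
    + eapply Rle_trans; [apply Rabs_triang|]. rewrite !Rabs_Ropp. lra.
    + lra.
Qed.
End StripToSolution.

(** * Uniqueness *)

Lemma D_in_is_derive (f : R -> R) (D : R -> Prop) (x l d : R) :
  0 < d -> (forall y, Rabs (y - x) < d -> D y) -> D_in f (fun _ => l) D x -> is_derive f x l.
Proof.
  intros Hd HD H. apply is_derive_Reals. intros eps Heps.
  destruct (H eps Heps) as [e [He H']].
  assert (Hm : 0 < Rmin d e) by (apply Rmin_pos; lra).
  exists (mkposreal _ Hm). simpl. intros h Hh Hhm.
  assert (m1 := Rmin_l d e). assert (m2 := Rmin_r d e).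
  specialize (H' (x + h)). simpl in H'. unfold Rdist in H'.
  replace (x + h - x) with h in H' by ring. apply H'. split; [|lra].
  split; [|lra]. apply HD. replace (x + h - x) with h by ring. lra.
Qed.

Lemma is_dt_is_derive (T : R) (f : R -> R -> R) (t x l : R) :
  0 < t < T -> is_dt (strip T) f t x l -> is_derive (fun s => f s x) t l.
Proof.
  intros Ht H. apply (D_in_is_derive _ _ _ _ (Rmin t (T - t))) in H; [exact H | apply Rmin_pos; lra |].
  intros y Hy. assert (m1 := Rmin_l t (T - t)). assert (m2 := Rmin_r t (T - t)).
  apply Rabs_def2 in Hy. unfold strip. lra.
Qed.

Lemma is_dx_is_derive (T : R) (f : R -> R -> R) (t x l : R) :
  0 <= t <= T -> is_dx (strip T) f t x l -> is_derive (fun y => f t y) x l.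
Proof.
  intros Ht H. apply (D_in_is_derive _ _ _ _ 1) in H; [exact H | lra |].
  intros y _. exact Ht.
Qed.

(** The Picard scheme on the plane with every unknown running in the first direction: the second
    coordinate is the starting time, and the solution is the slice at [t0]. *)
Lemma ode_exists (b : R -> R -> R) (L C : R) :
  0 < L -> jcont b -> (forall t x y, Rabs (b t x - b t y) <= L * Rabs (x - y)) ->
  (forall t x, Rabs (b t x) <= C) ->
  forall t0 x0, exists X : R -> R, X t0 = x0 /\ forall t, is_derive X t (b t (X t)).
Proof.
  intros HL Hb Hlip HC t0 x0.
  destruct (picard_differential (fun _ => true) (fun _ _ => x0) (fun _ a _ z => b a (z 0%nat)) L C)
    as (U & HU & Hdiag & _ & Hd & _); auto.
  - intros i x. apply continuous_const.
  - intros U HU i. apply (jcont_comp2 b (fun a _ => a) (U 0%nat)); auto using jcont_fst.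
  - intros i a b' z z' D HD. eapply Rle_trans; [apply Hlip|]. apply Rmult_le_compat_l; [lra | apply HD].
  - exists (fun t => U 0%nat t t0). split; [apply Hdiag|].
    intros t. apply (Hd 0%nat eq_refl t t0).
Qed.

Lemma is_derive_Rpower (p u : R) :
  0 < u -> is_derive (fun u => Rpower u p) u (p * Rpower u (p - 1)).
Proof. intros Hu. apply is_derive_Reals. now apply derivable_pt_lim_power. Qed.

Lemma Rpower_bounds (lo hi p u : R) : 0 < lo -> lo <= u <= hi ->
  exp (- (Rabs p * (Rabs (ln lo) + Rabs (ln hi)))) <= Rpower u p
  <= exp (Rabs p * (Rabs (ln lo) + Rabs (ln hi))).
Proof.
  intros Hlo Hu.
  assert (H1 : ln lo <= ln u) by (apply ln_le; lra).
  assert (H2 : ln u <= ln hi) by (apply ln_le; lra).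
  assert (K : Rabs (p * ln u) <= Rabs p * (Rabs (ln lo) + Rabs (ln hi))).
  { rewrite Rabs_mult. apply Rmult_le_compat_l; [apply Rabs_pos|].
    unfold Rabs; repeat destruct Rcase_abs; lra. }
  apply Rabs_le_between in K. unfold Rpower.
  split; apply exp_le_compat; lra.
Qed.

(** Extends functions from [[0, T]] to all times with continuity preserved, so that characteristics
    can be obtained from the global existence result. *)
Definition clamp_time (T s : R) : R := Rmax 0 (Rmin s T).

Lemma clamp_time_range T s : 0 <= T -> 0 <= clamp_time T s <= T.
Proof.
  intros HT. unfold clamp_time. split; [apply Rmax_l|]. apply Rmax_lub; [lra | apply Rmin_r].
Qed.

Lemma clamp_time_id T s : 0 <= s <= T -> clamp_time T s = s.
Proof. intros H. unfold clamp_time. rewrite Rmin_left, Rmax_right; lra. Qed.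

Lemma clamp_time_lip T s s' : Rabs (clamp_time T s - clamp_time T s') <= Rabs (s - s').
Proof.
  unfold clamp_time, Rmax, Rmin.
  repeat destruct Rle_dec; unfold Rabs; repeat destruct Rcase_abs; lra.
Qed.

Lemma jcont_clamp_time (T : R) (f : R -> R -> R) :
  0 <= T -> jointly_continuous_on (strip T) f -> jcont (fun s x => f (clamp_time T s) x).
Proof.
  intros HT Hf a b eps. rewrite jointly_continuous_on_eps in Hf.
  destruct (Hf (clamp_time T a) b (clamp_time_range T a HT) eps (cond_pos eps)) as [d [Hd Hd']].
  exists (mkposreal d Hd). simpl. intros s y Hs Hy. apply Hd'; [now apply clamp_time_range | | exact Hy].
  eapply Rle_lt_trans; [apply clamp_time_lip | exact Hs].
Qed.

Lemma is_derive_along_curve (T : R) (f ft fx : R -> R -> R) (X : R -> R) (t dX : R) :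
  (forall t x, strip T t x -> is_dt (strip T) f t x (ft t x) /\ is_dx (strip T) f t x (fx t x)) ->
  jointly_continuous_on (strip T) ft -> 0 < t < T -> is_derive X t dX ->
  is_derive (fun s => f s (X s)) t (ft t (X t) + fx t (X t) * dX).
Proof.
  intros Hf Hft Ht HX.
  set (d := Rmin t (T - t)). assert (Hd : 0 < d) by (apply Rmin_pos; lra).
  assert (m1 : d <= t) by apply Rmin_l. assert (m2 : d <= T - t) by apply Rmin_r.
  assert (D : differentiable_pt_lim f t (X t) (ft t (X t)) (fx t (X t))).
  { apply differentiable_of_partials.
    - exists (mkposreal d Hd). simpl. intros s y Hs _. apply Rabs_def2 in Hs.
      apply (is_dt_is_derive T); [lra|]. apply Hf. unfold strip. lra.
    - apply (is_dx_is_derive T); [lra|]. apply Hf. unfold strip. lra.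
    - intros eps. rewrite jointly_continuous_on_eps in Hft.
      destruct (Hft t (X t) ltac:(unfold strip; lra) eps (cond_pos eps)) as [e [He He']].
      assert (Hm : 0 < Rmin d e) by (apply Rmin_pos; lra).
      assert (m3 := Rmin_l d e). assert (m4 := Rmin_r d e).
      exists (mkposreal _ Hm). simpl. intros s y Hs Hy. apply He'; try lra.
      assert (Hs' : Rabs (s - t) < d) by lra. apply Rabs_def2 in Hs'. unfold strip. lra. }
  assert (K := derivable_pt_lim_comp_2d f (fun s => s) X t _ _ 1 dX D).
  apply is_derive_Reals. rewrite <- (Rmult_1_r (ft t (X t))). apply K.
  - apply is_derive_Reals. apply (is_derive_id (K := R_AbsRing)).
  - now apply is_derive_Reals.
Qed.

Definition speed (gamma u : R) : R := Rpower u (- ((gamma + 1) / 2)).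

Lemma speed_pos gamma u : 0 < speed gamma u.
Proof. apply exp_pos. Qed.

Lemma is_derive_eta (gamma u : R) : 1 < gamma -> 0 < u -> is_derive (eta gamma) u (- speed gamma u).
Proof.
  intros Hg Hu. unfold eta.
  evar_last; [apply (is_derive_scal (fun u => Rpower u (- ((gamma - 1) / 2)))), is_derive_Rpower, Hu|].
  unfold speed. replace (- ((gamma - 1) / 2) - 1) with (- ((gamma + 1) / 2)) by field.
  unfold scal; simpl; unfold mult; simpl. field. lra.
Qed.

Lemma is_derive_pressure (gamma u : R) : 1 < gamma -> 0 < u ->
  is_derive (pressure gamma) u (- speed gamma u ^ 2).
Proof.
  intros Hg Hu. unfold pressure.
  apply (is_derive_ext (fun u => / gamma * Rpower u (- gamma))); [intros; apply Rmult_comm|].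
  evar_last; [apply (is_derive_scal (fun u => Rpower u (- gamma))), is_derive_Rpower, Hu|].
  unfold speed. simpl. rewrite Rmult_1_r, <- Rpower_plus.
  replace (- ((gamma + 1) / 2) + - ((gamma + 1) / 2)) with (- gamma - 1) by field.
  unfold scal; simpl; unfold mult; simpl. field. lra.
Qed.

(** The second bound holds because [eta] has derivative [- speed], bounded away from [0] on the
    interval. It controls the difference of two wave speeds by the difference of Riemann invariants,
    which is what closes the uniqueness estimate. A single constant serves all the estimates. *)
Lemma speed_eta_lipschitz (gamma lo hi : R) : 1 < gamma -> 0 < lo ->
  exists C, 0 < C /\
    (forall u w, lo <= u <= hi -> lo <= w <= hi ->
      Rabs (speed gamma u - speed gamma w) <= C * Rabs (u - w) /\
      Rabs (speed gamma u - speed gamma w) <= C * Rabs (eta gamma u - eta gamma w)) /\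
    (forall u, lo <= u <= hi -> speed gamma u <= C).
Proof.
  intros Hg Hlo.
  set (B := Rabs (ln lo) + Rabs (ln hi)).
  set (p := - ((gamma + 1) / 2)).
  set (C1 := Rabs p * exp (Rabs (p - 1) * B)).
  set (m := exp (- (Rabs p * B))).
  assert (Hm : 0 < m) by apply exp_pos.
  assert (HC1 : 0 <= C1) by (apply Rmult_le_pos; [apply Rabs_pos | apply Rlt_le, exp_pos]).
  set (Cs := exp (Rabs p * B)). assert (HCs : 0 < Cs) by apply exp_pos.
  assert (HCm : 0 <= C1 / m) by (apply Rdiv_le_0_compat; lra).
  assert (K1 : forall u w, lo <= u <= hi -> lo <= w <= hi ->
     Rabs (speed gamma u - speed gamma w) <= C1 * Rabs (u - w)).
  { intros u w Hu Hw.
    destruct (MVT_gen (speed gamma) w u (fun u => p * Rpower u (p - 1))) as [c [Hc E]].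
    - intros y Hy. apply is_derive_Rpower.
      assert (lo <= Rmin w u) by (apply Rmin_glb; lra). lra.
    - intros y Hy. assert (lo <= Rmin w u) by (apply Rmin_glb; lra).
      apply continuity_pt_filterlim. eapply is_derive_continuous, is_derive_Rpower. lra.
    - assert (lo <= Rmin w u) by (apply Rmin_glb; lra). assert (Rmax w u <= hi) by (apply Rmax_lub; lra).
      rewrite E, Rabs_mult. apply Rmult_le_compat_r; [apply Rabs_pos|].
      rewrite Rabs_mult. apply Rmult_le_compat_l; [apply Rabs_pos|].
      rewrite Rabs_pos_eq by (apply Rlt_le, exp_pos). apply Rpower_bounds; lra. }
  exists (C1 + C1 / m + Cs). split; [lra|]. split.
  - intros u w Hu Hw. assert (K := K1 u w Hu Hw). split.
    + eapply Rle_trans; [exact K|]. apply Rmult_le_compat_r; [apply Rabs_pos | lra].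
    + destruct (MVT_gen (eta gamma) w u (fun u => - speed gamma u)) as [c [Hc E]].
      * intros y Hy. apply is_derive_eta; [exact Hg|].
        assert (lo <= Rmin w u) by (apply Rmin_glb; lra). lra.
      * intros y Hy. assert (lo <= Rmin w u) by (apply Rmin_glb; lra).
        apply continuity_pt_filterlim. eapply is_derive_continuous, is_derive_eta; lra.
      * assert (lo <= Rmin w u) by (apply Rmin_glb; lra). assert (Rmax w u <= hi) by (apply Rmax_lub; lra).
        assert (Hs : m <= speed gamma c) by (apply Rpower_bounds; lra).
        assert (E' : Rabs (eta gamma u - eta gamma w) = speed gamma c * Rabs (u - w)).
        { rewrite E, Rabs_mult, Rabs_Ropp, (Rabs_pos_eq (speed gamma c)); [reflexivity | lra]. }
        assert (Hm' : m * Rabs (u - w) <= Rabs (eta gamma u - eta gamma w)).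
        { rewrite E'. apply Rmult_le_compat_r; [apply Rabs_pos | exact Hs]. }
        eapply Rle_trans; [exact K|].
        apply Rle_trans with (C1 / m * Rabs (eta gamma u - eta gamma w)).
        -- apply Rle_trans with (C1 / m * (m * Rabs (u - w))); [right; field; lra|].
           apply Rmult_le_compat_l; assumption.
        -- apply Rmult_le_compat_r; [apply Rabs_pos | lra].
  - intros u Hu. assert (speed gamma u <= Cs) by (apply Rpower_bounds; lra). lra.
Qed.

Lemma eta_inj (gamma u w : R) : 1 < gamma -> 0 < u -> 0 < w -> eta gamma u = eta gamma w -> u = w.
Proof.
  intros Hg Hu Hw H. unfold eta in H.
  apply Rmult_eq_reg_l in H; [|apply Rgt_not_eq, Rdiv_lt_0_compat; lra].
  unfold Rpower in H. apply exp_inv in H. apply Rmult_eq_reg_l in H; [|lra].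
  apply ln_inv; assumption.
Qed.

(** The equations are stated in nonconservative form, with fixed derivative functions, and at
    interior times only: there the derivatives relative to the strip are ordinary ones and hence
    unique. *)
Record classical (gamma mu lambda T : R) (u v ut ux vt vx : R -> R -> R) (lo B : R) : Prop := {
  cl_u : forall t x, strip T t x -> is_dt (strip T) u t x (ut t x) /\ is_dx (strip T) u t x (ux t x);
  cl_v : forall t x, strip T t x -> is_dt (strip T) v t x (vt t x) /\ is_dx (strip T) v t x (vx t x);
  cl_cont : jointly_continuous_on (strip T) u /\ jointly_continuous_on (strip T) v /\
            jointly_continuous_on (strip T) ut /\ jointly_continuous_on (strip T) vt;
  cl_lo : 0 < lo;
  cl_bounds : forall t x, strip T t x -> lo <= u t x <= B /\ Rabs (v t x) <= B /\
                Rabs (ux t x) <= B /\ Rabs (vx t x) <= B;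
  cl_eq : forall t x, 0 < t < T -> ut t x = vx t x /\
            vt t x - speed gamma (u t x) ^ 2 * ux t x = - (lambda / Rpower (1 + t) mu) * v t x
}.
Arguments cl_u {gamma mu lambda T u v ut ux vt vx lo B} _.
Arguments cl_v {gamma mu lambda T u v ut ux vt vx lo B} _.
Arguments cl_cont {gamma mu lambda T u v ut ux vt vx lo B} _.
Arguments cl_lo {gamma mu lambda T u v ut ux vt vx lo B} _.
Arguments cl_bounds {gamma mu lambda T u v ut ux vt vx lo B} _.
Arguments cl_eq {gamma mu lambda T u v ut ux vt vx lo B} _.

Lemma classical_of_solution (gamma mu lambda T : R) (u0 v0 : R -> R) (u v : R -> R -> R) :
  1 < gamma -> is_solution gamma mu lambda u0 v0 T u v ->
  exists ut ux vt vx lo B, classical gamma mu lambda T u v ut ux vt vx lo B.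
Proof.
  intros Hg ((Cu & [Mu Hu] & ut & ux & Du & Cut & _ & _ & [Mux Hux]) &
     (Cv & [Mv Hv] & vt & vx & Dv & Cvt & _ & _ & [Mvx Hvx]) & [lo [Hlo Hul]] & Heq & _).
  exists ut, ux, vt, vx, lo, (Rabs Mu + Rabs Mv + Rabs Mux + Rabs Mvx).
  constructor; auto.
  - intros t x H. assert (A1 := Hu t x H). assert (A2 := Hv t x H). assert (A3 := Hux t x H). assert (A4 := Hvx t x H).
    assert (A5 := Rle_abs (u t x)). specialize (Hul t x H).
    assert (B1 := Rle_abs Mu). assert (B2 := Rle_abs Mv). assert (B3 := Rle_abs Mux). assert (B4 := Rle_abs Mvx).
    assert (C1 := Rabs_pos Mu). assert (C2 := Rabs_pos Mv). assert (C3 := Rabs_pos Mux). assert (C4 := Rabs_pos Mvx).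
    repeat split; lra.
  - intros t x Ht. assert (Hs : strip T t x) by (unfold strip; lra).
    destruct (Heq t x Hs) as (ut' & vt' & vx' & px & d1 & d2 & d3 & d4 & e1 & e2).
    destruct (Du t x Hs) as [du1 du2]. destruct (Dv t x Hs) as [dv1 dv2].
    assert (Ht' : 0 <= t <= T) by lra.
    apply (is_dt_is_derive T) in d1; [|exact Ht]. apply (is_dt_is_derive T) in d2; [|exact Ht].
    apply (is_dt_is_derive T) in du1; [|exact Ht]. apply (is_dt_is_derive T) in dv1; [|exact Ht].
    apply (is_dx_is_derive T) in d3; [|exact Ht']. apply (is_dx_is_derive T) in d4; [|exact Ht'].
    apply (is_dx_is_derive T) in du2; [|exact Ht']. apply (is_dx_is_derive T) in dv2; [|exact Ht'].
    assert (E1 : ut' = ut t x) by (rewrite <- (is_derive_unique _ _ _ d1); now apply is_derive_unique).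
    assert (E2 : vt' = vt t x) by (rewrite <- (is_derive_unique _ _ _ d2); now apply is_derive_unique).
    assert (E3 : vx' = vx t x) by (rewrite <- (is_derive_unique _ _ _ d3); now apply is_derive_unique).
    assert (E4 : px = - speed gamma (u t x) ^ 2 * ux t x).
    { rewrite <- (is_derive_unique _ _ _ d4). apply is_derive_unique. rewrite Rmult_comm.
      apply (is_derive_comp (V := R_NormedModule) (pressure gamma) (fun y => u t y)); [|exact du2].
      apply is_derive_pressure; [exact Hg|]. specialize (Hul t x Hs). lra. }
    subst. split; [lra|]. rewrite <- e2. ring.
Qed.

Section Uniqueness.
Variables (gamma mu lambda T : R).
Hypothesis gamma_gt : 1 < gamma.
Hypothesis mu_nonneg : 0 <= mu.
Hypothesis lambda_nonneg : 0 <= lambda.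
Hypothesis T_pos : 0 < T.

Lemma characteristic_exists u v ut ux vt vx lo B e t0 x0 :
  classical gamma mu lambda T u v ut ux vt vx lo B -> e = 1 \/ e = -1 ->
  exists X : R -> R, X t0 = x0 /\
    forall t, is_derive X t (- e * speed gamma (u (clamp_time T t) (X t))).
Proof.
  intros H He.
  destruct (speed_eta_lipschitz gamma lo B gamma_gt (cl_lo H)) as (C & HC & Hlip & Hbd).
  assert (Hran : forall t x, lo <= u (clamp_time T t) x <= B).
  { intros t x. apply (cl_bounds H). apply clamp_time_range. lra. }
  assert (HB : 0 < B).
  { generalize (cl_lo H) (Hran 0 0). lra. }
  assert (Hlo := cl_lo H).
  assert (Hae : Rabs e = 1) by (destruct He as [->| ->]; [apply Rabs_R1 | rewrite Rabs_left; lra]).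
  apply (ode_exists (fun t x => - e * speed gamma (u (clamp_time T t) x)) (C * B) C).
  - apply Rmult_lt_0_compat; lra.
  - apply jcont_mult; [apply jcont_const|].
    assert (J := jcont_clamp_time T u ltac:(lra) (proj1 (cl_cont H))).
    intros a b. apply (continuity_1d_2d_pt_comp (speed gamma)); [|apply J].
    apply continuity_pt_filterlim. eapply is_derive_continuous, is_derive_Rpower.
    generalize (Hran a b). lra.
  - intros t x y. replace (- e * speed gamma (u (clamp_time T t) x) - - e * speed gamma (u (clamp_time T t) y))
      with (- e * (speed gamma (u (clamp_time T t) x) - speed gamma (u (clamp_time T t) y))) by ring.
    rewrite Rabs_mult, Rabs_Ropp, Hae, Rmult_1_l.
    eapply Rle_trans; [apply (proj1 (Hlip _ _ (Hran t x) (Hran t y)))|].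
    rewrite Rmult_assoc. apply Rmult_le_compat_l; [lra|].
    assert (Hs : strip T (clamp_time T t) x) by (apply clamp_time_range; lra).
    destruct (MVT_gen (fun z => u (clamp_time T t) z) y x (fun z => ux (clamp_time T t) z)) as [c [Hc E]].
    + intros z _. apply (is_dx_is_derive T); [apply clamp_time_range; lra|].
      apply (cl_u H). exact Hs.
    + intros z _. apply continuity_pt_filterlim.
      eapply is_derive_continuous, (is_dx_is_derive T); [apply clamp_time_range; lra|].
      apply (cl_u H). exact Hs.
    + rewrite E, Rabs_mult. apply Rmult_le_compat_r; [apply Rabs_pos|].
      apply (cl_bounds H). exact Hs.
  - intros t x. rewrite Rabs_mult, Rabs_Ropp, Hae, Rmult_1_l.
    rewrite Rabs_pos_eq by apply Rlt_le, speed_pos. apply Hbd, Hran.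
Qed.

Lemma Rpower_ge_1 t : 0 <= t -> 1 <= Rpower (1 + t) mu.
Proof.
  intros Ht. assert (H : ln 1 <= ln (1 + t)) by (apply ln_le; lra). rewrite ln_1 in H.
  unfold Rpower. rewrite <- exp_0 at 1. apply exp_le_compat. now apply Rmult_le_pos.
Qed.

(** Along a characteristic of the first solution the difference of invariants has a derivative
    bounded by [L0] times the largest difference at that time. In the supremum weighted by
    [exp (- (2 * L0) * t)], integration from zero initial values halves any bound, so
    [sup_contraction] gives [0]. *)
Lemma solution_unique u0 v0 u1 v1 u2 v2 :
  is_solution gamma mu lambda u0 v0 T u1 v1 -> is_solution gamma mu lambda u0 v0 T u2 v2 ->
  forall t x, 0 <= t <= T -> u1 t x = u2 t x /\ v1 t x = v2 t x.
Proof.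
  intros S1 S2.
  destruct (classical_of_solution _ _ _ _ _ _ _ _ gamma_gt S1) as (ut1 & ux1 & vt1 & vx1 & lo1 & B1 & K1).
  destruct (classical_of_solution _ _ _ _ _ _ _ _ gamma_gt S2) as (ut2 & ux2 & vt2 & vx2 & lo2 & B2 & K2).
  set (lo := Rmin lo1 lo2). set (B := Rmax B1 B2).
  assert (Hlo : 0 < lo) by (apply Rmin_pos; [apply (cl_lo K1) | apply (cl_lo K2)]).
  assert (R1 : forall t x, strip T t x -> lo <= u1 t x <= B).
  { intros t x H. assert (A := proj1 (cl_bounds K1 t x H)).
    assert (lo <= lo1) by apply Rmin_l. assert (B1 <= B) by apply Rmax_l. lra. }
  assert (R2 : forall t x, strip T t x -> lo <= u2 t x <= B).
  { intros t x H. assert (A := proj1 (cl_bounds K2 t x H)).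
    assert (lo <= lo2) by apply Rmin_r. assert (B2 <= B) by apply Rmax_r. lra. }
  destruct (speed_eta_lipschitz gamma lo B gamma_gt Hlo) as (C & HC & Hlip & Hbd).
  assert (HB2 : 0 < B2).
  { assert (Hs : strip T 0 0) by (unfold strip; lra).
    generalize (cl_lo K2) (proj1 (cl_bounds K2 0 0 Hs)). lra. }
  (* [lambda] bounds the damping coefficient. In the other summand the first [C] converts the
     difference of speeds and [C * B2 + B2] bounds the derivatives of the second solution that
     multiply it. *)
  set (L0 := lambda + C * (C * B2 + B2)).
  assert (HL0 : 0 < L0).
  { assert (0 < C * (C * B2 + B2)); [|unfold L0; lra].
    apply Rmult_lt_0_compat; [lra|]. assert (0 < C * B2) by (apply Rmult_lt_0_compat; lra). lra. }
  set (rho := fun e t x => (v1 t x - e * eta gamma (u1 t x)) - (v2 t x - e * eta gamma (u2 t x))).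
  assert (Hzero : forall p : R * (R * R), ((fst p = 1 \/ fst p = -1) /\ strip T (fst (snd p)) (snd (snd p))) ->
     Rabs (rho (fst p) (fst (snd p)) (snd (snd p))) * exp (- (2 * L0) * fst (snd p)) <= 0).
  { apply (sup_contraction (fun p : R * (R * R) => (fst p = 1 \/ fst p = -1) /\ strip T (fst (snd p)) (snd (snd p)))
      (fun p => Rabs (rho (fst p) (fst (snd p)) (snd (snd p))) * exp (- (2 * L0) * fst (snd p))) 0 (/ 2)); [lra| |].
    - assert (HBe : forall u, lo <= u <= B -> Rabs (eta gamma u) <= eta gamma lo).
      { intros u Hu.
        assert (Hp : 0 < eta gamma u) by (apply Rmult_lt_0_compat; [apply Rdiv_lt_0_compat; lra | apply exp_pos]).
        rewrite Rabs_pos_eq by lra. unfold eta.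
        apply Rmult_le_compat_l; [apply Rlt_le, Rdiv_lt_0_compat; lra|].
        unfold Rpower. apply exp_le_compat.
        assert (ln lo <= ln u) by (apply ln_le; lra).
        rewrite <- !Ropp_mult_distr_l. apply Ropp_le_contravar, Rmult_le_compat_l; lra. }
      exists (B1 + B2 + 2 * eta gamma lo).
      intros [e [t x]] [He Hs]. simpl in He, Hs |- *.
      destruct (cl_bounds K1 t x Hs) as (_ & b1 & _).
      destruct (cl_bounds K2 t x Hs) as (_ & b2 & _).
      assert (e1 := HBe _ (R1 t x Hs)). assert (e2 := HBe _ (R2 t x Hs)).
      apply Rabs_le_between in b1. apply Rabs_le_between in b2.
      apply Rabs_le_between in e1. apply Rabs_le_between in e2.
      assert (E : Rabs (rho e t x) <= B1 + B2 + 2 * eta gamma lo).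
      { unfold rho. apply Rabs_le. destruct He as [->| ->]; lra. }
      rewrite <- (Rmult_1_r (B1 + B2 + 2 * eta gamma lo)).
      apply Rmult_le_compat; [apply Rabs_pos | apply Rlt_le, exp_pos | exact E |].
      rewrite <- exp_0. apply exp_le_compat. destruct Hs as [Ht _].
      assert (0 <= 2 * L0 * t) by (apply Rmult_le_pos; lra). lra.
    - intros D HD Hind [e [t0 x0]] [He Hs]. simpl in He, Hs |- *.
      assert (Hind' : forall e t x, e = 1 \/ e = -1 -> strip T t x -> Rabs (rho e t x) <= D * exp (2 * L0 * t)).
      { intros e' t x He' Hs'. specialize (Hind (e', (t, x)) (conj He' Hs')). simpl in Hind.
        apply Rmult_le_reg_r with (exp (- (2 * L0) * t)); [apply exp_pos|].
        rewrite Rmult_assoc, <- exp_plus.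
        replace (2 * L0 * t + - (2 * L0) * t) with 0 by ring. rewrite exp_0, Rmult_1_r. exact Hind. }
      assert (He2 : e * e = 1) by (destruct He as [->| ->]; ring).
      destruct (characteristic_exists _ _ _ _ _ _ _ _ e t0 x0 K1 He) as (X & HX0 & HX).
      set (g := fun t => rho e (clamp_time T t) (X t)).
      assert (CX : forall t, continuous X t) by (intros; eapply is_derive_continuous, HX).
      assert (Hg0 : g 0 = 0).
      { unfold g. rewrite clamp_time_id by lra. unfold rho.
        destruct S1 as (_ & _ & _ & _ & I1). destruct S2 as (_ & _ & _ & _ & I2).
        destruct (I1 (X 0)) as [-> ->]. destruct (I2 (X 0)) as [-> ->]. ring. }
      assert (Cg : forall t, continuous g t).
      { intros t. unfold g, rho.
        assert (J : forall f, jcont f -> continuous (fun t => f t (X t)) t).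
        { intros f Hf. apply (jcont_slice1 (fun s _ => f s (X s)) 0 t).
          apply (jcont_comp2 f (fun s _ => s) (fun s _ => X s)); [exact Hf | apply jcont_fst |].
          apply (jcont_comp1 X (fun s _ => s)); [exact CX | apply jcont_fst]. }
        apply (J (fun t x => (v1 (clamp_time T t) x - e * eta gamma (u1 (clamp_time T t) x))
           - (v2 (clamp_time T t) x - e * eta gamma (u2 (clamp_time T t) x)))).
        destruct (cl_cont K1) as (cu1 & cv1 & _).
        destruct (cl_cont K2) as (cu2 & cv2 & _).
        assert (Je : forall u, jointly_continuous_on (strip T) u -> (forall t x, strip T t x -> lo <= u t x <= B) ->
           jcont (fun t x => e * eta gamma (u (clamp_time T t) x))).
        { intros u Cu Ru. apply jcont_mult; [apply jcont_const|]. intros a b.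
          apply (continuity_1d_2d_pt_comp (eta gamma)); [|apply (jcont_clamp_time T u); [lra | exact Cu]].
          apply continuity_pt_filterlim. eapply is_derive_continuous, is_derive_eta; [exact gamma_gt|].
          assert (lo <= u (clamp_time T a) b <= B) by (apply Ru, clamp_time_range; lra). lra. }
        apply jcont_minus; apply jcont_minus; auto; apply jcont_clamp_time; auto; lra. }
      assert (Dg : forall t, 0 < t < T -> exists d, is_derive g t d /\ Rabs d <= L0 * (D * exp (2 * L0 * t))).
      { intros t Ht. assert (Hst : strip T t (X t)) by (unfold strip; lra).
        assert (HX' := HX t). rewrite clamp_time_id in HX' by lra.
        set (c1 := speed gamma (u1 t (X t))) in *. set (c2 := speed gamma (u2 t (X t))).
        assert (A : forall u v ut ux vt vx lo' B', classical gamma mu lambda T u v ut ux vt vx lo' B' ->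
           is_derive (fun s => v s (X s) - e * eta gamma (u s (X s))) t
            ((vt t (X t) + vx t (X t) * (- e * c1)) + e * speed gamma (u t (X t)) * (ut t (X t) + ux t (X t) * (- e * c1)))).
        { intros u v ut ux vt vx lo' B' K.
          assert (Du := is_derive_along_curve T u ut ux X t _ (cl_u K)
            (proj1 (proj2 (proj2 (cl_cont K)))) Ht HX').
          assert (Dv := is_derive_along_curve T v vt vx X t _ (cl_v K)
            (proj2 (proj2 (proj2 (cl_cont K)))) Ht HX').
          assert (Hup : 0 < u t (X t)).
          { generalize (cl_lo K) (proj1 (cl_bounds K t (X t) Hst)). lra. }
          evar_last.
          - apply (is_derive_minus (V := R_NormedModule) (fun s => v s (X s))); [exact Dv|].
            apply (is_derive_scal (fun s => eta gamma (u s (X s)))).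
            apply (is_derive_comp (V := R_NormedModule) (eta gamma) (fun s => u s (X s))); [|exact Du].
            apply is_derive_eta; assumption.
          - unfold minus, plus, opp, scal; simpl. unfold mult; simpl. ring. }
        assert (A1 := A _ _ _ _ _ _ _ _ K1). assert (A2 := A _ _ _ _ _ _ _ _ K2).
        destruct (cl_eq K1 t (X t) Ht) as [P1 P2].
        destruct (cl_eq K2 t (X t) Ht) as [P3 P4].
        fold c1 in A1, P2. fold c2 in A2, P4.
        eexists. split.
        - apply (is_derive_ext_loc (fun s => (v1 s (X s) - e * eta gamma (u1 s (X s))) - (v2 s (X s) - e * eta gamma (u2 s (X s))))).
          + assert (Hm : 0 < Rmin t (T - t)) by (apply Rmin_pos; lra).
            exists (mkposreal _ Hm). intros s Hsb. change (Rabs (s - t) < Rmin t (T - t)) in Hsb.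
            assert (m1 := Rmin_l t (T - t)). assert (m2 := Rmin_r t (T - t)). apply Rabs_def2 in Hsb.
            unfold g, rho. now rewrite clamp_time_id by lra.
          + apply (is_derive_minus (V := R_NormedModule) _ _ _ _ _ A1 A2).
        - unfold minus, plus, opp; simpl.
          rewrite P1, P3.
          set (dm := lambda / Rpower (1 + t) mu) in *.
          (* The term with [c1 - c2] appears because the second solution is followed along a curve
             that is not its own characteristic; it contains first derivatives of the second
             solution only. *)
          match goal with |- Rabs ?z <= _ =>
            replace z with (- dm * (v1 t (X t) - v2 t (X t)) + (c1 - c2) * (c2 * ux2 t (X t) + e * vx2 t (X t))) end.
          2:{ assert (F1 : vt1 t (X t) = - dm * v1 t (X t) + c1 ^ 2 * ux1 t (X t)) by lra.
              assert (F2 : vt2 t (X t) = - dm * v2 t (X t) + c2 ^ 2 * ux2 t (X t)) by lra.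
              rewrite F1, F2.
              transitivity (- dm * (v1 t (X t) - v2 t (X t)) + c1 ^ 2 * ux1 t (X t) * (1 - e * e)
                 - (c2 ^ 2 * ux2 t (X t) + (c2 - c1) * e * vx2 t (X t) - c1 * c2 * ux2 t (X t) * (e * e))).
              - rewrite He2. ring.
              - ring. }
          assert (I1 := Hind' 1 t (X t) ltac:(auto) Hst). assert (I2 := Hind' (-1) t (X t) ltac:(auto) Hst).
          unfold rho in I1, I2. apply Rabs_le_between in I1. apply Rabs_le_between in I2.
          set (De := D * exp (2 * L0 * t)) in *.
          assert (V1 : Rabs (v1 t (X t) - v2 t (X t)) <= De) by (apply Rabs_le; lra).
          assert (V2 : Rabs (eta gamma (u1 t (X t)) - eta gamma (u2 t (X t))) <= De) by (apply Rabs_le; lra).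
          destruct (Hlip _ _ (R1 t (X t) Hst) (R2 t (X t) Hst)) as [_ V3]. fold c1 c2 in V3.
          assert (HDe : 0 <= De) by (eapply Rle_trans; [apply Rabs_pos | exact V1]).
          destruct (cl_bounds K2 t (X t) Hst) as (_ & _ & b3 & b4).
          assert (Hc2 : 0 < c2 <= C) by (split; [apply speed_pos | apply Hbd, R2, Hst]).
          assert (Hdm : 0 <= dm <= lambda).
          { assert (Hr := Rpower_ge_1 t ltac:(lra)). unfold dm. split; [apply Rdiv_le_0_compat; lra|].
            assert (Hi : / Rpower (1 + t) mu <= / 1) by (apply Rinv_le_contravar; lra). rewrite Rinv_1 in Hi.
            unfold Rdiv. rewrite <- (Rmult_1_r lambda) at 2. apply Rmult_le_compat_l; lra. }
          assert (Hae : Rabs e = 1) by (destruct He as [->| ->]; [apply Rabs_R1 | rewrite Rabs_left; lra]).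
          eapply Rle_trans; [apply Rabs_triang|]. unfold L0. rewrite Rmult_plus_distr_r.
          apply Rplus_le_compat.
          + rewrite Rabs_mult, Rabs_Ropp, (Rabs_pos_eq dm) by lra.
            apply Rmult_le_compat; try lra. apply Rabs_pos.
          + rewrite Rabs_mult. replace (C * (C * B2 + B2) * De) with ((C * De) * (C * B2 + B2)) by ring.
            apply Rmult_le_compat; try apply Rabs_pos.
            * eapply Rle_trans; [exact V3|]. apply Rmult_le_compat_l; lra.
            * eapply Rle_trans; [apply Rabs_triang|]. rewrite !Rabs_mult, Hae, (Rabs_pos_eq c2) by lra.
              apply Rplus_le_compat; [|lra]. apply Rmult_le_compat; try lra. apply Rabs_pos. }
      assert (Hex : exp (2 * L0 * t0) * exp (- (2 * L0) * t0) = 1).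
      { rewrite <- exp_plus. replace (2 * L0 * t0 + - (2 * L0) * t0) with 0 by ring. apply exp_0. }
      enough (Hfin : Rabs (g t0) <= / 2 * D * exp (2 * L0 * t0)).
      { unfold g in Hfin. rewrite clamp_time_id, HX0 in Hfin by apply Hs.
        apply Rle_trans with (/ 2 * D * exp (2 * L0 * t0) * exp (- (2 * L0) * t0)).
        - apply Rmult_le_compat_r; [apply Rlt_le, exp_pos | exact Hfin].
        - rewrite Rmult_assoc, Hex. lra. }
      assert (key : forall sg, sg = 1 \/ sg = -1 -> sg * g t0 <= / 2 * D * exp (2 * L0 * t0)).
      { intros sg Hsg.
        assert (Dh : forall t, 0 < t < T -> exists d,
            is_derive (fun t => sg * g t - / 2 * D * exp (2 * L0 * t)) t d /\ d <= 0).
        { intros t Ht. destruct (Dg t Ht) as [d [Hd Hdb]]. eexists. split.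
          - apply (is_derive_minus (V := R_NormedModule) (fun t => sg * g t)).
            + apply (is_derive_scal g), Hd.
            + apply (is_derive_scal (fun t => exp (2 * L0 * t)) t (/ 2 * D) (2 * L0 * exp (2 * L0 * t))).
              auto_derive; [trivial | ring].
          - apply Rabs_le_between in Hdb. unfold minus, plus, opp; simpl. destruct Hsg as [->| ->]; lra. }
        destruct Hs as [Ht0 Ht1]. destruct Ht0 as [Ht0|Ht0].
        2:{ rewrite <- Ht0, Hg0, Rmult_0_r. apply Rmult_le_pos; [lra | apply Rlt_le, exp_pos]. }
        (* The mean value theorem places its point in the closed interval, so the default [0]
           outside [(0, T)] keeps the sign available at the endpoints as well. *)
        assert (HM : exists df : R -> R, forall t, (0 < t < T ->
            is_derive (fun t => sg * g t - / 2 * D * exp (2 * L0 * t)) t (df t)) /\ df t <= 0).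
        { apply (functional_choice (fun t d => (0 < t < T ->
            is_derive (fun t => sg * g t - / 2 * D * exp (2 * L0 * t)) t d) /\ d <= 0)).
          intros t. destruct (Rlt_dec 0 t) as [h|h]; [destruct (Rlt_dec t T) as [h'|h']|].
          - destruct (Dh t (conj h h')) as [d Hd]. exists d. split; [intros _|]; apply Hd.
          - exists 0. split; lra.
          - exists 0. split; lra. }
        destruct HM as [df Hdf].
        destruct (MVT_gen (fun t => sg * g t - / 2 * D * exp (2 * L0 * t)) 0 t0 df) as [c [Hc E]].
        - rewrite Rmin_left, Rmax_right by lra. intros y Hy. apply Hdf. lra.
        - intros y _. apply continuity_pt_filterlim.
          apply (continuous_minus (V := R_NormedModule) (fun t => sg * g t) (fun t => / 2 * D * exp (2 * L0 * t))).
          + apply (continuous_scal_r (V := R_NormedModule) sg g), Cg.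
          + apply (is_derive_continuous _ y (/ 2 * D * (2 * L0 * exp (2 * L0 * y)))). auto_derive; [trivial | ring].
        - assert (Hc' := proj2 (Hdf c)).
          rewrite Hg0, Rmult_0_r, Rmult_0_r, exp_0 in E.
          assert (df c * (t0 - 0) <= 0).
          { rewrite Rmult_comm. assert (0 <= (t0 - 0) * - df c) by (apply Rmult_le_pos; lra). lra. }
          lra. }
      unfold Rabs. destruct Rcase_abs.
      + generalize (key (-1) ltac:(auto)). lra.
      + generalize (key 1 ltac:(auto)). lra. }
  intros t x Ht.
  assert (Hst : strip T t x) by exact Ht.
  assert (Z : forall e, e = 1 \/ e = -1 -> rho e t x = 0).
  { intros e He. assert (K := Hzero (e, (t, x)) (conj He Hst)). simpl in K.
    apply Rabs_eq_0, Rle_antisym; [|apply Rabs_pos].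
    apply Rmult_le_reg_r with (exp (- (2 * L0) * t)); [apply exp_pos|]. lra. }
  assert (Z1 := Z 1 ltac:(auto)). assert (Z2 := Z (-1) ltac:(auto)). unfold rho in Z1, Z2.
  assert (A1 := R1 t x Hst). assert (A2 := R2 t x Hst).
  split; [apply (eta_inj gamma); lra | lra].
Qed.
End Uniqueness.

(** * Gluing *)

Lemma D_in_local (f g : R -> R) (D E : R -> Prop) (x l d : R) :
  0 < d -> f x = g x ->
  (forall y, E y -> Rabs (y - x) < d -> D y /\ f y = g y) ->
  D_in f (fun _ => l) D x -> D_in g (fun _ => l) E x.
Proof.
  intros Hd Hx H HD eps Heps. destruct (HD eps Heps) as [e [He H']].
  exists (Rmin d e). split; [apply Rmin_pos; assumption|].
  intros y [[Hy Hne] Hyd]. simpl in Hyd. unfold Rdist in Hyd.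
  assert (m1 := Rmin_l d e). assert (m2 := Rmin_r d e).
  destruct (H y Hy ltac:(lra)) as [HDy Hfg]. rewrite <- Hfg, <- Hx.
  apply H'. split; [split; assumption|]. simpl. unfold Rdist. lra.
Qed.

Lemma is_dt_mono (Om Om' : R -> R -> Prop) (f g : R -> R -> R) (t x l : R) :
  (forall t x, Om' t x -> Om t x) -> (forall t x, Om' t x -> f t x = g t x) -> Om' t x ->
  is_dt Om f t x l -> is_dt Om' g t x l.
Proof.
  intros Hs He Ht. apply (D_in_local _ _ _ _ _ _ 1); [lra | now apply He |].
  intros y Hy _. auto.
Qed.

Lemma is_dx_mono (Om Om' : R -> R -> Prop) (f g : R -> R -> R) (t x l : R) :
  (forall t x, Om' t x -> Om t x) -> (forall t x, Om' t x -> f t x = g t x) -> Om' t x ->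
  is_dx Om f t x l -> is_dx Om' g t x l.
Proof.
  intros Hs He Ht. apply (D_in_local _ _ _ _ _ _ 1); [lra | now apply He |].
  intros y Hy _. auto.
Qed.

Lemma jointly_continuous_on_mono (Om Om' : R -> R -> Prop) (f g : R -> R -> R) :
  (forall t x, Om' t x -> Om t x) -> (forall t x, Om' t x -> f t x = g t x) ->
  jointly_continuous_on Om f -> jointly_continuous_on Om' g.
Proof.
  intros Hs He. rewrite !jointly_continuous_on_eps. intros H t x Ht eps Heps.
  destruct (H t x (Hs t x Ht) eps Heps) as [d [Hd Hd']]. exists d. split; [exact Hd|].
  intros t' x' Ht' h1 h2. rewrite <- !He by assumption. auto.
Qed.

Lemma C1b_mono (Om Om' : R -> R -> Prop) (f g : R -> R -> R) :
  (forall t x, Om' t x -> Om t x) -> (forall t x, Om' t x -> f t x = g t x) ->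
  C1b Om f -> C1b Om' g.
Proof.
  intros Hs He (Hc & [Mf Hb] & ft & fx & Hd & Ct & [Mt Bt] & Cx & [Mx Bx]).
  split; [now apply (jointly_continuous_on_mono Om Om' f g)|].
  split; [exists Mf; intros t x H; rewrite <- He by assumption; auto|].
  exists ft, fx. split; [|split; [|split; [|split]]].
  - intros t x H. destruct (Hd t x (Hs t x H)) as [d1 d2].
    split; [now apply (is_dt_mono Om Om' f g) | now apply (is_dx_mono Om Om' f g)].
  - now apply (jointly_continuous_on_mono Om Om' ft ft).
  - exists Mt. auto.
  - now apply (jointly_continuous_on_mono Om Om' fx fx).
  - exists Mx. auto.
Qed.

Lemma is_solution_mono (gamma mu lambda : R) (u0 v0 u0' v0' : R -> R) (T T' : R) (u v u' v' : R -> R -> R) :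
  0 <= T' <= T -> (forall t x, 0 <= t <= T' -> u t x = u' t x /\ v t x = v' t x) ->
  (forall x, u0 x = u0' x /\ v0 x = v0' x) ->
  is_solution gamma mu lambda u0 v0 T u v -> is_solution gamma mu lambda u0' v0' T' u' v'.
Proof.
  intros HT He H0 (Cu & Cv & [c [Hc Hlo]] & Heq & Hini).
  assert (Hs : forall t x, strip T' t x -> strip T t x) by (unfold strip; intros; lra).
  assert (Eu : forall t x, strip T' t x -> u t x = u' t x) by (intros; now apply He).
  assert (Ev : forall t x, strip T' t x -> v t x = v' t x) by (intros; now apply He).
  split; [now apply (C1b_mono (strip T) (strip T') u u')|].
  split; [now apply (C1b_mono (strip T) (strip T') v v')|].
  split; [exists c; split; [exact Hc | intros t x H; rewrite <- Eu by assumption; auto]|].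
  split.
  - intros t x H. destruct (Heq t x (Hs t x H)) as (ut & vt & vx & px & d1 & d2 & d3 & d4 & e1 & e2).
    exists ut, vt, vx, px. split; [|split; [|split; [|split; [|split]]]]; auto.
    + now apply (is_dt_mono (strip T) (strip T') u u').
    + now apply (is_dt_mono (strip T) (strip T') v v').
    + now apply (is_dx_mono (strip T) (strip T') v v').
    + apply (is_dx_mono (strip T) (strip T') (fun s y => pressure gamma (u s y))); auto.
      intros; now rewrite Eu.
    + now rewrite <- Ev.
  - intros x. destruct (Hini x) as [i1 i2]. destruct (H0 x) as [j1 j2].
    destruct (He 0 x ltac:(lra)) as [h1 h2]. split; congruence.
Qed.

Definition riemann_derivative_bounds (gamma : R) (u v : R -> R -> R) (Om : R -> R -> Prop)
    (bnd : R -> R) (rt rx st sx : R -> R -> R) : Prop :=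
  forall t x, Om t x ->
    is_dt Om (riemann_r gamma u v) t x (rt t x) /\
    is_dx Om (riemann_r gamma u v) t x (rx t x) /\
    is_dt Om (riemann_s gamma u v) t x (st t x) /\
    is_dx Om (riemann_s gamma u v) t x (sx t x) /\
    Rabs (rt t x) <= bnd t /\ Rabs (rx t x) <= bnd t /\
    Rabs (st t x) <= bnd t /\ Rabs (sx t x) <= bnd t.

Lemma global_of_strips (gamma mu lambda : R) (u0 v0 : R -> R) (bnd : R -> R) :
  1 < gamma -> 0 <= mu -> 0 <= lambda ->
  (forall T, 0 < T -> exists u v rt rx st sx,
     is_solution gamma mu lambda u0 v0 T u v /\
     riemann_derivative_bounds gamma u v (strip T) bnd rt rx st sx) ->
  exists u v rt rx st sx,
    is_global_solution gamma mu lambda u0 v0 u v /\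
    riemann_derivative_bounds gamma u v half_plane bnd rt rx st sx.
Proof.
  intros Hg Hmu Hla H.
  (* The strip of index [n] ends at [n + 1], whereas the index used at time [t] only satisfies
     [n > t]. All nonnegative times within [1] of [t] then lie in the same strip, and derivatives at
     [t] carry over to the half plane. *)
  assert (Hn : forall n : nat, exists w : (R -> R -> R) * (R -> R -> R) *
      ((R -> R -> R) * (R -> R -> R)) * ((R -> R -> R) * (R -> R -> R)),
     let '(u, v, (rt, rx), (st, sx)) := w in
     is_solution gamma mu lambda u0 v0 (INR n + 1) u v /\
     riemann_derivative_bounds gamma u v (strip (INR n + 1)) bnd rt rx st sx).
  { intros n. destruct (H (INR n + 1)) as (u & v & rt & rx & st & sx & K).
    - generalize (pos_INR n). lra.
    - exists (u, v, (rt, rx), (st, sx)). exact K. }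
  destruct (functional_choice _ Hn) as [F HF].
  destruct (functional_choice (fun t n => INR n > t) INR_unbounded) as [nn Hnn].
  set (un := fun n => fst (fst (fst (F n)))). set (vn := fun n => snd (fst (fst (F n)))).
  set (rtn := fun n => fst (snd (fst (F n)))). set (rxn := fun n => snd (snd (fst (F n)))).
  set (stn := fun n => fst (snd (F n))). set (sxn := fun n => snd (snd (F n))).
  assert (HS : forall n, is_solution gamma mu lambda u0 v0 (INR n + 1) (un n) (vn n) /\
     riemann_derivative_bounds gamma (un n) (vn n) (strip (INR n + 1)) bnd (rtn n) (rxn n) (stn n) (sxn n)).
  { intros n. specialize (HF n). unfold un, vn, rtn, rxn, stn, sxn.
    destruct (F n) as [[[u v] [rt rx]] [st sx]]. exact HF. }
  clearbody un vn rtn rxn stn sxn. clear HF F Hn.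
  assert (Hag : forall n t x, 0 <= t <= INR n + 1 -> un (nn t) t x = un n t x /\ vn (nn t) t x = vn n t x).
  { intros n t x Ht.
    set (T := Rmin (INR (nn t) + 1) (INR n + 1)).
    assert (T1 : T <= INR (nn t) + 1) by apply Rmin_l. assert (T2 : T <= INR n + 1) by apply Rmin_r.
    assert (Htt := Hnn t).
    assert (Ht' : t <= T) by (apply Rmin_glb; lra).
    assert (HTp : 0 < T) by (apply Rmin_pos; generalize (pos_INR n) (pos_INR (nn t)); lra).
    apply (solution_unique gamma mu lambda T Hg Hmu Hla HTp u0 v0); [| |lra].
    - apply (is_solution_mono gamma mu lambda u0 v0 u0 v0 (INR (nn t) + 1) T (un (nn t)) (vn (nn t))); auto; [lra | apply HS].
    - apply (is_solution_mono gamma mu lambda u0 v0 u0 v0 (INR n + 1) T (un n) (vn n)); auto; [lra | apply HS]. }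
  exists (fun t x => un (nn t) t x), (fun t x => vn (nn t) t x), (fun t x => rtn (nn t) t x),
    (fun t x => rxn (nn t) t x), (fun t x => stn (nn t) t x), (fun t x => sxn (nn t) t x).
  split.
  - intros T HT. set (n := nn T). assert (HnT := Hnn T). fold n in HnT.
    apply (is_solution_mono gamma mu lambda u0 v0 u0 v0 (INR n + 1) T (un n) (vn n)); auto; [lra | | apply HS].
    intros t x Ht. destruct (Hag n t x ltac:(lra)). split; congruence.
  - intros t x Ht. unfold half_plane in Ht.
    assert (Htn := Hnn t). set (n := nn t) in *.
    destruct (HS n) as [_ HR].
    destruct (HR t x ltac:(unfold strip; lra)) as (d1 & d2 & d3 & d4 & b).
    assert (Er : forall s y, 0 <= s <= INR n + 1 ->
      riemann_r gamma (un n) (vn n) s y = riemann_r gamma (fun t x => un (nn t) t x) (fun t x => vn (nn t) t x) s y).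
    { intros s y Hs. unfold riemann_r. destruct (Hag n s y Hs) as [-> ->]. reflexivity. }
    assert (Es : forall s y, 0 <= s <= INR n + 1 ->
      riemann_s gamma (un n) (vn n) s y = riemann_s gamma (fun t x => un (nn t) t x) (fun t x => vn (nn t) t x) s y).
    { intros s y Hs. unfold riemann_s. destruct (Hag n s y Hs) as [-> ->]. reflexivity. }
    split; [|split; [|split; [|split]]]; [| | | |exact b].
    + revert d1. apply (D_in_local _ _ _ _ _ _ 1); [lra | apply Er; lra |].
      intros s Hs Hst. apply Rabs_def2 in Hst. unfold half_plane in Hs.
      split; [unfold strip; lra | apply Er; lra].
    + revert d2. apply (D_in_local _ _ _ _ _ _ 1); [lra | apply Er; lra |].
      intros y _ _. split; [unfold strip; lra | apply Er; lra].
    + revert d3. apply (D_in_local _ _ _ _ _ _ 1); [lra | apply Es; lra |].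
      intros s Hs Hst. apply Rabs_def2 in Hst. unfold half_plane in Hs.
      split; [unfold strip; lra | apply Es; lra].
    + revert d4. apply (D_in_local _ _ _ _ _ _ 1); [lra | apply Es; lra |].
      intros y _ _. split; [unfold strip; lra | apply Es; lra].
Qed.

(** * State functions and time weights *)

(* With [theta = s - r] one has [eta u = k + theta / 2] where [k = 2 / (gamma - 1)];
   [eta_ratio] is [eta u / k], frozen outside [|theta| <= k], and [kap] is the
   logarithmic derivative [c' / c] of the wave speed [c] as a function of [theta]. *)
Section StateFunctions.
Variable gamma : R.
Hypothesis gamma_gt : 1 < gamma.

Let k := 2 / (gamma - 1).

Definition eta_ratio (z : R) : R := 1 + clamp (2 / (gamma - 1)) z / (2 * (2 / (gamma - 1))).
Definition kap (z : R) : R := (gamma + 1) / 4 / eta_ratio z.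
(** By the gas law [c] is the power [(gamma + 1) / (gamma - 1)] of [eta u / k], equal to [1] at
    [theta = 0]. Writing [sqrt c], [u] and the pressure as exponentials of multiples of this one
    integral makes their derivative formulas valid for every [z]; agreement with the gas law holds
    for [Rabs z <= k]. *)
Definition log_speed (z : R) : R := RInt kap 0 z.
Definition root_speed (z : R) : R := exp (/ 2 * log_speed z).
Definition state_u (z : R) : R := exp (- (2 / (gamma + 1)) * log_speed z).
Definition coupling (z : R) : R := RInt (fun y => / (4 * root_speed y)) 0 z.

Lemma k_pos : 0 < 2 / (gamma - 1).
Proof. apply Rdiv_lt_0_compat; lra. Qed.

Lemma eta_ratio_range z : / 2 <= eta_ratio z <= 3 / 2.
Proof.
  unfold eta_ratio. fold k. assert (Hk := k_pos). fold k in Hk.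
  assert (H := Rabs_clamp_le k z ltac:(lra)). apply Rabs_le_between in H.
  assert (E1 : clamp k z / (2 * k) <= k / (2 * k)) by (apply Rmult_le_compat_r; [apply Rlt_le, Rinv_0_lt_compat; lra | lra]).
  assert (E2 : - k / (2 * k) <= clamp k z / (2 * k)) by (apply Rmult_le_compat_r; [apply Rlt_le, Rinv_0_lt_compat; lra | lra]).
  replace (k / (2 * k)) with (/ 2) in E1 by (field; lra).
  replace (- k / (2 * k)) with (- / 2) in E2 by (field; lra). lra.
Qed.

Lemma eta_ratio_eq z : Rabs z <= k -> eta_ratio z = 1 + z / (2 * k).
Proof. intros H. unfold eta_ratio. fold k. now rewrite clamp_id. Qed.

Lemma kap_bound z : Rabs (kap z) <= (gamma + 1) / 2.
Proof.
  assert (H := eta_ratio_range z). unfold kap.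
  assert (Hi : / eta_ratio z <= / / 2) by (apply Rinv_le_contravar; lra). rewrite Rinv_inv in Hi.
  assert (Hp : 0 < / eta_ratio z) by (apply Rinv_0_lt_compat; lra).
  rewrite Rabs_pos_eq by (apply Rmult_le_pos; lra).
  replace ((gamma + 1) / 2) with ((gamma + 1) / 4 * 2) by field.
  apply Rmult_le_compat_l; lra.
Qed.

Lemma kap_lip z y : Rabs (kap z - kap y) <= (gamma + 1) / 4 * (4 / (2 * k)) * Rabs (z - y).
Proof.
  assert (H1 := eta_ratio_range z). assert (H2 := eta_ratio_range y). assert (Hk := k_pos). fold k in Hk.
  assert (E : kap z - kap y = (gamma + 1) / 4 * (/ eta_ratio z * / eta_ratio y) * / (2 * k) * (clamp k y - clamp k z)).
  { transitivity ((gamma + 1) / 4 * (/ eta_ratio z * / eta_ratio y) * (eta_ratio y - eta_ratio z)).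
    - unfold kap. field. lra.
    - unfold eta_ratio at 3 4. fold k. field. split; [lra|]. split; lra. }
  rewrite E, !Rabs_mult. rewrite (Rabs_minus_sym z y).
  assert (K : forall w, / 2 <= w -> Rabs (/ w) <= 2).
  { intros w Hw. rewrite Rabs_pos_eq by (apply Rlt_le, Rinv_0_lt_compat; lra).
    rewrite <- (Rinv_inv 2). apply Rinv_le_contravar; lra. }
  rewrite (Rabs_pos_eq ((gamma + 1) / 4)) by lra.
  rewrite (Rabs_pos_eq (/ (2 * k))) by (apply Rlt_le, Rinv_0_lt_compat; lra).
  apply Rmult_le_compat; [| apply Rabs_pos | | apply clamp_lip].
  - repeat apply Rmult_le_pos; try apply Rabs_pos; try lra. apply Rlt_le, Rinv_0_lt_compat. lra.
  - replace ((gamma + 1) / 4 * (4 / (2 * k))) with ((gamma + 1) / 4 * (2 * 2) * / (2 * k)) by (field; lra).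
    apply Rmult_le_compat_r; [apply Rlt_le, Rinv_0_lt_compat; lra|].
    apply Rmult_le_compat_l; [lra|].
    apply Rmult_le_compat; try apply Rabs_pos; apply K; lra.
Qed.

Lemma kap_cont z : continuous kap z.
Proof. apply (continuous_lip kap _ kap_lip). Qed.

Lemma log_speed_derive z : is_derive log_speed z (kap z).
Proof. apply is_derive_RInt_cont, kap_cont. Qed.

Lemma log_speed_le z : Rabs (log_speed z) <= (gamma + 1) / 2 * Rabs z.
Proof.
  unfold log_speed. rewrite <- (Rminus_0_r z) at 2.
  apply Rabs_RInt_le; [apply kap_cont | intros; apply kap_bound].
Qed.

Lemma exp_log_speed_derive q z :
  is_derive (fun z => exp (q * log_speed z)) z (q * kap z * exp (q * log_speed z)).
Proof.
  evar_last.
  - apply (is_derive_comp (V := R_NormedModule) exp (fun z => q * log_speed z)); [apply is_derive_exp|].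
    apply (is_derive_scal log_speed), log_speed_derive.
  - unfold scal; simpl; unfold mult; simpl. ring.
Qed.

Lemma root_speed_derive z : is_derive root_speed z (kap z / 2 * root_speed z).
Proof.
  replace (kap z / 2) with (/ 2 * kap z) by field. apply exp_log_speed_derive.
Qed.

Lemma root_speed_pos z : 0 < root_speed z.
Proof. apply exp_pos. Qed.

Lemma root_speed_sqr z : root_speed z ^ 2 = exp (log_speed z).
Proof. unfold root_speed. simpl. rewrite Rmult_1_r, <- exp_plus. f_equal. field. Qed.

Lemma state_u_derive z : is_derive state_u z (- (2 / (gamma + 1)) * kap z * state_u z).
Proof. apply exp_log_speed_derive. Qed.

Lemma coupling_derive z : is_derive coupling z (/ (4 * root_speed z)).
Proof.
  apply (is_derive_RInt_cont (fun y => / (4 * root_speed y))). intros y.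
  apply (ex_derive_continuous (fun y => / (4 * root_speed y))).
  assert (ex_derive root_speed y) by (eexists; apply root_speed_derive).
  auto_derive. split; [assumption|]. split; [|trivial]. generalize (root_speed_pos y). lra.
Qed.

Lemma pressure_state_u z : pressure gamma (state_u z) = / gamma * exp (2 * gamma / (gamma + 1) * log_speed z).
Proof.
  unfold pressure, state_u, Rpower. rewrite ln_exp.
  replace (- gamma * (- (2 / (gamma + 1)) * log_speed z)) with (2 * gamma / (gamma + 1) * log_speed z) by (field; lra).
  field. lra.
Qed.

Lemma pressure_state_u_derive z :
  is_derive (fun z => pressure gamma (state_u z)) z
    (2 / (gamma + 1) * kap z * exp (2 * gamma / (gamma + 1) * log_speed z)).
Proof.
  apply (is_derive_ext (fun z => / gamma * exp (2 * gamma / (gamma + 1) * log_speed z))).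
  { intros y. symmetry. apply pressure_state_u. }
  evar_last.
  - apply (is_derive_scal (fun z => exp (2 * gamma / (gamma + 1) * log_speed z))), exp_log_speed_derive.
  - unfold scal; simpl; unfold mult; simpl. field. lra.
Qed.

Lemma log_speed_eq z : Rabs z <= k ->
  log_speed z = (gamma + 1) / (gamma - 1) * ln (1 + z / (2 * k)).
Proof.
  intros Hz. assert (Hk := k_pos). fold k in Hk. unfold log_speed.
  assert (Hy : forall y, Rmin 0 z <= y <= Rmax 0 z -> Rabs y <= k).
  { intros y Hy. unfold Rmin, Rmax, Rabs in *. repeat destruct Rle_dec; repeat destruct Rcase_abs; lra. }
  assert (I : is_RInt kap 0 z ((gamma + 1) / (gamma - 1) * ln (1 + z / (2 * k)) -
               (gamma + 1) / (gamma - 1) * ln (1 + 0 / (2 * k)))).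
  { apply (is_RInt_derive (fun y => (gamma + 1) / (gamma - 1) * ln (1 + y / (2 * k))) kap).
    - intros y Hy0. assert (Hyk := Hy y Hy0). assert (Er := eta_ratio_eq y Hyk).
      assert (Rg := eta_ratio_range y).
      unfold kap. rewrite Er in *. auto_derive; [unfold Rdiv in *; lra|].
      unfold k. field. repeat split; try lra.
      + unfold k, Rdiv in Rg. intros E.
        assert (E' : 4 + y * (gamma - 1) = 4 * (1 + y * / (2 * (2 * / (gamma - 1))))) by (field; lra). lra.
    - intros y _. apply kap_cont. }
  rewrite (is_RInt_unique _ _ _ _ I). replace (1 + 0 / (2 * k)) with 1 by (field; lra). rewrite ln_1. ring.
Qed.

Lemma ln_ratio_exp z : Rabs z <= k -> exp (ln (1 + z / (2 * k))) = 1 + z / (2 * k).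
Proof.
  intros Hz. apply exp_ln. rewrite <- eta_ratio_eq by exact Hz. generalize (eta_ratio_range z). lra.
Qed.

Lemma kap_exp z : Rabs z <= k -> kap z = (gamma + 1) / 4 * exp (- ln (1 + z / (2 * k))).
Proof. intros Hz. unfold kap. rewrite eta_ratio_eq, exp_Ropp, ln_ratio_exp by exact Hz. reflexivity. Qed.

(** This is [du / dtheta = - 1 / (2 c)], as expected from [eta' = - c] and
    [eta u = k + theta / 2]. *)
Lemma state_u_derive_eq z : Rabs z <= k ->
  - (2 / (gamma + 1)) * kap z * state_u z = - / (2 * root_speed z ^ 2).
Proof.
  intros Hz. rewrite root_speed_sqr, Rinv_mult, <- exp_Ropp.
  unfold state_u. rewrite kap_exp, log_speed_eq by exact Hz.
  set (w := ln _).
  replace (- (2 / (gamma + 1)) * ((gamma + 1) / 4 * exp (- w)) * exp (- (2 / (gamma + 1)) * ((gamma + 1) / (gamma - 1) * w)))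
    with (- (/ 2 * (exp (- w) * exp (- (2 / (gamma + 1)) * ((gamma + 1) / (gamma - 1) * w))))) by (field; lra).
  rewrite <- exp_plus. do 3 f_equal. field. lra.
Qed.

Lemma pressure_state_u_derive_eq z : Rabs z <= k ->
  2 / (gamma + 1) * kap z * exp (2 * gamma / (gamma + 1) * log_speed z) = root_speed z ^ 2 / 2.
Proof.
  intros Hz. rewrite root_speed_sqr. rewrite kap_exp, log_speed_eq by exact Hz.
  set (w := ln _).
  replace (2 / (gamma + 1) * ((gamma + 1) / 4 * exp (- w)) * exp (2 * gamma / (gamma + 1) * ((gamma + 1) / (gamma - 1) * w)))
    with ((exp (- w) * exp (2 * gamma / (gamma + 1) * ((gamma + 1) / (gamma - 1) * w))) / 2) by (field; lra).
  rewrite <- exp_plus. do 2 f_equal. field. lra.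
Qed.

Lemma eta_state_u z : Rabs z <= k -> eta gamma (state_u z) = 2 / (gamma - 1) + z / 2.
Proof.
  intros Hz. assert (Hk := k_pos). unfold eta, state_u, Rpower. rewrite ln_exp, log_speed_eq by exact Hz.
  replace (- ((gamma - 1) / 2) * (- (2 / (gamma + 1)) * ((gamma + 1) / (gamma - 1) * ln (1 + z / (2 * k)))))
    with (ln (1 + z / (2 * k))) by (field; lra).
  rewrite ln_ratio_exp by exact Hz. unfold k. field. lra.
Qed.

Lemma state_u_eta u : 0 < u -> Rabs (2 * (eta gamma u - 2 / (gamma - 1))) <= k ->
  state_u (2 * (eta gamma u - 2 / (gamma - 1))) = u.
Proof.
  intros Hu Hz. assert (Hk := k_pos). unfold state_u. rewrite log_speed_eq by exact Hz.
  replace (1 + 2 * (eta gamma u - 2 / (gamma - 1)) / (2 * k)) with (exp (- ((gamma - 1) / 2) * ln u)).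
  - rewrite ln_exp.
    replace (- (2 / (gamma + 1)) * ((gamma + 1) / (gamma - 1) * (- ((gamma - 1) / 2) * ln u))) with (ln u) by (field; lra).
    now apply exp_ln.
  - unfold eta, Rpower, k. field. lra.
Qed.

Lemma small_state z : (gamma + 1) / 2 * Rabs z <= / 2 ->
  / 2 <= root_speed z ^ 2 <= 2 /\
  exp (- (2 / (gamma + 1))) <= state_u z <= exp (2 / (gamma + 1)).
Proof.
  intros Hz. assert (HL := log_speed_le z).
  assert (Hl : Rabs (log_speed z) <= / 2) by lra. apply Rabs_le_between in Hl.
  (* Because [/ 2 < ln 2], a logarithm of size at most [/ 2] keeps the speed between [/ 2] and
     [2]. *)
  assert (H2 := ln_lt_2).
  split.
  - rewrite root_speed_sqr. split.
    + rewrite <- (exp_ln (/ 2)) by lra. apply exp_le_compat. rewrite ln_Rinv; lra.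
    + rewrite <- (exp_ln 2) by lra. apply exp_le_compat. lra.
  - assert (Hg : 0 < 2 / (gamma + 1)) by (apply Rdiv_lt_0_compat; lra).
    unfold state_u. split; apply exp_le_compat; set (q := 2 / (gamma + 1)) in *.
    + assert (q * log_speed z <= q * 1) by (apply Rmult_le_compat_l; lra). lra.
    + assert (q * - log_speed z <= q * 1) by (apply Rmult_le_compat_l; lra). lra.
Qed.

Lemma coupling_le z : (gamma + 1) / 2 * Rabs z <= / 2 -> Rabs (coupling z) <= Rabs z / 2.
Proof.
  intros Hz. unfold coupling.
  replace (Rabs z / 2) with (/ 2 * Rabs (z - 0)) by (rewrite Rminus_0_r; field).
  apply Rabs_RInt_le.
  - intros y. apply (ex_derive_continuous (fun y => / (4 * root_speed y))).
    assert (ex_derive root_speed y) by (eexists; apply root_speed_derive).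
    auto_derive. split; [assumption|]. split; [|trivial]. generalize (root_speed_pos y). lra.
  - intros y Hy.
    assert (Hyz : Rabs y <= Rabs z).
    { unfold Rmin, Rmax, Rabs in *. repeat destruct Rle_dec; repeat destruct Rcase_abs; lra. }
    destruct (small_state y) as [H1 _].
    { eapply Rle_trans; [|exact Hz]. apply Rmult_le_compat_l; lra. }
    assert (Hp := root_speed_pos y).
    destruct (range_of_sqr (root_speed y)) as [Hr _]; [exact Hp | exact H1 |].
    rewrite Rabs_pos_eq by (apply Rlt_le, Rinv_0_lt_compat; lra).
    apply Rinv_le_contravar; lra.
Qed.
End StateFunctions.

(** * Power weights in time and the damping coefficient *)

Lemma Rpower_le_base_neg (a b q : R) : 0 < a -> a <= b -> 0 <= q -> Rpower b (- q) <= Rpower a (- q).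
Proof.
  intros Ha Hab Hq. unfold Rpower. apply exp_le_compat.
  assert (ln a <= ln b) by (apply ln_le; lra).
  rewrite <- !Ropp_mult_distr_l. apply Ropp_le_contravar, Rmult_le_compat_l; lra.
Qed.

Lemma Rpower_le_1_neg (a q : R) : 1 <= a -> 0 <= q -> Rpower a (- q) <= 1.
Proof.
  intros Ha Hq. eapply Rle_trans; [apply (Rpower_le_base_neg 1 a q); lra|].
  unfold Rpower. rewrite ln_1, Rmult_0_r, exp_0. lra.
Qed.

Lemma is_derive_Rpower_shift (B q t : R) : 0 < B + t ->
  is_derive (fun t => Rpower (B + t) q) t (q * Rpower (B + t) (q - 1)).
Proof.
  intros H. evar_last.
  - apply (is_derive_comp (V := R_NormedModule) (fun s => Rpower s q) (fun t => B + t)).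
    + apply is_derive_Rpower, H.
    + auto_derive; [trivial | reflexivity].
  - unfold scal; simpl; unfold mult; simpl. ring.
Qed.

(* For [mu < 1] the shift [B] makes the decay rate [mu / (B + t)] of the weight a
   fraction of the damping from the start; for [mu = 1] this is exactly where
   [lambda > 2] is needed. *)
Lemma time_weight (mu lambda : R) :
  (0 <= mu < 1 /\ 0 < lambda) \/ (mu = 1 /\ 2 < lambda) ->
  exists B w, 1 <= B /\ 0 < w /\ forall t, 0 <= t ->
    w * Rpower (1 + t) (- mu) ^ 2 <=
    lambda / 2 * Rpower (1 + t) (- mu) * Rpower (B + t) (- mu) - mu * Rpower (B + t) (- mu - 1).
Proof.
  intros [[[Hmu Hmu1] Hla]|[-> Hla]].
  (* The power is chosen so that [(B + t)^(-(1 - mu))] is at most [lambda / 4]. *)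
  - set (B := 1 + Rpower (4 / lambda) (/ (1 - mu))).
    assert (Hq : 0 < Rpower (4 / lambda) (/ (1 - mu))) by apply exp_pos.
    assert (HB : 1 <= B) by (unfold B; lra).
    (* Half of the damping term absorbs [mu * (B + t)^(-mu - 1)]. The other half is bounded below
       through [B + t <= B * (1 + t)], which costs the factor [B^(-mu)]. *)
    exists B, (lambda / 4 * Rpower B (- mu)).
    assert (HBm : 0 < Rpower B (- mu)) by apply exp_pos.
    split; [exact HB|]. split; [apply Rmult_lt_0_compat; lra|].
    intros t Ht.
    set (d := Rpower (1 + t) (- mu)). set (b := Rpower (B + t) (- mu)).
    assert (Hd : 0 < d) by apply exp_pos. assert (Hb : 0 < b) by apply exp_pos.
    assert (Hbd : b <= d) by (apply Rpower_le_base_neg; lra).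
    assert (Hdb : Rpower B (- mu) * d <= b).
    { unfold d, b. rewrite Rpower_mult_distr by lra. apply Rpower_le_base_neg; try lra.
      assert (0 <= (B - 1) * t) by (apply Rmult_le_pos; lra). lra. }
    assert (Hr : Rpower (B + t) (- (1 - mu)) <= lambda / 4).
    { apply Rle_trans with (Rpower (Rpower (4 / lambda) (/ (1 - mu))) (- (1 - mu))).
      - apply Rpower_le_base_neg; unfold B; lra.
      - rewrite Rpower_mult. replace (/ (1 - mu) * - (1 - mu)) with (- (1)) by (field; lra).
        assert (H4 : 0 < 4 / lambda) by (apply Rdiv_lt_0_compat; lra).
        rewrite Rpower_Ropp, Rpower_1 by exact H4. right. field. lra. }
    assert (E : Rpower (B + t) (- mu - 1) = b * (b * Rpower (B + t) (- (1 - mu)))).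
    { unfold b. rewrite <- !Rpower_plus. f_equal. ring. }
    rewrite E.
    assert (T1 : mu * (b * (b * Rpower (B + t) (- (1 - mu)))) <= b * (d * (lambda / 4))).
    { assert (Hpp : 0 < Rpower (B + t) (- (1 - mu))) by apply exp_pos.
      apply Rle_trans with (1 * (b * (b * Rpower (B + t) (- (1 - mu))))).
      - apply Rmult_le_compat_r; [|lra]. apply Rlt_le, Rmult_lt_0_compat; [exact Hb|]. now apply Rmult_lt_0_compat.
      - rewrite Rmult_1_l. apply Rmult_le_compat_l; [lra|]. apply Rmult_le_compat; lra. }
    assert (T2 : lambda / 4 * d * (Rpower B (- mu) * d) <= lambda / 4 * d * b).
    { apply Rmult_le_compat_l; [|exact Hdb]. apply Rmult_le_pos; lra. }
    simpl. lra.
  - exists 1, (lambda / 2 - 1). split; [lra|]. split; [lra|]. intros t Ht.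
    assert (E : Rpower (1 + t) (- (1) - 1) = Rpower (1 + t) (- (1)) * Rpower (1 + t) (- (1))).
    { rewrite <- Rpower_plus. f_equal; ring. }
    rewrite E. right. ring.
Qed.

Section Damping.
Variables (mu lambda : R).
Hypothesis mu_range : 0 <= mu <= 1.
Hypothesis lambda_pos : 0 < lambda.

(** Frozen at its initial value for negative times: the truncated system lives on the whole plane,
    where [t] may take either sign, and needs a coefficient that is bounded and Lipschitz
    throughout. *)
Definition damping (t : R) : R := lambda * Rpower (1 + Rmax 0 t) (- mu).
Definition damping' (t : R) : R := lambda * (- mu * Rpower (1 + t) (- mu - 1)).
Definition half_energy (t : R) : R := exp (RInt (fun s => damping s / 2) 0 t).

Lemma damping_pos t : 0 < damping t.
Proof. apply Rmult_lt_0_compat; [exact lambda_pos | apply exp_pos]. Qed.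

Lemma damping_le t : damping t <= lambda.
Proof.
  unfold damping. rewrite <- (Rmult_1_r lambda) at 2. apply Rmult_le_compat_l; [lra|].
  apply Rpower_le_1_neg; [|lra]. generalize (Rmax_l 0 t). lra.
Qed.

Lemma damping_eq t : 0 <= t -> damping t = lambda * Rpower (1 + t) (- mu).
Proof. intros Ht. unfold damping. now rewrite Rmax_right. Qed.

Lemma damping_lip t s : Rabs (damping t - damping s) <= lambda * mu * Rabs (t - s).
Proof.
  assert (Hm : Rabs (Rmax 0 t - Rmax 0 s) <= Rabs (t - s)).
  { unfold Rmax. repeat destruct Rle_dec; unfold Rabs; repeat destruct Rcase_abs; lra. }
  eapply Rle_trans; [|apply Rmult_le_compat_l; [apply Rmult_le_pos; lra | exact Hm]].
  assert (Ht := Rmax_l 0 t). assert (Hs := Rmax_l 0 s).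
  unfold damping. set (a := Rmax 0 t) in *. set (b := Rmax 0 s) in *.
  assert (Hmn : 0 <= Rmin b a) by (apply Rmin_glb; lra).
  rewrite <- Rmult_minus_distr_l, Rabs_mult, (Rabs_pos_eq lambda) by lra.
  rewrite Rmult_assoc. apply Rmult_le_compat_l; [lra|].
  destruct (MVT_gen (fun t => Rpower (1 + t) (- mu)) b a (fun t => - mu * Rpower (1 + t) (- mu - 1))) as [c [Hc E]].
  - intros x Hx. apply is_derive_Rpower_shift. lra.
  - intros x Hx. apply continuity_pt_filterlim.
    eapply (is_derive_continuous (fun t => Rpower (1 + t) (- mu))), is_derive_Rpower_shift. lra.
  - rewrite E, Rabs_mult. apply Rmult_le_compat_r; [apply Rabs_pos|].
    rewrite Rabs_mult, Rabs_Ropp, (Rabs_pos_eq mu) by lra.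
    rewrite Rabs_pos_eq by (apply Rlt_le, exp_pos).
    replace (- mu - 1) with (- (mu + 1)) by ring.
    assert (H1 : Rpower (1 + c) (- (mu + 1)) <= 1) by (apply Rpower_le_1_neg; lra).
    apply (Rmult_le_compat_l mu) in H1; lra.
Qed.

Lemma damping_cont t : continuous damping t.
Proof. apply (continuous_lip damping _ damping_lip). Qed.

Lemma damping_derive t : 0 < t -> is_derive damping t (damping' t).
Proof.
  intros Ht. apply (is_derive_ext_loc (fun t => lambda * Rpower (1 + t) (- mu))).
  - exists (mkposreal t Ht). intros s Hs. change (Rabs (s - t) < t) in Hs. apply Rabs_def2 in Hs.
    symmetry. apply damping_eq. lra.
  - apply (is_derive_scal (fun t => Rpower (1 + t) (- mu))). apply is_derive_Rpower_shift. lra.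
Qed.

(** Because [mu <= 1], the power [-mu - 1] is at most [-2 mu]: the derivative of the damping decays
    at least as fast as its square. *)
Lemma damping'_bound t : 0 <= t -> Rabs (damping' t) <= lambda * mu * Rpower (1 + t) (- mu) ^ 2.
Proof.
  intros Ht. unfold damping'. rewrite !Rabs_mult, Rabs_Ropp, (Rabs_pos_eq lambda), (Rabs_pos_eq mu) by lra.
  rewrite Rmult_assoc. apply Rmult_le_compat_l; [lra|]. apply Rmult_le_compat_l; [lra|].
  rewrite Rabs_pos_eq by (apply Rlt_le, exp_pos).
  simpl. rewrite Rmult_1_r, <- Rpower_plus.
  apply Rle_Rpower; lra.
Qed.

Lemma half_energy_derive t : is_derive half_energy t (damping t / 2 * half_energy t).
Proof.
  assert (Hc : forall s, continuous (fun s => damping s / 2) s).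
  { intros s. apply (continuous_ext (fun s => / 2 * damping s)); [intros; apply Rmult_comm|].
    apply (continuous_scal_r (V := R_NormedModule) (/ 2) damping), damping_cont. }
  apply (is_derive_comp (V := R_NormedModule) exp (fun t => RInt (fun s => damping s / 2) 0 t)).
  - apply is_derive_exp.
  - apply (is_derive_RInt_cont (fun s => damping s / 2)), Hc.
Qed.

Lemma half_energy_0 : half_energy 0 = 1.
Proof. unfold half_energy. rewrite RInt_point. apply exp_0. Qed.
End Damping.

(** * Global existence and decay *)

(** Every term of the barrier inequality is compared with [(1 + t)^(-2 mu)], so it reduces to one
    inequality between constants, uniform in [t] and [T]. The final constant arises as twice
    [beta + damping * M], for the gradient, plus [damping * M], for the damping term in the time
    derivatives. *)
Lemma solution_on_strip (gamma mu lambda B K w M : R) (u0 v0 dv0 dth0 : R -> R) :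
  1 < gamma -> 0 <= mu <= 1 -> 0 < lambda -> 1 <= B -> 0 < K -> 0 <= M ->
  (forall t, 0 <= t -> w * Rpower (1 + t) (- mu) ^ 2 <=
    lambda / 2 * Rpower (1 + t) (- mu) * Rpower (B + t) (- mu) - mu * Rpower (B + t) (- mu - 1)) ->
  (gamma + 1) / 2 * (2 * M) <= / 2 -> 2 * M <= 2 / (gamma - 1) ->
  2 * M + lambda * M < K * Rpower B (- mu) ->
  2 * ((gamma + 1) / 2) * (K + lambda * M) ^ 2 + (lambda ^ 2 / 2 + lambda * mu) * M < K * w ->
  (forall x, 0 < u0 x) ->
  (forall x, is_derive v0 x (dv0 x)) -> (forall x, continuous dv0 x) ->
  (forall x, is_derive (fun x => 2 * (eta gamma (u0 x) - 2 / (gamma - 1))) x (dth0 x)) ->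
  (forall x, continuous dth0 x) ->
  (forall x, Rabs (v0 x) + Rabs (2 * (eta gamma (u0 x) - 2 / (gamma - 1))) / 2 <= M) ->
  (forall x, Rabs (dv0 x) + Rabs (dth0 x) / 2 <= M) ->
  forall T, 0 < T -> exists u v rt rx st sx,
    is_solution gamma mu lambda u0 v0 T u v /\
    riemann_derivative_bounds gamma u v (strip T)
      (fun t => (2 * K + 3 * (lambda * M)) * Rpower (1 + t) (- mu)) rt rx st sx.
Proof.
  intros Hg Hmu Hla HB HK HM Hw HM1 HM2 Hini Hbar Hu0 Dv Cdv Dth Cdth HdM Hd'M T HT.
  set (th0 := fun x => 2 * (eta gamma (u0 x) - 2 / (gamma - 1))) in *.
  assert (HlM : 0 <= lambda * M) by (apply Rmult_le_pos; lra).
  assert (Hsmall : forall z, Rabs z <= 2 * M -> (gamma + 1) / 2 * Rabs z <= / 2).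
  { intros z Hz. eapply Rle_trans; [|exact HM1]. apply Rmult_le_compat_l; lra. }
  set (beta := fun t => K * Rpower (B + t) (- mu)).
  set (beta' := fun t => K * (- mu * Rpower (B + t) (- mu - 1))).
  assert (Dbeta : forall t, 0 <= t -> is_derive beta t (beta' t)).
  { intros t Ht. apply (is_derive_scal (fun t => Rpower (B + t) (- mu))). apply is_derive_Rpower_shift. lra. }
  assert (Hb0 : forall t, 0 < beta t) by (intros; apply Rmult_lt_0_compat; [lra | apply exp_pos]).
  assert (Hbd : forall t, 0 <= t -> beta t <= K * Rpower (1 + t) (- mu)).
  { intros t Ht. apply Rmult_le_compat_l; [lra|]. apply Rpower_le_base_neg; lra. }
  assert (Hd1 : forall t, 0 <= t -> 0 < Rpower (1 + t) (- mu) <= 1).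
  { intros t Ht. split; [apply exp_pos | apply Rpower_le_1_neg; lra]. }
  assert (Hpm : forall y z, Rabs y + Rabs z / 2 <= M -> Rabs (y - z / 2) <= M /\ Rabs (y + z / 2) <= M).
  { intros y z H. assert (Rabs (z / 2) = Rabs z / 2).
    { unfold Rdiv. rewrite Rabs_mult, (Rabs_pos_eq (/ 2)) by lra. reflexivity. }
    split; (eapply Rle_trans; [apply Rabs_triang|]); rewrite ?Rabs_Ropp; lra. }
  assert (Hbnd : forall t, 0 <= t -> 0 <= beta t + damping mu lambda t * M
            <= (K + lambda * M) * Rpower (1 + t) (- mu)).
  { intros t Ht. rewrite damping_eq by exact Ht. specialize (Hb0 t). specialize (Hbd t Ht).
    destruct (Hd1 t Ht) as [h1 h2]. set (d := Rpower (1 + t) (- mu)) in *.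
    assert (0 <= lambda * d * M) by (apply Rmult_le_pos; [apply Rmult_le_pos|]; lra). lra. }
  destruct (strip_solution_exists (kap gamma) (damping mu lambda) (damping' mu lambda) (root_speed gamma)
    (coupling gamma) (half_energy mu lambda) beta beta' ((gamma + 1) / 2)
    ((gamma + 1) / 4 * (4 / (2 * (2 / (gamma - 1))))) lambda (lambda * mu) M M M (K + lambda * M)
    (kap_bound gamma Hg) (kap_lip gamma Hg)
    (fun t => ltac:(rewrite Rabs_pos_eq by (apply Rlt_le, damping_pos; exact Hla); apply damping_le; assumption))
    (damping_lip mu lambda Hmu Hla)
    (fun t => Rlt_le _ _ (damping_pos mu lambda Hla t))
    (damping_derive mu lambda)
    (root_speed_derive gamma Hg) (root_speed_pos gamma) (coupling_derive gamma Hg)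
    (half_energy_derive mu lambda Hmu Hla) (fun t => exp_pos _) (half_energy_0 mu lambda)
    (fun z Hz => proj1 (small_state gamma Hg z (Hsmall z Hz))) HM) with (v0 := v0) (dv0 := dv0) (th0 := th0) (dth0 := dth0) (W := 4 * T)
    as (ell & Lam & P & Q & Y & V & th & t & v & x & vb & xb & S).
  (* Here [Gm = M], since [coupling] grows at rate at most [1/2] and [Rabs z <= 2 * M]. *)
  - intros z Hz. eapply Rle_trans; [apply coupling_le; [exact Hg | now apply Hsmall]|]. lra.
  - intros s Hs. eapply is_derive_continuous, Dbeta, Hs.
  - intros s Hs. apply Dbeta. lra.
  - intros s Hs. now apply Rlt_le.
  - intros s Hs. assert (Hs' : 0 <= s) by lra.
    assert (Hws := Hw s Hs'). assert (Hds := damping'_bound mu lambda Hmu Hla s Hs').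
    destruct (Hbnd s Hs') as [n1 n2]. destruct (Hd1 s Hs') as [h1 h2].
    assert (E : damping mu lambda s / 2 * beta s + beta' s =
      K * (lambda / 2 * Rpower (1 + s) (- mu) * Rpower (B + s) (- mu) - mu * Rpower (B + s) (- mu - 1))).
    { rewrite damping_eq by exact Hs'. unfold beta, beta'. field. }
    rewrite E. rewrite damping_eq in * by exact Hs'. set (d := Rpower (1 + s) (- mu)) in *.
    apply Rlt_le_trans with (K * w * d ^ 2).
    2:{ rewrite Rmult_assoc. apply Rmult_le_compat_l; [lra | exact Hws]. }
    assert (Hd2 : 0 < d ^ 2) by (apply pow_lt; lra).
    assert (T1 : (beta s + lambda * d * M) ^ 2 <= (K + lambda * M) ^ 2 * d ^ 2).
    { rewrite <- Rpow_mult_distr. apply pow_incr. lra. }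
    assert (T2 : 2 * ((gamma + 1) / 2) * (beta s + lambda * d * M) ^ 2
                 <= 2 * ((gamma + 1) / 2) * ((K + lambda * M) ^ 2 * d ^ 2)).
    { apply Rmult_le_compat_l; lra. }
    assert (T3 : ((lambda * d) ^ 2 / 2 + Rabs (damping' mu lambda s)) * M
              <= (lambda ^ 2 / 2 + lambda * mu) * M * d ^ 2).
    { replace ((lambda ^ 2 / 2 + lambda * mu) * M * d ^ 2)
        with (((lambda * d) ^ 2 / 2 + lambda * mu * d ^ 2) * M) by field.
      apply Rmult_le_compat_r; lra. }
    apply (Rmult_lt_compat_r (d ^ 2)) in Hbar; [|exact Hd2]. lra.
  - intros s Hs. destruct (Hbnd s Hs) as [n1 n2]. destruct (Hd1 s Hs) as [h1 h2].
    assert ((K + lambda * M) * Rpower (1 + s) (- mu) <= (K + lambda * M) * 1) by (apply Rmult_le_compat_l; lra).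
    lra.
  - exact Dv.
  - exact Dth.
  - exact Cdv.
  - exact Cdth.
  - intros z. apply Hpm, HdM.
  - intros z. apply Hpm, HdM.
  - intros z. apply Hpm, Hd'M.
  - intros z. apply Hpm, Hd'M.
  - rewrite damping_eq by lra. unfold beta. rewrite !Rplus_0_r.
    replace (Rpower 1 (- mu)) with 1; [lra|]. unfold Rpower. now rewrite ln_1, Rmult_0_r, exp_0.
  - lra.
  - destruct (strip_to_solution gamma mu lambda _ _ _ _ _ _ (state_u gamma)
      (fun z => - (2 / (gamma + 1)) * kap gamma z * state_u gamma z)
      (fun z => 2 / (gamma + 1) * kap gamma z * exp (2 * gamma / (gamma + 1) * log_speed gamma z))
      M T ell Lam (K + lambda * M) (exp (- (2 / (gamma + 1)))) (exp (2 / (gamma + 1)))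
      P Q Y V th t v x vb xb S HT HM (root_speed_pos gamma))
      as (uu & ww & rt & rx & st & sx & Hsol & Hbounds).
    + intros z. eapply is_derive_continuous, root_speed_derive, Hg.
    + intros z Hz. apply (small_state gamma Hg), Hsmall, Hz.
    + intros s Hs. destruct (Hbnd s Hs) as [n1 n2]. destruct (Hd1 s Hs) as [h1 h2].
      assert ((K + lambda * M) * Rpower (1 + s) (- mu) <= (K + lambda * M) * 1) by (apply Rmult_le_compat_l; lra).
      lra.
    + intros s Hs. rewrite damping_eq by exact Hs. now rewrite Rpower_Ropp.
    + intros s. now apply Rlt_le, damping_pos.
    + intros s. apply damping_le; assumption.
    + intros z. apply state_u_derive, Hg.
    + intros z. apply (continuous_mult (K := R_AbsRing)).
      * apply (continuous_scal_r (V := R_NormedModule) (- (2 / (gamma + 1))) (kap gamma)), kap_cont, Hg.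
      * eapply is_derive_continuous, state_u_derive, Hg.
    + intros z Hz. apply state_u_derive_eq; [exact Hg | lra].
    + intros z. apply pressure_state_u_derive, Hg.
    + intros z. apply (continuous_mult (K := R_AbsRing)).
      * apply (continuous_scal_r (V := R_NormedModule) (2 / (gamma + 1)) (kap gamma)), kap_cont, Hg.
      * eapply is_derive_continuous, exp_log_speed_derive, Hg.
    + intros z Hz. apply pressure_state_u_derive_eq; [exact Hg | lra].
    + intros z Hz. apply (small_state gamma Hg), Hsmall, Hz.
    + apply exp_pos.
    + intros z Hz. apply eta_state_u; [exact Hg | lra].
    + exists uu, ww, rt, rx, st, sx. split.
      * apply (is_solution_mono gamma mu lambda (fun z => state_u gamma (th0 z)) v0 u0 v0 T T uu ww); auto; [lra|].
        intros z. split; [|reflexivity]. apply state_u_eta; [exact Hg | apply Hu0|].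
        specialize (HdM z). fold (th0 z) in HdM |- *.
        assert (Hv0 := Rabs_pos (v0 z)). change (2 * (eta gamma (u0 z) - 2 / (gamma - 1))) with (th0 z). lra.
      * intros s y Hs. destruct (Hbounds s y Hs) as (d1 & d2 & d3 & d4 & b1 & b2 & b3 & b4).
        destruct (Hbnd s (proj1 Hs)) as [n1 n2]. destruct (Hd1 s (proj1 Hs)) as [h1 h2].
        rewrite damping_eq in * by apply Hs.
        assert (Hle : 2 * (beta s + lambda * Rpower (1 + s) (- mu) * M) + lambda * Rpower (1 + s) (- mu) * M
          <= (2 * K + 3 * (lambda * M)) * Rpower (1 + s) (- mu)) by lra.
        cbv beta in b1, b2, b3, b4.
        repeat (split; [assumption || lra|]); lra.
Qed.

Lemma Linfty_norm_pair_le (f g : R -> R) (b : R) :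
  (forall x, Rabs (f x) <= b) -> (forall x, Rabs (g x) <= b) ->
  Rbar_le (Linfty_norm (fun x => (f x, g x))) (Finite (2 * b)).
Proof.
  intros Hf Hg. apply (proj2 (Lub_Rbar_correct _)). intros y [x ->]. simpl.
  change (sqrt (Rabs (f x) ^ 2 + Rabs (g x) ^ 2) <= 2 * b).
  assert (Hf' := Hf x). assert (Hg' := Hg x). assert (F0 := Rabs_pos (f x)). assert (G0 := Rabs_pos (g x)).
  rewrite <- (sqrt_pow2 (2 * b)) by lra. apply sqrt_le_1_alt.
  assert (F2 : Rabs (f x) ^ 2 <= b ^ 2) by (apply pow_incr; lra).
  assert (G2 : Rabs (g x) ^ 2 <= b ^ 2) by (apply pow_incr; lra).
  replace ((2 * b) ^ 2) with (4 * b ^ 2) by ring. generalize (pow2_ge_0 b). lra.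
Qed.

Lemma Rle_inv_mult (e a : R) : 0 < a -> e <= / a -> a * e <= 1.
Proof.
  intros Ha He. apply (Rmult_le_compat_l a) in He; [|lra]. rewrite Rinv_r in He by lra. exact He.
Qed.

Lemma eta_1 (gamma : R) : eta gamma 1 = 2 / (gamma - 1).
Proof. unfold eta, Rpower. rewrite ln_1, Rmult_0_r, exp_0. ring. Qed.

Lemma eta_near_1 (gamma : R) : 1 < gamma ->
  exists C, 0 < C /\ forall u, Rabs (u - 1) <= / 2 ->
    speed gamma u <= C /\ Rabs (eta gamma u - 2 / (gamma - 1)) <= C * Rabs (u - 1).
Proof.
  intros Hg. destruct (speed_eta_lipschitz gamma (/ 2) (3 / 2) Hg ltac:(lra)) as (C & HC & _ & Hs).
  exists C. split; [exact HC|]. intros u Hu. apply Rabs_le_between in Hu.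
  split; [apply Hs; lra|]. rewrite <- eta_1.
  assert (Hm1 : / 2 <= Rmin 1 u) by (apply Rmin_glb; lra).
  assert (Hm2 : Rmax 1 u <= 3 / 2) by (apply Rmax_lub; lra).
  destruct (MVT_gen (eta gamma) 1 u (fun u => - speed gamma u)) as [c [Hc E]].
  - intros y Hy. apply is_derive_eta; lra.
  - intros y Hy. apply continuity_pt_filterlim. eapply is_derive_continuous, is_derive_eta; lra.
  - rewrite E, Rabs_mult, Rabs_Ropp, (Rabs_pos_eq (speed gamma c)) by apply Rlt_le, speed_pos.
    apply Rmult_le_compat_r; [apply Rabs_pos | apply Hs; lra].
Qed.

Theorem theorem1p2 (gamma mu lambda : R) (phi psi : R -> R)
    (hgamma : 1 < gamma) (hphi : C1b_line phi) (hpsi : C1b_line psi)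
    (hdamp : (0 <= mu < 1 /\ 0 < lambda) \/ (mu = 1 /\ 2 < lambda)) :
  exists eps0 K : R, 0 < eps0 /\ 0 < K /\
    forall eps : R, 0 < eps <= eps0 ->
      exists u v : R -> R -> R,
        is_global_solution gamma mu lambda
          (fun x => 1 + eps * phi x) (fun x => eps * psi x) u v /\
        (forall u' v' : R -> R -> R,
           is_global_solution gamma mu lambda
             (fun x => 1 + eps * phi x) (fun x => eps * psi x) u' v' ->
           forall t x, 0 <= t -> u' t x = u t x /\ v' t x = v t x) /\
        exists rt rx st sx : R -> R -> R,
          (forall t x, 0 <= t ->
             is_dt half_plane (riemann_r gamma u v) t x (rt t x) /\
             is_dx half_plane (riemann_r gamma u v) t x (rx t x) /\
             is_dt half_plane (riemann_s gamma u v) t x (st t x) /\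
             is_dx half_plane (riemann_s gamma u v) t x (sx t x)) /\
          forall t, 0 <= t ->
            Rbar_le
              (Rbar_plus (Linfty_norm (fun x => (rt t x, st t x)))
                         (Linfty_norm (fun x => (rx t x, sx t x))))
              (Finite (K * eps * Rpower (1 + t) (- mu))).
Proof.
  assert (Hmu : 0 <= mu <= 1) by lra. assert (Hla : 0 < lambda) by lra.
  destruct hphi as (_ & [A0 HA0] & phi' & Dphi & Cphi & [A1 HA1]).
  destruct hpsi as (_ & [B0 HB0] & psi' & Dpsi & Cpsi & [B1 HB1]).
  assert (PA0 : 0 <= A0) by (eapply Rle_trans; [apply Rabs_pos | apply (HA0 0)]).
  assert (PA1 : 0 <= A1) by (eapply Rle_trans; [apply Rabs_pos | apply (HA1 0)]).
  assert (PB0 : 0 <= B0) by (eapply Rle_trans; [apply Rabs_pos | apply (HB0 0)]).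
  assert (PB1 : 0 <= B1) by (eapply Rle_trans; [apply Rabs_pos | apply (HB1 0)]).
  destruct (eta_near_1 gamma hgamma) as (C & HC & Heta).
  destruct (time_weight mu lambda hdamp) as (B & w & HB & Hw & Hweight).
  assert (PCA0 : 0 <= C * A0) by (apply Rmult_le_pos; lra).
  assert (PCA1 : 0 <= C * A1) by (apply Rmult_le_pos; lra).
  (* [m * eps] dominates the initial invariants and their slopes; [C] bounds the wave speed near
     [u = 1], and the summand [1] makes [m] positive. *)
  set (m := (B0 + C * A0) + (B1 + C * A1) + 1).
  assert (Hm : 0 < m) by (unfold m; lra).
  assert (HBmu : 0 < Rpower B (- mu)) by apply exp_pos.
  set (f := (lambda ^ 2 / 2 + lambda * mu) * m).
  assert (Hf : 0 <= f).
  { apply Rmult_le_pos; [|lra]. apply Rplus_le_le_0_compat.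
    - generalize (pow2_ge_0 lambda). lra.
    - apply Rmult_le_pos; lra. }
  set (g := (2 + lambda) * m). assert (Hg : 0 < g) by (apply Rmult_lt_0_compat; lra).
  (* Chosen before [eps]. The first summand lets [K * w] exceed the linear coefficient [f] of the
     barrier inequality, with a margin [2] for the quadratic term; the second puts the barrier above
     the initial gradient. *)
  set (K := (f + 2) / w + g / Rpower B (- mu) + 1).
  assert (K1 : 0 < (f + 2) / w) by (apply Rdiv_lt_0_compat; lra).
  assert (K2 : 0 < g / Rpower B (- mu)) by (apply Rdiv_lt_0_compat; lra).
  assert (HK : 0 < K) by (unfold K; lra).
  assert (HKw : f + 2 <= K * w).
  { replace (f + 2) with ((f + 2) / w * w) by (field; lra). apply Rmult_le_compat_r; unfold K; lra. }
  assert (HKB : g < K * Rpower B (- mu)).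
  { replace g with (g / Rpower B (- mu) * Rpower B (- mu)) at 1 by (field; lra).
    apply Rmult_lt_compat_r; unfold K; lra. }
  assert (HlM : 0 <= lambda * m) by (apply Rmult_le_pos; lra).
  set (q := (gamma + 1) * (K + lambda * m) ^ 2).
  assert (Hq : 0 < q) by (apply Rmult_lt_0_compat; [lra | apply pow_lt; lra]).
  (* [e1] keeps [u0] within [1/2] of [1], [e2] keeps the wave speed between [1/2] and [2], [e3]
     keeps [theta] in the range where the state functions follow the gas law, and [e4] makes the
     quadratic term at most [1] after division by [eps]. *)
  set (e1 := / (2 * (A0 + 1))). set (e2 := / (2 * (gamma + 1) * m)). set (e3 := / ((gamma - 1) * m)).
  set (e4 := / q).
  assert (P2 : 0 < 2 * (gamma + 1) * m) by (apply Rmult_lt_0_compat; lra).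
  assert (P3 : 0 < (gamma - 1) * m) by (apply Rmult_lt_0_compat; lra).
  (* The factor [4] collects the two norms, each of which is at most twice the bound on the
     components of its pair. *)
  exists (Rmin (Rmin e1 e2) (Rmin e3 e4)), (4 * (2 * K + 3 * (lambda * m))).
  split; [|split; [lra|]].
  { repeat apply Rmin_pos; apply Rinv_0_lt_compat; lra. }
  intros eps [Heps Heps0].
  assert (E1 : 2 * (A0 + 1) * eps <= 1).
  { apply Rle_inv_mult; [lra|]. eapply Rle_trans; [exact Heps0|]. eapply Rle_trans; [apply Rmin_l | apply Rmin_l]. }
  assert (E2 : 2 * (gamma + 1) * m * eps <= 1).
  { apply Rle_inv_mult; [lra|]. eapply Rle_trans; [exact Heps0|]. eapply Rle_trans; [apply Rmin_l | apply Rmin_r]. }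
  assert (E3 : (gamma - 1) * m * eps <= 1).
  { apply Rle_inv_mult; [lra|]. eapply Rle_trans; [exact Heps0|]. eapply Rle_trans; [apply Rmin_r | apply Rmin_l]. }
  assert (E4 : q * eps <= 1).
  { apply Rle_inv_mult; [lra|]. eapply Rle_trans; [exact Heps0|]. eapply Rle_trans; [apply Rmin_r | apply Rmin_r]. }
  set (u0 := fun x => 1 + eps * phi x). set (v0 := fun x => eps * psi x).
  assert (Habs : forall y b, Rabs y <= b -> Rabs (eps * y) <= eps * b).
  { intros y b Hy. rewrite Rabs_mult, (Rabs_pos_eq eps) by lra. apply Rmult_le_compat_l; lra. }
  assert (Hu1 : forall x, Rabs (u0 x - 1) <= eps * A0).
  { intros x. unfold u0. replace (1 + eps * phi x - 1) with (eps * phi x) by ring. apply Habs, HA0. }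
  assert (Hu2 : forall x, Rabs (u0 x - 1) <= / 2).
  { intros x. eapply Rle_trans; [apply Hu1|]. lra. }
  assert (Hupos : forall x, 0 < u0 x).
  { intros x. generalize (Hu2 x). intros H. apply Rabs_le_between in H. lra. }
  assert (Du0 : forall x, is_derive u0 x (eps * phi' x)).
  { intros x. unfold u0. rewrite <- (Rplus_0_l (eps * phi' x)).
    apply (is_derive_plus (V := R_NormedModule)); [apply (is_derive_const (V := R_NormedModule))|].
    apply (is_derive_scal phi), Dphi. }
  set (bnd := fun t => (2 * (K * eps) + 3 * (lambda * (m * eps))) * Rpower (1 + t) (- mu)).
  assert (Hstrips := solution_on_strip gamma mu lambda B (K * eps) w (m * eps) u0 v0
    (fun x => eps * psi' x) (fun x => 2 * (- speed gamma (u0 x) * (eps * phi' x)))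
    hgamma Hmu Hla HB ltac:(apply Rmult_lt_0_compat; lra) ltac:(apply Rmult_le_pos; lra) Hweight).
  destruct (global_of_strips gamma mu lambda u0 v0 bnd hgamma) as (u & v & rt & rx & st & sx & Hsol & Hbd); [lra | lra | |].
  { apply Hstrips; clear Hstrips; auto.
    - lra.
    - apply Rmult_le_reg_r with (gamma - 1); [lra|].
      replace (2 / (gamma - 1) * (gamma - 1)) with 2 by (field; lra). lra.
    - replace (2 * (m * eps) + lambda * (m * eps)) with (g * eps) by (unfold g; ring).
      replace (K * eps * Rpower B (- mu)) with (K * Rpower B (- mu) * eps) by ring.
      apply Rmult_lt_compat_r; lra.
    - replace (2 * ((gamma + 1) / 2) * (K * eps + lambda * (m * eps)) ^ 2 +
         (lambda ^ 2 / 2 + lambda * mu) * (m * eps)) with ((q * eps + f) * eps) by (unfold q, f; field).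
      replace (K * eps * w) with (K * w * eps) by ring.
      apply Rmult_lt_compat_r; lra.
    - intros x. apply (is_derive_scal psi), Dpsi.
    - intros x. apply (continuous_scal_r (V := R_NormedModule) eps psi'), Cpsi.
    - intros x. apply (is_derive_scal (fun x => eta gamma (u0 x) - 2 / (gamma - 1))).
      evar_last.
      + apply (is_derive_minus (V := R_NormedModule) (fun x => eta gamma (u0 x))).
        * apply (is_derive_comp (V := R_NormedModule) (eta gamma) u0); [apply is_derive_eta; auto | apply Du0].
        * apply (is_derive_const (V := R_NormedModule)).
      + unfold minus, plus, opp, scal, zero; simpl. unfold mult; simpl. ring.
    - intros x. apply (continuous_scal_r (V := R_NormedModule) 2 (fun x => - speed gamma (u0 x) * (eps * phi' x))).
      apply (continuous_mult (K := R_AbsRing)).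
      + apply (continuous_opp (V := R_NormedModule) (fun x => speed gamma (u0 x))).
        apply (continuous_comp u0 (speed gamma)).
        * eapply is_derive_continuous, Du0.
        * eapply is_derive_continuous, is_derive_Rpower, Hupos.
      + apply (continuous_scal_r (V := R_NormedModule) eps phi'), Cphi.
    - intros x. destruct (Heta (u0 x) (Hu2 x)) as [_ He].
      assert (T1 : C * Rabs (u0 x - 1) <= C * (eps * A0)) by (apply Rmult_le_compat_l; [lra | apply Hu1]).
      assert (T2 := Habs _ _ (HB0 x)). fold (v0 x) in T2.
      rewrite Rabs_mult, (Rabs_pos_eq 2) by lra.
      assert (T3 : eps * B0 + C * (eps * A0) <= m * eps).
      { replace (eps * B0 + C * (eps * A0)) with ((B0 + C * A0) * eps) by ring.
        apply Rmult_le_compat_r; unfold m; lra. }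
      lra.
    - intros x. destruct (Heta (u0 x) (Hu2 x)) as [Hs _]. assert (Hsp := speed_pos gamma (u0 x)).
      assert (T2 := Habs _ _ (HB1 x)). assert (T4 := Habs _ _ (HA1 x)).
      rewrite (Rabs_mult 2), (Rabs_pos_eq 2) by lra.
      rewrite (Rabs_mult (- speed gamma (u0 x))), Rabs_Ropp, (Rabs_pos_eq (speed gamma (u0 x))) by lra.
      assert (T1 : speed gamma (u0 x) * Rabs (eps * phi' x) <= C * (eps * A1)).
      { apply Rmult_le_compat; auto using Rabs_pos; lra. }
      assert (T3 : eps * B1 + C * (eps * A1) <= m * eps).
      { replace (eps * B1 + C * (eps * A1)) with ((B1 + C * A1) * eps) by ring.
        apply Rmult_le_compat_r; unfold m; lra. }
      lra. }
  exists u, v. split; [exact Hsol|]. split.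
  - intros u' v' Hsol' t x Ht.
    apply (solution_unique gamma mu lambda (t + 1) hgamma (proj1 Hmu) ltac:(lra) ltac:(lra) u0 v0); [| |lra].
    + apply Hsol'. lra.
    + apply Hsol. lra.
  - exists rt, rx, st, sx. split.
    + intros t x Ht. destruct (Hbd t x Ht) as (d1 & d2 & d3 & d4 & _). auto.
    + intros t Ht.
      assert (N1 : Rbar_le (Linfty_norm (fun x => (rt t x, st t x))) (2 * bnd t)).
      { apply Linfty_norm_pair_le; intros x; apply (Hbd t x Ht). }
      assert (N2 : Rbar_le (Linfty_norm (fun x => (rx t x, sx t x))) (2 * bnd t)).
      { apply Linfty_norm_pair_le; intros x; apply (Hbd t x Ht). }
      eapply Rbar_le_trans; [apply (Rbar_plus_le_compat _ _ _ _ N1 N2)|].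
      simpl. right. unfold bnd. ring.
Qed.
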